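(* Let $V$ be a Hilbert module over the Clifford algebra $\mathbb{R}_d$ and let $T\in\mathcal{K}(V)$ be bisectorial of angle $\omega\in(0,\frac{\pi}{2})$. Then for every $\theta\in(\omega,\frac{\pi}{2})$ and every $f\in\mathcal{SH}_L^0(D_\theta)$ or $f\in\mathcal{SH}_R^0(D_\theta)$, the $\omega$-functional calculi of $T^*$ and $T$ are connected via $$f(T^* )=f^\#(T)^*,\qquad f^\#(s):=\overline{f(\overline{s})}.$$ Here, if $f\in\mathcal{SH}_L^0(D_\theta)$, then $f(T^* )$ is the left and $f^\#(T)$ the right $\omega$-functional calculus; if $f\in\mathcal{SH}_R^0(D_\theta)$, then $f(T^* )$ is the right and $f^\#(T)$ the left $\omega$-functional calculus. If moreover $f\in\mathcal{N}(D_\theta)$ is intrinsic, then $f(T^* )=f(T)^*$.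
   Context: Clifford algebra: for $d\in\mathbb{N}$, $d\ge1$, $\mathbb{R}_d$ is the real Clifford algebra generated by $e_1,\dots,e_d$ with $e_i^2=-1$, $e_ie_j=-e_je_i$ for $i\neq j$, with real basis $e_A=e_{i_1}\cdots e_{i_r}$, $A=(i_1,\dots,i_r)$, $1\le i_1<\dots<i_r\le d$, $e_\emptyset=1$. For $s=\sum_As_Ae_A$: $\overline{s}=\sum_A(-1)^{|A|(|A|+1)/2}s_Ae_A$, $|s|^2=\sum_As_A^2$. Paravectors: $\mathbb{R}^{d+1}=\{s_0+s_1e_1+\dots+s_de_d\}$, $\operatorname{Im}(s)=s_1e_1+\dots+s_de_d$. $\mathbb{S}=\{J\in\mathbb{R}^{d+1}\mid J_0=0,|J|=1\}$, $\mathbb{C}_J=\{x+Jy\mid x,y\in\mathbb{R}\}$, $[s]=\{s_0+J|\operatorname{Im}(s)|\mid J\in\mathbb{S}\}$; $U\subseteq\mathbb{R}^{d+1}$ is axially symmetric if $[s]\subseteq U$ for all $s\in U$. Slice hyperholomorphic functions: for $U$ open, axially symmetric, let $\mathcal{U}=\{(x,y)\in\mathbb{R}^2\mid x+\mathbb{S}y\subseteq U\}$. $f:U\to\mathbb{R}_d$ is in $\mathcal{SH}_L(U)$ (resp. $\mathcal{SH}_R(U)$) if there are $C^1$ functions $f_0,f_1:\mathcal{U}\to\mathbb{R}_d$ with $f(x+Jy)=f_0(x,y)+Jf_1(x,y)$ (resp. $f(x+Jy)=f_0(x,y)+f_1(x,y)J$) for all $J\in\mathbb{S}$, $f_0(x,-y)=f_0(x,y)$,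 $f_1(x,-y)=-f_1(x,y)$, $\partial_xf_0=\partial_yf_1$, $\partial_yf_0=-\partial_xf_1$. If $f_0,f_1$ are real valued, $f$ is intrinsic, $f\in\mathcal{N}(U)$. Hilbert module: for a real Hilbert space $V_\mathbb{R}$, $V=\{\sum_Av_A\otimes e_A\mid v_A\in V_\mathbb{R}\}$ with $\|v\|^2=\sum_A\|v_A\|_\mathbb{R}^2$, $sv=\sum_{A,B}(s_Bv_A)\otimes(e_Be_A)$, $vs=\sum_{A,B}(v_As_B)\otimes(e_Ae_B)$, $\langle v,w\rangle=\sum_{A,B}\langle v_A,w_B\rangle_\mathbb{R}\overline{e_A}e_B$. $\mathcal{B}(V)$: bounded everywhere defined right-linear operators; $\mathcal{K}(V)$: closed right-linear operators $T:\operatorname{dom}(T)\subseteq V\to V$ (domain a right submodule). The adjoint of a densely defined right-linear $T$ has $\operatorname{dom}(T^* )=\{w\in V\mid\exists v_w\in V:\langle v_w,v\rangle=\langle w,Tv\rangle\ \forall v\in\operatorname{dom}(T)\}$, $T^*w=v_w$. Clifford numbers act on operators by left multiplication: $(sT)v=s(Tv)$, $(Ts)v=T(sv)$. $S$-spectrum: $Q_s[T]=T^2-2s_0T+|s|^2$ on $\operatorname{dom}(T^2)$, $\rho_S(T)=\{s\in\mathbb{R}^{d+1}\mid Q_s[T]^{-1}\in\mathcal{B}(V)\}$, $\sigma_S(T)=\mathbb{R}^{d+1}\setminus\rho_S(T)$; $S_L^{-1}(s,T)=Q_s[T]^{-1}\overline{s}-TQ_s[T]^{-1}$, $S_R^{-1}(s,T)=(\overline{s}-T)Q_s[T]^{-1}$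 for $s\in\rho_S(T)$. Double sector: $D_\omega=\{s\in\mathbb{R}^{d+1}\setminus\{0\}\mid\operatorname{Arg}(s)\in I_\omega\}$, $I_\omega=(-\omega,\omega)\cup(\pi-\omega,\pi+\omega)$, $\operatorname{Arg}(s)=\arccos(s_0/|s|)\in[0,\pi]$. Bisectorial: $T\in\mathcal{K}(V)$ is bisectorial of angle $\omega\in(0,\frac{\pi}{2})$ if $\sigma_S(T)\subseteq\overline{D_\omega}$ and for every $\varphi\in(\omega,\frac{\pi}{2})$ there is $C_\varphi\ge0$ with $\|S_L^{-1}(s,T)\|\le C_\varphi/|s|$ for all $s\in\mathbb{R}^{d+1}\setminus(D_\varphi\cup\{0\})$. (Such $T$ on a Hilbert module is densely defined and $T^*$ is bisectorial of the same angle, so both sides of the identity are defined; also $\|S_R^{-1}(s,T)\|\le2C_\varphi/|s|$ for the same $s$.) Function spaces: $\mathcal{SH}_L^0(D_\theta)$ (resp. $\mathcal{SH}_R^0(D_\theta)$) is the set of bounded $f\in\mathcal{SH}_L(D_\theta)$ (resp. $\mathcal{SH}_R(D_\theta)$) with $\int_0^\infty|f(te^{J\phi})|\frac{dt}{t}<\infty$ for all $J\in\mathbb{S}$, $\phi\in I_\theta$, where $e^{J\phi}=\cos\phi+J\sin\phi$. $\omega$-functional calculus: for $T$ bisectorial of angle $\omega$, $\theta\in(\omega,\frac\pi2)$, $f\in\mathcal{SH}_L^0(D_\theta)$ (resp. $\mathcal{SH}_R^0(D_\theta)$), $$f(T):=\frac{1}{2\pi}\int_{\partial D_\varphi\cap\mathbb{C}_J}S_L^{-1}(s,T)\,ds_J\,f(s)\qquad\Big(\text{resp.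 }f(T):=\frac{1}{2\pi}\int_{\partial D_\varphi\cap\mathbb{C}_J}f(s)\,ds_J\,S_R^{-1}(s,T)\Big),$$ with arbitrary $J\in\mathbb{S}$, $\varphi\in(\omega,\theta)$ (the value is independent of them, and for intrinsic $f$ both versions coincide). Here $ds_J:=-J\,ds$ and the path is positively oriented: the rays $\{te^{J\varphi}\}$ and $\{te^{J(\pi+\varphi)}\}$ are traversed from $\infty$ to $0$, the rays $\{te^{-J\varphi}\}$ and $\{te^{J(\pi-\varphi)}\}$ from $0$ to $\infty$, the point $0$ itself being omitted. The integrals converge absolutely in operator norm. *)

(* Defs.v *)
From HB Require Import structures.
From mathcomp Require Import all_boot all_order all_algebra.
From mathcomp Require Import all_classical all_reals all_analysis.

Set Implicit Arguments.
Unset Strict Implicit.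
Unset Printing Implicit Defensive.

Import Order.TTheory GRing.Theory Num.Theory.
Import numFieldNormedType.Exports.

Local Open Scope classical_set_scope.
Local Open Scope ring_scope.

(** * The Clifford algebra R_d *)

(* The coefficients (s_A)_A of s = \sum_A s_A e_A; the generators e_1, ..., e_d
   are indexed by 'I_d, and A runs over the subsets of 'I_d. *)
Definition clifford (R : realType) (d : nat) : Type := {ffun {set 'I_d} -> R^o}.
HB.instance Definition _ R d := GRing.Lmodule.on (clifford R d).

Section Clifford.
Context {R : realType} {d : nat}.
Local Notation Rd := (clifford R d).
Implicit Types (A B C : {set 'I_d}) (s t J : Rd).

Definition symdiff A B : {set 'I_d} := (A :\: B) :|: (B :\: A).

(* e_A e_B = basis_sign A B e_(symdiff A B): sorting the word e_A e_B costs one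
   sign for each pair (i, j) in A x B with j < i, and each common generator
   contributes e_i^2 = -1. *)
Definition basis_sign A B : R :=
  (-1) ^+ #|[set p in finset.setX A B | (p.2 <= p.1)%N]%SET|.

Definition cl_e A : Rd := [ffun B : {set 'I_d} => (B == A)%:R].

Definition cl_mul s t : Rd :=
  \sum_(A : {set 'I_d}) \sum_(B : {set 'I_d})
    (basis_sign A B * (s A * t B)) *: cl_e (symdiff A B).

Definition cl_conj s : Rd :=
  [ffun A : {set 'I_d} => (-1) ^+ 'C(#|A|.+1, 2) * s A].

Definition cl_norm s : R := Num.sqrt (\sum_(A : {set 'I_d}) s A ^+ 2).

Definition cl_real (x : R) : Rd := x *: cl_e finset.set0.

Definition Re0 s : R := s finset.set0.

Definition paravector : set Rd := [set s | forall A, (1 < #|A|)%N -> s A = 0].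

(* The sphere S of imaginary units. *)
Definition imag_unit : set Rd :=
  [set J | [/\ paravector J, Re0 J = 0 & cl_norm J = 1]].

Definition slice_pt (x y : R) J : Rd := cl_real x + y *: J.

(* e^(J phi) *)
Definition cl_exp J (phi : R) : Rd := slice_pt (cos phi) (sin phi) J.

Definition para_closure (U : set Rd) : set Rd :=
  [set s | paravector s /\
     forall eps : R, 0 < eps -> exists2 t, U t & cl_norm (s - t) < eps].

(* The defining relations of R_d, and e_A as the ordered product of its
   generators, follow from the definition of basis_sign. *)
Lemma cl_mul_basis A B :
  cl_mul (cl_e A) (cl_e B) = basis_sign A B *: cl_e (symdiff A B).
Proof.
rewrite /cl_mul (bigD1 A)//= [X in _ + X]big1 ?addr0 => [|A' nA].
  rewrite (bigD1 B)//= [X in _ + X]big1 ?addr0 => [|B' nB].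
    by rewrite !ffunE !eqxx !mulr1.
  by rewrite !ffunE (negbTE nB) !mulr0 scale0r.
by rewrite big1 // => B' _; rewrite !ffunE (negbTE nA) mul0r mulr0 scale0r.
Qed.

Lemma cl_e_sqr (i : 'I_d) :
  cl_mul (cl_e (finset.set1 i)) (cl_e (finset.set1 i)) = - cl_real 1.
Proof.
rewrite cl_mul_basis /basis_sign /symdiff finset.setDv finset.setU0.
have -> : [set p in finset.setX (finset.set1 i) (finset.set1 i)
            | (p.2 <= p.1)%N]%SET = (finset.set1 (i, i)).
  apply/finset.setP => -[a b]; rewrite !finset.inE/= xpair_eqE.
  by case: (a =P i) => [->|]; case: (b =P i) => [->|]//=; rewrite leqnn.
by rewrite finset.cards1 expr1 scaleN1r /cl_real scale1r.
Qed.

Lemma cl_e_anticomm (i j : 'I_d) : i != j ->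
  cl_mul (cl_e (finset.set1 i)) (cl_e (finset.set1 j)) =
  - cl_mul (cl_e (finset.set1 j)) (cl_e (finset.set1 i)).
Proof.
wlog ij : i j / (i < j)%N.
  move=> H ne; have [/H/(_ ne)//|ji|/val_inj e] := ltngtP i j.
    by rewrite (H j i) ?opprK // eq_sym.
  by rewrite e eqxx in ne.
move=> _; rewrite !cl_mul_basis /basis_sign.
have -> : [set p in finset.setX (finset.set1 i) (finset.set1 j)
            | (p.2 <= p.1)%N]%SET = finset.set0.
  apply/finset.setP => -[a b]; rewrite !finset.inE/=.
  by case: (a =P i) => [->|]; case: (b =P j) => [->|]//=; rewrite leqNgt ij.
have -> : [set p in finset.setX (finset.set1 j) (finset.set1 i)
            | (p.2 <= p.1)%N]%SET = finset.set1 (j, i).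
  apply/finset.setP => -[a b]; rewrite !finset.inE/= xpair_eqE.
  by case: (a =P j) => [->|]; case: (b =P i) => [->|]//=; rewrite ltnW.
rewrite finset.cards0 finset.cards1 expr0 expr1 scale1r scaleN1r opprK.
by rewrite /symdiff finset.setUC.
Qed.

Lemma cl_e_word A (i : 'I_d) : (forall j, j \in A -> (j < i)%N) ->
  cl_mul (cl_e A) (cl_e (finset.set1 i)) = cl_e (i |: A).
Proof.
move=> Ai; rewrite cl_mul_basis /basis_sign.
have -> : [set p in finset.setX A (finset.set1 i) | (p.2 <= p.1)%N]%SET
          = finset.set0.
  apply/finset.setP => -[a b]; rewrite !finset.inE/=.
  case aA: (a \in A) => //=; case: (b =P i) => [->|]//=.
  by rewrite leqNgt Ai.
rewrite finset.cards0 expr0 scale1r; congr cl_e.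
apply/finset.setP => a; rewrite !finset.inE.
case aA: (a \in A); case: (a =P i) => [e|]//=.
by rewrite e in aA; have := Ai _ aA; rewrite ltnn.
Qed.

End Clifford.

(** * Double sectors *)

Section Sector.
Context {R : realType} {d : nat}.
Local Notation Rd := (clifford R d).

Definition sector_angles (omega : R) : set R :=
  [set x | - omega < x < omega \/ pi - omega < x < pi + omega].

Definition Arg (s : Rd) : R := acos (Re0 s / cl_norm s).

Definition dsector (omega : R) : set Rd :=
  [set s | [/\ paravector s, s <> 0 & sector_angles omega (Arg s)]].

End Sector.

(** * Slice hyperholomorphic functions *)

(* These classes are meant for U open in the paravectors and axially symmetric,
   as is the case for dsector theta; functions are total, and only their values
   on U matter. *)

Section SliceHyperholomorphic.
Context {R : realType} {d : nat}.
Local Notation Rd := (clifford R d).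
Implicit Types (U : set Rd) (f : Rd -> Rd).

(* The set of the (x, y) such that x + S y is contained in U. *)
Definition slice_dom U : set (R * R) :=
  [set z | forall J : Rd, imag_unit J -> U (slice_pt z.1 z.2 J)].

Definition dx (g : R -> R -> Rd) (A : {set 'I_d}) (x y : R) : R :=
  derive1 (fun u : R => g u y A : R) x.
Definition dy (g : R -> R -> Rd) (A : {set 'I_d}) (x y : R) : R :=
  derive1 (fun u : R => g x u A : R) y.

(* C^1 on an open set W: continuous first partial derivatives. *)
Definition C1_on (W : set (R * R)) (g : R -> R -> Rd) : Prop :=
  forall (A : {set 'I_d}) (x y : R), W (x, y) ->
    [/\ derivable (fun u : R => g u y A : R) x 1,
        derivable (fun u : R => g x u A : R) y 1,
        {for (x, y), continuous (fun z : R * R => dx g A z.1 z.2)} &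
        {for (x, y), continuous (fun z : R * R => dy g A z.1 z.2)}].

Definition slice_pair U (f0 f1 : R -> R -> Rd) : Prop :=
  [/\ C1_on (slice_dom U) f0, C1_on (slice_dom U) f1 &
      forall x y : R, slice_dom U (x, y) ->
        [/\ f0 x (- y) = f0 x y, f1 x (- y) = - f1 x y,
            forall A, dx f0 A x y = dy f1 A x y &
            forall A, dy f0 A x y = - dx f1 A x y]].

Definition SH_L U f : Prop :=
  exists f0 f1 : R -> R -> Rd, slice_pair U f0 f1 /\
    forall x y J, slice_dom U (x, y) -> imag_unit J ->
      f (slice_pt x y J) = f0 x y + cl_mul J (f1 x y).

Definition SH_R U f : Prop :=
  exists f0 f1 : R -> R -> Rd, slice_pair U f0 f1 /\
    forall x y J, slice_dom U (x, y) -> imag_unit J ->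
      f (slice_pt x y J) = f0 x y + cl_mul (f1 x y) J.

Definition intrinsic U f : Prop :=
  exists g0 g1 : R -> R -> R,
    let f0 x y := cl_real (g0 x y) in
    let f1 x y := cl_real (g1 x y) in
    slice_pair U f0 f1 /\
    forall x y J, slice_dom U (x, y) -> imag_unit J ->
      f (slice_pt x y J) = f0 x y + cl_mul J (f1 x y).

Definition bounded_on U f : Prop :=
  exists M : R, forall s, U s -> cl_norm (f s) <= M.

Definition ray_integrable (theta : R) f : Prop :=
  forall (J : Rd) (phi : R), imag_unit J -> sector_angles theta phi ->
    (\int[lebesgue_measure]_(t in `]0%R, +oo[)
       (cl_norm (f (t *: cl_exp J phi)%R) / t)%:E < +oo)%E.

Definition SH0_L (theta : R) f : Prop :=
  [/\ SH_L (dsector theta) f, bounded_on (dsector theta) f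
    & ray_integrable theta f].

Definition SH0_R (theta : R) f : Prop :=
  [/\ SH_R (dsector theta) f, bounded_on (dsector theta) f
    & ray_integrable theta f].

Definition sharp f : Rd -> Rd := fun s => cl_conj (f (cl_conj s)).

End SliceHyperholomorphic.

(** * Hilbert modules *)

(* V = V_R (x) R_d, as families (v_A)_A; the real Hilbert space V_R is a
   complete normed module H whose norm comes from an inner product. *)
Definition hmod (R : realType) (d : nat) (H : completeNormedModType R) : Type :=
  {ffun {set 'I_d} -> H}.
HB.instance Definition _ R d H := GRing.Lmodule.on (@hmod R d H).

Section HilbertModule.
Context {R : realType} {d : nat} {H : completeNormedModType R}.
Variable ip : {dot H for @idfun R}.
Local Notation Rd := (clifford R d).
Local Notation V := (hmod d H).
Implicit Types (v w : V) (s t J : Rd).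

Definition norm_from_dot : Prop := forall x : H, `|x| ^+ 2 = ip x x.

(* x (x) e_A *)
Definition tens (x : H) (A : {set 'I_d}) : V :=
  [ffun B : {set 'I_d} => if B == A then x else 0].

Definition lact s v : V :=
  \sum_(A : {set 'I_d}) \sum_(B : {set 'I_d})
    tens ((basis_sign B A * s B) *: v A) (symdiff B A).

Definition ract v s : V :=
  \sum_(A : {set 'I_d}) \sum_(B : {set 'I_d})
    tens ((basis_sign A B * s B) *: v A) (symdiff A B).

Definition hnorm v : R := Num.sqrt (\sum_(A : {set 'I_d}) `|v A| ^+ 2).

Definition hinner v w : Rd :=
  \sum_(A : {set 'I_d}) \sum_(B : {set 'I_d})
    ip (v A) (w B) *: cl_mul (cl_conj (cl_e A)) (cl_e B).

(** ** Operators *)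

(* A partially defined operator; the values outside of the domain are
   meaningless. *)
Record oper := Oper { dom : set V ; oper_fun :> V -> V }.

Definition full_oper (A : V -> V) : oper := Oper setT A.

Definition oper_eq (S T : oper) : Prop :=
  dom S = dom T /\ forall v, dom T v -> S v = T v.

Definition right_linear (T : oper) : Prop :=
  [/\ dom T 0,
      forall v w, dom T v -> dom T w -> dom T (v + w) /\ T (v + w) = T v + T w &
      forall v s, dom T v -> dom T (ract v s) /\ T (ract v s) = ract (T v) s].

Definition closed_oper (T : oper) : Prop :=
  forall (u : nat -> V) v w, (forall n, dom T (u n)) ->
    (fun n => hnorm (u n - v)) @ \oo --> (0 : R) ->
    (fun n => hnorm (T (u n) - w)) @ \oo --> (0 : R) ->
    dom T v /\ T v = w.

(* K(V) *)
Definition in_K (T : oper) : Prop := right_linear T /\ closed_oper T.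

(* The operator norm of A is at most c. *)
Definition opnorm_le (A : V -> V) (c : R) : Prop :=
  forall v, hnorm (A v) <= c * hnorm v.

(* B(V) *)
Definition in_B (A : V -> V) : Prop :=
  right_linear (full_oper A) /\ exists c, opnorm_le A c.

(* For T densely defined the vector T^* w is unique. *)
Definition adjoint (T : oper) : oper :=
  let is_adj w u := forall v, dom T v -> hinner u v = hinner w (T v) in
  Oper [set w | exists u, is_adj w u] (fun w => xget 0 [set u | is_adj w u]).

(** ** The S-spectrum *)

Definition Q_op s (T : oper) : oper :=
  Oper [set v | dom T v /\ dom T (T v)]
       (fun v => T (T v) - (2 * Re0 s) *: T v + (cl_norm s ^+ 2) *: v).

Definition is_inverse (P : oper) (B : V -> V) : Prop :=
  (forall v, dom P (B v) /\ P (B v) = v) /\ (forall v, dom P v -> B (P v) = v).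

Definition S_resolvent_set (T : oper) : set Rd :=
  [set s | paravector s /\ exists B, in_B B /\ is_inverse (Q_op s T) B].

Definition S_spectrum (T : oper) : set Rd :=
  [set s | paravector s /\ ~ S_resolvent_set T s].

(* Q_s[T]^-1, meaningful for s in the S-resolvent set. *)
Definition Q_inv s (T : oper) (v : V) : V :=
  xget 0 [set u | dom (Q_op s T) u /\ Q_op s T u = v].

Definition SL_resolvent s (T : oper) (v : V) : V :=
  Q_inv s T (lact (cl_conj s) v) - T (Q_inv s T v).

Definition SR_resolvent s (T : oper) (v : V) : V :=
  lact (cl_conj s) (Q_inv s T v) - T (Q_inv s T v).

Definition bisectorial (omega : R) (T : oper) : Prop :=
  [/\ in_K T,
      S_spectrum T `<=` para_closure (dsector omega) &
      forall phi : R, omega < phi < pi / 2 ->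
        exists2 C : R, 0 <= C &
          forall s, paravector s -> ~ dsector phi s -> s <> 0 ->
            opnorm_le (SL_resolvent s T) (C / cl_norm s)].

(** ** Integration of operator valued functions *)

(* p 0 <= ... <= p n is a partition of [a, b] of mesh < delta, with tags xi. *)
Definition tagged_partition (a b delta : R) (n : nat) (p xi : nat -> R) : Prop :=
  [/\ p 0%N = a, p n = b &
      forall i, (i < n)%N -> p i <= xi i <= p i.+1 /\ p i.+1 - p i < delta].

(* A is the Riemann integral of F over [a, b], in operator norm. *)
Definition is_op_RInt (F : R -> V -> V) (a b : R) (A : V -> V) : Prop :=
  forall eps : R, 0 < eps -> exists2 delta : R, 0 < delta &
    forall n p xi, tagged_partition a b delta n p xi ->
      opnorm_le (fun v =>
        \sum_(i < n) (p i.+1 - p i) *: F (xi i) v - A v) eps.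

(* A is the improper Riemann integral of F over (0, oo), in operator norm. *)
Definition is_op_RInt_gen (F : R -> V -> V) (A : V -> V) : Prop :=
  forall eps : R, 0 < eps -> exists a0 b0 : R, [/\ 0 < a0, a0 <= b0 &
    forall a b, 0 < a < a0 -> b0 < b ->
      exists2 B, is_op_RInt F a b B & opnorm_le (fun v => B v - A v) eps].

(** ** The omega-functional calculus *)

(* A = \int_(boundary of D_phi in C_J) G s ds_J, where G s c stands for the
   integrand at s with ds_J replaced by the Clifford number c.  On the ray
   s = t e^(J psi) one has ds_J = - J e^(J psi) dt; the rays psi = - phi and
   psi = pi - phi run from 0 to oo, the other two from oo to 0. *)
Definition is_contour_int (J : Rd) (phi : R) (G : Rd -> Rd -> V -> V)
    (A : V -> V) : Prop :=
  let ray psi := is_op_RInt_gen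
    (fun t : R => G (t *: cl_exp J psi) (- cl_mul J (cl_exp J psi))) in
  exists A1 A2 A3 A4,
    [/\ ray phi A1, ray (- phi) A2, ray (pi - phi) A3, ray (pi + phi) A4 &
        forall v, A v = - A1 v + A2 v + A3 v - A4 v].

Definition contour_in_resolvent (J : Rd) (phi : R) (T : oper) : Prop :=
  forall psi t : R, psi \in [:: phi; - phi; pi - phi; pi + phi] -> 0 < t ->
    S_resolvent_set T (t *: cl_exp J psi).

(* fT is the operator f(T), computed along the boundary of D_phi in C_J; its
   value does not depend on J and phi when T is bisectorial of an angle less
   than phi and f is in SH0_L theta (resp. SH0_R theta) with phi < theta. *)
Definition omega_calc_L (J : Rd) (phi : R) (T : oper) (f : Rd -> Rd)
    (fT : V -> V) : Prop :=
  [/\ contour_in_resolvent J phi T, in_B fT &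
      exists2 A,
        is_contour_int J phi
          (fun s c v => SL_resolvent s T (lact c (lact (f s) v))) A &
        forall v, fT v = (2 * pi)^-1 *: A v].

Definition omega_calc_R (J : Rd) (phi : R) (T : oper) (f : Rd -> Rd)
    (fT : V -> V) : Prop :=
  [/\ contour_in_resolvent J phi T, in_B fT &
      exists2 A,
        is_contour_int J phi
          (fun s c v => lact (f s) (lact c (SR_resolvent s T v))) A &
        forall v, fT v = (2 * pi)^-1 *: A v].

End HilbertModule.

(* Main.v *)
Require Import Defs.
From HB Require Import structures.
From mathcomp Require Import all_boot all_order all_algebra.
From mathcomp Require Import all_classical all_reals all_analysis.
From mathcomp Require Import measurable_realfun.
From mathcomp Require Import ring lra.

Set Implicit Arguments.
Unset Strict Implicit.
Unset Printing Implicit Defensive.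

Import Order.TTheory GRing.Theory Num.Theory.
Import numFieldNormedType.Exports.

Local Open Scope classical_set_scope.
Local Open Scope ring_scope.

(** The integrals defining both functional calculi converge in operator norm, so
    the adjoint may be taken under the integral sign, and everything reduces to
    one pointwise identity: the adjoint of [S_R^-1(s, T)] is the left S-resolvent
    of the adjoint of [T] at the conjugate point (lemmas [SL_adjoint_dual] and
    [SR_adjoint_dual]).  Left multiplication by a Clifford number has the
    conjugate multiplication as its adjoint, conjugation exchanges the rays of the
    contour in pairs, and the factor [ds_J] changes sign with the orientation
    ([cl_conj_dray]); hence the integrand of [f] for the adjoint is the adjoint of
    the integrand of [sharp f] for [T] ([GL_dual], [GR_dual]), and the contour
    integrals are dual ([contour_form_dual]).

    All pairings are computed with the real inner product [hdot], the scalar part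
    of [hinner].  On right submodules this loses nothing ([hinner_adjP]), and it
    reduces adjoints of bounded operators to the Riesz representation theorem
    ([riesz]), proved by minimizing the norm.

    Three points need an argument.  First, the domain of [T] is dense
    ([dom_dense]); this is where completeness enters a second time, through
    almost minimizers of the norm in shrinking convex sets.  Density makes the
    adjoint single valued, and then the inverse of [Q_s] for the adjoint is the
    adjoint of the inverse of [Q_s] ([Q_op_adjoint_inverse]); it uses that
    [T Q_s^-1] is bounded, which follows from the bounds on the S-resolvents at
    the two conjugate points of a sphere ([Q_inv_bound]).  Second, the operator
    valued integrals exist: on each ray the integrand is continuous in operator
    norm and dominated by a multiple of [|f(s)| / |s|] ([tame_GL], [tame_GR]).  The
    integral is first obtained weakly, from scalar Lebesgue integrals and the
    Riesz theorem, and uniform continuity then identifies it with the limit of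
    Riemann sums in operator norm ([weak_integral_RInt], [tame_integral]).  Third,
    for intrinsic [f] the two versions of the calculus agree: the contributions of
    two conjugate points add up to a real linear combination of [Q_s^-1] and
    [T Q_s^-1], which commutes with the multiplications ([intrinsic_pair]). *)

(** * Signs of products of basis elements *)

Section Signs.
Context {R : realType} {d : nat}.
Implicit Types A B C : {set 'I_d}.
Local Notation sg := (@basis_sign R d).

Lemma in_symdiff A B i : (i \in symdiff A B) = (i \in A) (+) (i \in B).
Proof. by rewrite !finset.inE; case: (i \in A); case: (i \in B). Qed.

Lemma symdiffC A B : symdiff A B = symdiff B A.
Proof. by apply/finset.setP => i; rewrite !in_symdiff addbC. Qed.

Lemma symdiffA A B C : symdiff A (symdiff B C) = symdiff (symdiff A B) C.
Proof. by apply/finset.setP => i; rewrite !in_symdiff addbA. Qed.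

Lemma symdiff0 A : symdiff A finset.set0 = A.
Proof. by apply/finset.setP => i; rewrite in_symdiff finset.inE addbF. Qed.

Lemma symdiffv A : symdiff A A = finset.set0.
Proof. by apply/finset.setP => i; rewrite in_symdiff finset.inE addbb. Qed.

Lemma symdiffK B : involutive (symdiff^~ B).
Proof. by move=> A; rewrite -symdiffA symdiffv symdiff0. Qed.

Lemma symdiffKl B : involutive (symdiff B).
Proof. by move=> A; rewrite symdiffA symdiffv symdiffC symdiff0. Qed.

Lemma symdiff_eq0 A B : (symdiff A B == finset.set0) = (A == B).
Proof.
apply/eqP/eqP => [E|->]; last exact: symdiffv.
by rewrite -(symdiffK B A) E symdiffC symdiff0.
Qed.


Lemma basis_sign_prod A B :
  sg A B = \prod_(a in A) \prod_(b in B) (-1) ^+ (b <= a)%N.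
Proof.
rewrite pair_big_dep/= /basis_sign -prodr_const big_mkcond/= [RHS]big_mkcond/=.
apply: eq_bigr => -[a b] _; rewrite !finset.inE/=.
by case: (a \in A); case: (b \in B); case: (_ <= _)%N.
Qed.

Lemma basis_sign_sqr A B : sg A B * sg A B = 1.
Proof. by rewrite /basis_sign -expr2 sqrr_sign. Qed.

Lemma prod_symdiff (F : 'I_d -> R) A B : (forall i, F i * F i = 1) ->
  \prod_(i in symdiff A B) F i = (\prod_(i in A) F i) * \prod_(i in B) F i.
Proof.
move=> F1; rewrite big_mkcond [X in _ = X * _]big_mkcond.
rewrite [X in _ = _ * X]big_mkcond -big_split/=; apply: eq_bigr => i _.
by rewrite in_symdiff; case: (i \in A); case: (i \in B);
  rewrite /= ?mulr1 ?mul1r// F1.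
Qed.

(** The sign is bimultiplicative for the symmetric difference, because repeated
    generators contribute squares of signs.  Associativity, the conjugation and
    the inner product identities all reduce to this. *)
Lemma basis_signDl A A' B : sg (symdiff A A') B = sg A B * sg A' B.
Proof.
rewrite !basis_sign_prod prod_symdiff// => a.
by rewrite -big_split big1//= => b _; rewrite -expr2 sqrr_sign.
Qed.

Lemma basis_signDr A B B' : sg A (symdiff B B') = sg A B * sg A B'.
Proof.
rewrite !basis_sign_prod -big_split/=; apply: eq_bigr => a _.
by rewrite prod_symdiff// => b; rewrite -expr2 sqrr_sign.
Qed.

Lemma basis_sign0r A : sg A finset.set0 = 1.
Proof. by rewrite basis_sign_prod big1// => a _; rewrite big_set0. Qed.

Lemma basis_sign0l A : sg finset.set0 A = 1.
Proof. by rewrite basis_sign_prod big_set0. Qed.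

Lemma basis_sign1 (i j : 'I_d) :
  sg (finset.set1 i) (finset.set1 j) = (-1) ^+ (j <= i)%N.
Proof. by rewrite basis_sign_prod !big_set1. Qed.

(** The ordered pairs and their mirror images cover the square of [A] and overlap
    in the diagonal. *)
Lemma card_ordered_pairs A :
  #|[set p in finset.setX A A | (p.2 <= p.1)%N]%SET| = 'C(#|A|.+1, 2).
Proof.
set le := [set p in finset.setX A A | (p.2 <= p.1)%N]%SET.
set ge := [set p in finset.setX A A | (p.1 <= p.2)%N]%SET.
have swapK : involutive (fun p : 'I_d * 'I_d => (p.2, p.1)) by case.
have cge : #|ge| = #|le|.
  rewrite -(card_imset _ (inv_inj swapK)); apply: eq_card => -[a b].
  rewrite -{1}[(a, b)]swapK (mem_imset _ _ (inv_inj swapK)) !finset.inE/=.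
  by rewrite [(b \in A) && _]andbC.
have cU : (le :|: ge)%SET = finset.setX A A.
  apply/finset.setP => -[a b]; rewrite !finset.inE/=.
  by case: (a \in A); case: (b \in A); rewrite //= leq_total.
have cI : #|(le :&: ge)%SET| = #|A|.
  have inj : injective (fun a : 'I_d => (a, a)) by move=> a b [].
  rewrite -[RHS](card_imset _ inj); apply: eq_card => -[a b].
  rewrite !finset.inE/=; apply/idP/imsetP => [|[c cA [-> ->]]]; last first.
    by rewrite cA leqnn.
  move=> /andP[/andP[/andP[aA bA] ba] /andP[_ ab]]; exists a => //.
  by congr pair; apply/val_inj/eqP; rewrite /= eqn_leq ab ba.
have := cardsUI le ge; rewrite cU cI cge cardsX => E.
rewrite bin2 /=; apply: (canRL half_double).
by rewrite -addnn -E mulSn addnC.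
Qed.

(** The sign of the conjugation is thereby a value of the bimultiplicative form,
    which makes its compatibility with products a computation with squares. *)
Lemma cl_conj_sign A : (-1) ^+ 'C(#|A|.+1, 2) = sg A A.
Proof. by rewrite -card_ordered_pairs. Qed.

End Signs.


(** * Left and right actions of the Clifford algebra *)

Section Actions.
Context {R : realType} {d : nat} {H : completeNormedModType R}.
Local Notation Rd := (clifford R d).
Local Notation V := (hmod d H).
Implicit Types (A B C : {set 'I_d}) (s t J : Rd) (v w : V).
Local Notation sg := (@basis_sign R d).

Lemma sum_tens (F : {set 'I_d} -> {set 'I_d} -> H) (C : {set 'I_d}) :
  (\sum_A \sum_B tens (F A B) (symdiff A B) : V) C
  = \sum_B F (symdiff C B) B.
Proof.
rewrite exchange_big/= sum_ffunE; apply: eq_bigr => B _.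
rewrite sum_ffunE (bigD1 (symdiff C B))//= big1 ?addr0 => [|A /eqP nA].
  by rewrite ffunE symdiffK eqxx.
rewrite ffunE; case: eqP => // E; case: nA.
by rewrite E symdiffK.
Qed.

Lemma ractE v s C :
  ract v s C = \sum_B (sg (symdiff C B) B * s B) *: v (symdiff C B).
Proof. exact: sum_tens. Qed.

Lemma lactE s v C :
  lact s v C = \sum_B (sg B (symdiff C B) * s B) *: v (symdiff C B).
Proof.
rewrite -[RHS](sum_tens (fun A B => (sg B A * s B) *: v A)).
rewrite /lact; congr (fun_of_fin _ C).
by apply: eq_bigr => A _; apply: eq_bigr => B _; rewrite symdiffC.
Qed.

Lemma lactDl s t v : lact (s + t) v = lact s v + lact t v.
Proof.
apply/ffunP => C; rewrite [RHS]ffunE !lactE -big_split/=; apply: eq_bigr => B _.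
by rewrite ffunE mulrDr scalerDl.
Qed.

Lemma lactZl (a : R) s v : lact (a *: s) v = a *: lact s v.
Proof.
apply/ffunP => C; rewrite [RHS]ffunE !lactE scaler_sumr; apply: eq_bigr => B _.
by rewrite ffunE scalerA mulrCA.
Qed.

Lemma lactDr s v w : lact s (v + w) = lact s v + lact s w.
Proof.
apply/ffunP => C; rewrite [RHS]ffunE !lactE -big_split/=; apply: eq_bigr => B _.
by rewrite ffunE scalerDr.
Qed.

Lemma lactZr s (a : R) v : lact s (a *: v) = a *: lact s v.
Proof.
apply/ffunP => C; rewrite [RHS]ffunE !lactE scaler_sumr; apply: eq_bigr => B _.
by rewrite ffunE !scalerA mulrC.
Qed.

Lemma lactNl s v : lact (- s) v = - lact s v.
Proof. by rewrite -scaleN1r lactZl scaleN1r. Qed.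

Lemma lactBl s t v : lact (s - t) v = lact s v - lact t v.
Proof. by rewrite lactDl lactNl. Qed.

Lemma lactNr s v : lact s (- v) = - lact s v.
Proof. by rewrite -scaleN1r lactZr scaleN1r. Qed.

Lemma ractDl v w s : ract (v + w) s = ract v s + ract w s.
Proof.
apply/ffunP => C; rewrite [RHS]ffunE !ractE -big_split/=; apply: eq_bigr => B _.
by rewrite ffunE scalerDr.
Qed.

Lemma ractZl (a : R) v s : ract (a *: v) s = a *: ract v s.
Proof.
apply/ffunP => C; rewrite [RHS]ffunE !ractE scaler_sumr; apply: eq_bigr => B _.
by rewrite ffunE !scalerA mulrC.
Qed.

Lemma ractNl v s : ract (- v) s = - ract v s.
Proof. by rewrite -scaleN1r ractZl scaleN1r. Qed.

Lemma lact_real (x : R) v : lact (cl_real x) v = x *: v.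
Proof.
apply/ffunP => C; rewrite lactE ffunE (bigD1 finset.set0)//= big1 ?addr0.
  by rewrite !ffunE eqxx basis_sign0l symdiff0 mul1r [x *: _]mulr1.
move=> B /negbTE nB; by rewrite !ffunE nB [x *: _]mulr0 mulr0 scale0r.
Qed.

Lemma ract_real v (x : R) : ract v (cl_real x) = x *: v.
Proof.
apply/ffunP => C; rewrite ractE ffunE (bigD1 finset.set0)//= big1 ?addr0.
  by rewrite !ffunE eqxx basis_sign0r symdiff0 mul1r [x *: _]mulr1.
move=> B /negbTE nB; by rewrite !ffunE nB [x *: _]mulr0 mulr0 scale0r.
Qed.

Lemma lact_ract s v t : lact s (ract v t) = ract (lact s v) t.
Proof.
apply/ffunP => C; rewrite lactE ractE.
under eq_bigr => B _ do rewrite ractE scaler_sumr.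
under [RHS]eq_bigr => B _ do rewrite lactE scaler_sumr.
rewrite exchange_big/=; apply: eq_bigr => B _; apply: eq_bigr => D _.
rewrite !scalerA -!symdiffA [symdiff D B]symdiffC; congr (_ *: _).
by rewrite !basis_signDr !basis_signDl; ring.
Qed.

Lemma cl_mulE s t C :
  cl_mul s t C = \sum_B sg B (symdiff C B) * s B * t (symdiff C B).
Proof.
rewrite /cl_mul exchange_big/= sum_ffunE.
rewrite (reindex_inj (inv_inj (symdiffKl C)))/=; apply: eq_bigr => B _.
rewrite sum_ffunE (bigD1 B)//= big1 ?addr0 => [|A /eqP nA].
  by rewrite !ffunE [symdiff B _]symdiffC symdiffK eqxx [_ *: _]mulr1 mulrA.
rewrite !ffunE; case: eqP => [E|]; last by rewrite [_ *: _]mulr0.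
by case: nA; rewrite -(symdiffK (symdiff C B) A) -E symdiffKl.
Qed.

(** Associativity holds since, by bimultiplicativity, the two signs differ by a
    square. *)
Lemma lact_mul s t v : lact s (lact t v) = lact (cl_mul s t) v.
Proof.
apply/ffunP => C; rewrite !lactE.
under eq_bigr => B _ do rewrite lactE scaler_sumr.
under [RHS]eq_bigr => B _ do rewrite cl_mulE mulr_sumr scaler_suml.
rewrite [RHS]exchange_big/=; apply: eq_bigr => B _.
rewrite [RHS](reindex_inj (inv_inj (symdiffK B)))/=.
apply: eq_bigr => D _; rewrite symdiffK [symdiff D B]symdiffC !scalerA.
rewrite -!symdiffA.
congr (_ *: _); rewrite !basis_signDr !basis_signDl.
have E (a b c e f u w x : R) : x * x = 1 ->
    a * b * u * (c * (e * f) * w) = a * c * (b * e * (x * f)) * (x * u * w).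
  by move=> x1; rewrite -[LHS]mulr1 -x1; ring.
exact/E/basis_sign_sqr.
Qed.


End Actions.

(** * Conjugation, norm and imaginary units *)

Section CliffordAlgebra.
Context {R : realType} {d : nat}.
Local Notation Rd := (clifford R d).
Implicit Types (A B C : {set 'I_d}) (s t J : Rd).
Local Notation sg := (@basis_sign R d).

Lemma cl_conjE s A : cl_conj s A = sg A A * s A.
Proof. by rewrite ffunE cl_conj_sign. Qed.

Lemma cl_conjK : involutive (@cl_conj R d).
Proof.
by move=> s; apply/ffunP => A; rewrite !cl_conjE mulrA basis_sign_sqr mul1r.
Qed.

Lemma cl_conjD s t : cl_conj (s + t) = cl_conj s + cl_conj t.
Proof. by apply/ffunP => A; rewrite [RHS]ffunE !cl_conjE ffunE mulrDr. Qed.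

Lemma cl_conjZ (a : R) s : cl_conj (a *: s) = a *: cl_conj s.
Proof.
by apply/ffunP => A; rewrite [RHS]ffunE !cl_conjE ffunE [LHS]mulrCA.
Qed.

Lemma cl_conj_real (x : R) : cl_conj (cl_real x : Rd) = cl_real x.
Proof.
apply/ffunP => A; rewrite cl_conjE !ffunE; case: eqP => [->|_].
  by rewrite basis_sign0l mul1r.
by rewrite [x *: _]mulr0 mulr0.
Qed.

Lemma cl_conj_e A : cl_conj (cl_e A) = sg A A *: cl_e A :> Rd.
Proof.
apply/ffunP => B; rewrite cl_conjE !ffunE.
by case: eqP => [->//|_]; rewrite mulr0; exact/esym/mulr0.
Qed.

Lemma cl_mulZl (a : R) s t : cl_mul (a *: s) t = a *: cl_mul s t.
Proof.
apply/ffunP => C; rewrite ffunE !cl_mulE [RHS]mulr_sumr; apply: eq_bigr => B _.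
by rewrite ffunE [_ *: _]mulrC; ring.
Qed.

Lemma cl_mulDr s t t' : cl_mul s (t + t') = cl_mul s t + cl_mul s t'.
Proof.
apply/ffunP => C; rewrite [RHS]ffunE !cl_mulE -big_split/=.
by apply: eq_bigr => B _; rewrite ffunE mulrDr.
Qed.

Lemma cl_mulZr (a : R) s t : cl_mul s (a *: t) = a *: cl_mul s t.
Proof.
apply/ffunP => C; rewrite ffunE !cl_mulE [RHS]mulr_sumr; apply: eq_bigr => B _.
by rewrite ffunE [LHS]mulrCA.
Qed.

Lemma cl_mul_realr s (x : R) : cl_mul s (cl_real x) = x *: s.
Proof.
apply/ffunP => C; rewrite ffunE cl_mulE (bigD1 C)//= big1 => [|B nB].
  by rewrite symdiffv !ffunE eqxx basis_sign0r addr0 mul1r mulrC [x *: true%:R]mulr1.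
rewrite !ffunE symdiff_eq0 eq_sym (negbTE nB) [x *: false%:R]mulr0.
exact: mulr0.
Qed.

Lemma cl_norm_conj s : cl_norm (cl_conj s) = cl_norm s.
Proof.
rewrite /cl_norm; congr Num.sqrt; apply: eq_bigr => A _.
by rewrite cl_conjE exprMn expr2 basis_sign_sqr mul1r.
Qed.

Lemma cl_norm_ge0 s : 0 <= cl_norm s.
Proof. exact: sqrtr_ge0. Qed.

Lemma cl_norm_sqr s : cl_norm s ^+ 2 = \sum_A s A ^+ 2.
Proof. by rewrite sqr_sqrtr// sumr_ge0// => A _; rewrite sqr_ge0. Qed.

Lemma le_cl_norm s A : `|s A| <= cl_norm s.
Proof.
rewrite -sqrtr_sqr ler_wsqrtr// (bigD1 A)//= lerDl sumr_ge0// => B _.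
exact: sqr_ge0.
Qed.

Lemma cl_norm_le_sum s : cl_norm s <= \sum_A `|s A|.
Proof.
have S0 (P : pred {set 'I_d}) : 0 <= \sum_(A | P A) `|s A| by exact: sumr_ge0.
rewrite -(ger0_norm (S0 predT)) -sqrtr_sqr ler_wsqrtr//.
rewrite expr2 mulr_suml ler_sum// => A _.
rewrite -real_normK ?num_real// expr2 ler_wpM2l// (bigD1 A)//= lerDl.
exact: S0.
Qed.

Lemma imag_unitP J : imag_unit J ->
  (forall A, #|A| != 1%N -> J A = 0) /\ \sum_A J A ^+ 2 = 1.
Proof.
move=> [pJ J0 nJ]; split; last by rewrite -cl_norm_sqr nJ expr1n.
move=> A; rewrite neq_ltn => /orP[|/pJ//].
by rewrite ltnS leqn0 cards_eq0 => /eqP ->.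
Qed.

(** Distinct generators anticommute, so only their squares survive in [J ^ 2]. *)
Lemma imag_unit_sqr J : imag_unit J -> cl_mul J J = - cl_real 1.
Proof.
move=> /imag_unitP[J1 nJ]; apply/ffunP => C; rewrite cl_mulE !ffunE.
case: (eqVneq C finset.set0) => [->|C0].
  rewrite scale1r -nJ -sumrN; apply: eq_bigr => B _.
  rewrite symdiffC symdiff0 -mulrA -expr2.
  have [/eqP/cards1P[i ->]|/J1 ->] := eqVneq #|B| 1%N.
    by rewrite basis_sign1 leqnn expr1 mulN1r.
  by rewrite expr0n mulr0 oppr0.
rewrite scaler0 oppr0; set X := LHS.
(* The substitution [B -> symdiff C B] exchanges the two factors. *)
suff : X = - X by lra.
rewrite {1}/X (reindex_inj (inv_inj (symdiffKl C)))/= /X -sumrN.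
apply: eq_bigr => B _; rewrite symdiffKl.
have [/eqP/cards1P[i Bi]|/J1 ->] := eqVneq #|B| 1%N; last first.
  by rewrite !(mulr0, mul0r, oppr0).
have [/eqP/cards1P[j CBj]|/J1 ->] := eqVneq #|symdiff C B| 1%N; last first.
  by rewrite !(mulr0, mul0r, oppr0).
rewrite CBj Bi !basis_sign1.
have ij : i != j.
  apply: contra_neq C0 => ij; rewrite -(symdiffK B C) CBj Bi ij.
  exact: symdiffv.
have := ij; rewrite -val_eqE neq_ltn => /orP[] lt; rewrite (ltnW lt) leqNgt lt.
  by rewrite /= expr0 expr1; ring.
by rewrite /= expr0 expr1; ring.
Qed.

Lemma cl_conj_imag J : imag_unit J -> cl_conj J = - J.
Proof.
move=> /imag_unitP[J1 _]; apply/ffunP => A; rewrite cl_conjE ffunE.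
have [/eqP/cards1P[i ->]|/J1 ->] := eqVneq #|A| 1%N.
  by rewrite basis_sign1 leqnn expr1 mulN1r.
by rewrite mulr0 oppr0.
Qed.

Lemma cl_conj_slice J x y : imag_unit J ->
  cl_conj (slice_pt x y J) = slice_pt x (- y) J.
Proof.
move=> hJ; rewrite /slice_pt cl_conjD cl_conj_real cl_conjZ cl_conj_imag//.
by rewrite scalerN scaleNr.
Qed.

Lemma Re0_slice J x y : imag_unit J -> Re0 (slice_pt x y J) = x.
Proof.
by move=> [_ J0 _]; rewrite /Re0 !ffunE eqxx [x *: _]mulr1 [J _]J0
  [y *: _]mulr0 addr0.
Qed.

Lemma paravector_slice J x y : imag_unit J -> paravector (slice_pt x y J).
Proof.
move=> [pJ _ _] A A1; rewrite !ffunE pJ//.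
case: eqP => [E|_]; first by rewrite E cards0 in A1.
by rewrite [x *: _]mulr0 [y *: _]mulr0 addr0.
Qed.

Lemma cl_norm_slice J x y : imag_unit J ->
  cl_norm (slice_pt x y J) = Num.sqrt (x ^+ 2 + y ^+ 2).
Proof.
move=> hJ; have [J1 nJ] := imag_unitP hJ; have [_ J0 _] := hJ.
congr Num.sqrt; rewrite (bigD1 finset.set0)//=.
rewrite [_ finset.set0](Re0_slice x y hJ); congr (_ + _).
rewrite -[RHS]mulr1 -nJ mulr_sumr [RHS](bigD1 finset.set0)//=.
rewrite [J _]J0 expr0n mulr0 add0r; apply: eq_bigr => A /negbTE A0.
by rewrite !ffunE A0 [x *: _]mulr0 add0r exprMn.
Qed.

Lemma cl_mul_imag_slice J x y : imag_unit J ->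
  cl_mul J (slice_pt x y J) = slice_pt (- y) x J.
Proof.
move=> hJ; rewrite cl_mulDr cl_mul_realr cl_mulZr imag_unit_sqr// addrC /slice_pt.
by rewrite scalerN /cl_real scale1r scaleNr.
Qed.

Lemma scale_slice (t : R) J x y :
  t *: slice_pt x y J = slice_pt (t * x) (t * y) J.
Proof. by rewrite /slice_pt scalerDr !scalerA. Qed.

End CliffordAlgebra.

(** * The real inner product *)

Section InnerProduct.
Context {R : realType} {d : nat} {H : completeNormedModType R}.
Variable ip : {dot H for @idfun R}.
Hypothesis hip : norm_from_dot ip.
Local Notation Rd := (clifford R d).
Local Notation V := (hmod d H).
Implicit Types (A B C : {set 'I_d}) (s t J : Rd) (u v w : V) (a : R).
Local Notation sg := (@basis_sign R d).

(** The real inner product of [V], the scalar part of [hinner]. *)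
Definition hdot v w : R := \sum_A ip (v A) (w A).

Lemma ipC (x y : H) : ip x y = ip y x.
Proof. by rewrite (hermC ip) /= expr0 mul1r. Qed.

Lemma ipDl (x y z : H) : ip (x + y) z = ip x z + ip y z.
Proof. exact: linearDl. Qed.

Lemma ipZl a (x y : H) : ip (a *: x) y = a * ip x y.
Proof. exact: linearZl_LR. Qed.

Lemma hdotC v w : hdot v w = hdot w v.
Proof. by apply: eq_bigr => A _; rewrite ipC. Qed.

Lemma hdotDl u v w : hdot (u + v) w = hdot u w + hdot v w.
Proof. by rewrite -big_split; apply: eq_bigr => A _; rewrite ffunE ipDl. Qed.

Lemma hdotZl a v w : hdot (a *: v) w = a * hdot v w.
Proof. by rewrite mulr_sumr; apply: eq_bigr => A _; rewrite ffunE ipZl. Qed.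

Lemma hdotDr u v w : hdot u (v + w) = hdot u v + hdot u w.
Proof. by rewrite hdotC hdotDl !(hdotC u). Qed.

Lemma hdotZr a v w : hdot v (a *: w) = a * hdot v w.
Proof. by rewrite hdotC hdotZl hdotC. Qed.

Lemma hdotNl v w : hdot (- v) w = - hdot v w.
Proof. by rewrite -scaleN1r hdotZl mulN1r. Qed.

Lemma hdotNr v w : hdot v (- w) = - hdot v w.
Proof. by rewrite hdotC hdotNl hdotC. Qed.

Lemma hdotBl u v w : hdot (u - v) w = hdot u w - hdot v w.
Proof. by rewrite hdotDl hdotNl. Qed.

Lemma hdotBr u v w : hdot u (v - w) = hdot u v - hdot u w.
Proof. by rewrite hdotDr hdotNr. Qed.

Lemma hdot0l v : hdot 0 v = 0.
Proof. by rewrite -(scale0r v) hdotZl mul0r. Qed.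

Lemma hdot0r v : hdot v 0 = 0.
Proof. by rewrite hdotC hdot0l. Qed.

Lemma hnorm_ge0 v : 0 <= hnorm v.
Proof. exact: sqrtr_ge0. Qed.

Lemma hdotvv v : hdot v v = hnorm v ^+ 2.
Proof.
rewrite sqr_sqrtr; last by rewrite sumr_ge0// => A _; exact: sqr_ge0.
by apply: eq_bigr => A _; rewrite hip.
Qed.

Lemma hnorm0 : hnorm (0 : V) = 0.
Proof. by apply/eqP; rewrite -sqrf_eq0 -hdotvv hdot0l. Qed.

Lemma hnorm_eq0 v : hnorm v = 0 -> v = 0.
Proof.
move=> v0; apply/ffunP => A; rewrite ffunE; apply/eqP.
rewrite -normr_eq0 -sqrf_eq0; apply/eqP.
have : \sum_A `|v A| ^+ 2 == 0.
  have := hdotvv v; rewrite v0 expr0n /= => v20.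
  by apply/eqP; rewrite -[RHS]v20; apply: eq_bigr => B _; rewrite hip.
by rewrite psumr_eq0 => [/allP/(_ A)|B _];
  [rewrite mem_index_enum => /(_ isT)/eqP | exact: sqr_ge0].
Qed.

Lemma hnormZ a v : hnorm (a *: v) = `|a| * hnorm v.
Proof.
apply/eqP; rewrite -(@eqrXn2 _ 2) ?mulr_ge0 ?hnorm_ge0//.
by rewrite -hdotvv hdotZl hdotZr hdotvv exprMn real_normK ?num_real// mulrA.
Qed.

Lemma hnormN v : hnorm (- v) = hnorm v.
Proof. by rewrite -scaleN1r hnormZ normrN1 mul1r. Qed.

Lemma hnormBC v w : hnorm (v - w) = hnorm (w - v).
Proof. by rewrite -hnormN opprB. Qed.


(** Expanding [0 <= | |w| v - |v| w |^2] avoids dividing by either norm. *)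
Lemma hdot_le v w : hdot v w <= hnorm v * hnorm w.
Proof.
have [/hnorm_eq0 ->|v0] := eqVneq (hnorm v) 0; first by rewrite hdot0l hnorm0 mul0r.
have [/hnorm_eq0 ->|w0] := eqVneq (hnorm w) 0; first by rewrite hdot0r hnorm0 mulr0.
have vw : 0 < hnorm v * hnorm w by rewrite mulr_gt0// lt0r hnorm_ge0 ?v0 ?w0.
have : 0 <= hdot (hnorm w *: v - hnorm v *: w) (hnorm w *: v - hnorm v *: w).
  by rewrite hdotvv sqr_ge0.
rewrite hdotBl !hdotBr !hdotZl !hdotZr (hdotC w v) !hdotvv => h.
by rewrite -(ler_pM2l vw); nra.
Qed.

Lemma normr_hdot v w : `|hdot v w| <= hnorm v * hnorm w.
Proof.
by rewrite ler_norml lerNl -hdotNl -{1}(hnormN v) !hdot_le.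
Qed.

Lemma hnormD v w : hnorm (v + w) <= hnorm v + hnorm w.
Proof.
rewrite -(@ler_pXn2r _ 2) ?nnegrE ?addr_ge0 ?hnorm_ge0//.
rewrite -hdotvv hdotDl !hdotDr (hdotC w v) !hdotvv.
by have := hdot_le v w; nra.
Qed.

Lemma hnormB v w : hnorm (v - w) <= hnorm v + hnorm w.
Proof. by rewrite (le_trans (hnormD _ _))// hnormN. Qed.

Lemma hnorm_sum (I : finType) (F : I -> V) :
  hnorm (\sum_i F i) <= \sum_i hnorm (F i).
Proof.
elim/big_ind2 : _ => [|x a y b xa yb|//]; first by rewrite hnorm0.
by rewrite (le_trans (hnormD _ _))// lerD.
Qed.

Lemma parallelogram v w :
  hnorm (v - w) ^+ 2
  = 2 * hnorm v ^+ 2 + 2 * hnorm w ^+ 2 - 4 * hnorm (2^-1 *: (v + w)) ^+ 2.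
Proof.
rewrite -!hdotvv hdotBl !hdotBr hdotZl hdotZr hdotDl !hdotDr (hdotC w v).
by field.
Qed.

Lemma hdot_inj v w : (forall u, hdot v u = hdot w u) -> v = w.
Proof.
move=> vw; apply/eqP; rewrite -subr_eq0; apply/eqP/hnorm_eq0/eqP.
by rewrite -sqrf_eq0 -hdotvv hdotBl vw subrr.
Qed.

(** * Adjoints of the Clifford actions *)

Lemma ip_suml (I : finType) (F : I -> H) (y : H) :
  ip (\sum_i F i) y = \sum_i ip (F i) y.
Proof. by rewrite linear_sumlz. Qed.

Lemma ip_sumr (I : finType) (F : I -> H) (y : H) :
  ip y (\sum_i F i) = \sum_i ip y (F i).
Proof. by rewrite ipC ip_suml; apply: eq_bigr => i _; rewrite ipC. Qed.

Lemma hdot_lact s v w : hdot (lact s v) w = hdot v (lact (cl_conj s) w).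
Proof.
rewrite /hdot; under eq_bigr => C _ do rewrite lactE ip_suml.
under [RHS]eq_bigr => C _ do rewrite lactE ip_sumr.
rewrite exchange_big [RHS]exchange_big/=; apply: eq_bigr => B _.
rewrite (reindex_inj (inv_inj (symdiffK B)))/=; apply: eq_bigr => C _.
rewrite symdiffK ipZl [RHS]ipC ipZl ipC cl_conjE basis_signDr.
have E (a b : R) : b * b = 1 -> a = a * b * b.
  by move=> b1; rewrite -mulrA b1 mulr1.
by rewrite mulrA -(E _ _ (basis_sign_sqr B B)).
Qed.

Lemma hdot_ract s v w : hdot (ract v s) w = hdot v (ract w (cl_conj s)).
Proof.
rewrite /hdot; under eq_bigr => C _ do rewrite ractE ip_suml.
under [RHS]eq_bigr => C _ do rewrite ractE ip_sumr.
rewrite exchange_big [RHS]exchange_big/=; apply: eq_bigr => B _.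
rewrite (reindex_inj (inv_inj (symdiffK B)))/=; apply: eq_bigr => C _.
rewrite symdiffK ipZl [RHS]ipC ipZl ipC cl_conjE basis_signDl.
have E (a b : R) : b * b = 1 -> a = a * b * b.
  by move=> b1; rewrite -mulrA b1 mulr1.
by rewrite mulrA -(E _ _ (basis_sign_sqr B B)).
Qed.

(** The coordinates of the Clifford valued inner product are real ones: this is
    why identities for [hinner] on a right submodule can be tested with [hdot]. *)
Lemma hinnerE v w C : hinner ip v w C = sg C C * hdot v (ract w (cl_e C)).
Proof.

rewrite /hinner /hdot sum_ffunE mulr_sumr; apply: eq_bigr => A _.
have cE B : cl_mul (cl_conj (cl_e A)) (cl_e B) C
    = sg A A * sg A B * (C == symdiff A B)%:R.
  rewrite cl_conj_e cl_mulZl cl_mul_basis !ffunE.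
  exact: mulrA.
rewrite sum_ffunE (bigD1 (symdiff A C))//= big1 => [|B /eqP nB]; last first.
  rewrite ffunE cE; case: eqP => [CAB|_]; last by rewrite mulr0 [LHS]mulr0.
  by case: nB; rewrite CAB symdiffKl.
rewrite addr0 ffunE cE symdiffKl eqxx mulr1 ractE (bigD1 C)//= big1 => [|B nB].
  rewrite addr0 !ffunE eqxx mulr1 [in RHS]ipC ipZl ipC.
  rewrite basis_signDr basis_signDl.
  have E (x a b c : R) : a * a = 1 -> b * b = 1 ->
    x * (a * (a * c)) = b * (c * b * x).
    by move=> a1 b1; rewrite (mulrA a) a1 mulrCA !mulrA [b * c * b]mulrAC b1; ring.
  exact: E (basis_sign_sqr A A) (basis_sign_sqr C C).
by rewrite ffunE (negbTE nB) mulr0 scale0r.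
Qed.

End InnerProduct.

(** * Riesz representation and adjoints of bounded operators *)

Section Hilbert.
Context {R : realType} {d : nat} {H : completeNormedModType R}.
Variable ip : {dot H for @idfun R}.
Hypothesis hip : norm_from_dot ip.
Local Notation V := (hmod d H).
Implicit Types (u v w : V) (a : R).
Local Notation "<[ v , w ]>" := (hdot ip v w).

Lemma cvgn0P (u : nat -> R) : (forall n, 0 <= u n) ->
  u @ \oo --> 0 <->
  forall eps : R, 0 < eps -> exists N, forall n, (N <= n)%N -> u n <= eps.
Proof.
move=> u0; split=> [/cvgrPdist_le ul eps /ul[N _ H']|ul].
  by exists N => n /H' /=; rewrite sub0r normrN ger0_norm.
apply/cvgrPdist_le => eps /ul[N H']; exists N => // n /= /H'.
by rewrite sub0r normrN ger0_norm.
Qed.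

Lemma invS_small (eps : R) : 0 < eps ->
  exists N, forall n, (N <= n)%N -> n.+1%:R^-1 <= eps.
Proof.
move: eps; apply/(cvgn0P (u := harmonic)) => [n|]; last exact: cvg_harmonic.
by rewrite invr_ge0.
Qed.

Lemma le_hnorm v A : `|v A| <= hnorm v.
Proof.
rewrite -[`|v A|]ger0_norm// -sqrtr_sqr ler_wsqrtr// (bigD1 A)//= lerDl.
by rewrite sumr_ge0// => B _; exact: sqr_ge0.
Qed.

Lemma hnorm_le_sum v : hnorm v <= \sum_A `|v A|.
Proof.
have S0 (P : pred {set 'I_d}) : 0 <= \sum_(A | P A) `|v A| by exact: sumr_ge0.
rewrite -(ger0_norm (S0 predT)) -sqrtr_sqr ler_wsqrtr//.
rewrite expr2 mulr_suml ler_sum// => A _.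
rewrite expr2 ler_wpM2l// (bigD1 A)//= lerDl.
exact: S0.
Qed.

Lemma hmod_complete (u : nat -> V) :
  (forall eps : R, 0 < eps -> exists N, forall m n,
     (N <= n)%N -> (n <= m)%N -> hnorm (u m - u n) <= eps) ->
  exists l, (fun n => hnorm (u n - l)) @ \oo --> 0.
Proof.
move=> cu.
have cvA A : cvgn (fun n => u n A).
  apply/cauchy_cvgP/cauchyP => eps eps0.
  have [N HN] := cu _ (divr_gt0 eps0 (ltr0n R 2)).
  exists (u N A); exists N => // n /= Nn.
  rewrite -ball_normE /ball_/= distrC; apply: le_lt_trans (_ : hnorm (u n - u N) < _).
    by have := le_hnorm (u n - u N) A; rewrite !ffunE.
  apply: (le_lt_trans (HN n N (leqnn _) Nn)).
  by rewrite ltr_pdivrMr// ltr_pMr// ltr1n.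
exists [ffun A => limn (fun n => u n A)].
set l := finfun _.
have S0 : (fun n => \sum_A `|(u n - l) A|) @ \oo --> 0.
  rewrite [X in _ --> X](_ : 0 = \sum_(A : {set 'I_d}) `|0 : H|); last first.
    by rewrite big1// => A _; rewrite normr0.
  apply: cvg_big => [|A _]; first exact: add_continuous.
  apply: cvg_norm; rewrite [X in X @ _](_ : _ = fun n => u n A - l A).
    by rewrite -(subrr (l A)) {2}/l ffunE; apply: cvgB => //; exact: cvg_cst.
  by apply/funext => n; rewrite !ffunE.
apply: (squeeze_cvgr _ (cvg_cst 0) S0).
by apply: nearW => n; rewrite hnorm_ge0 hnorm_le_sum.
Qed.

(** Almost minimizers of the norm over shrinking convex sets converge: by the
    parallelogram identity two of them can only be far apart if their midpoint
    beats the infimum. *)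
Lemma minimizing_sequence (K : nat -> set V) (M : R) :
  (forall n m, (n <= m)%N -> K m `<=` K n) ->
  (forall n x y, K n x -> K n y -> K n (2^-1 *: (x + y))) ->
  (forall n, exists2 x, K n x & hnorm x <= M) ->
  exists (z : nat -> V) l,
    [/\ forall n, K n (z n),
        forall n x, K n x -> hnorm (z n) ^+ 2 <= hnorm x ^+ 2 + n.+1%:R^-1 &
        (fun n => hnorm (z n - l)) @ \oo --> 0].
Proof.
move=> Kdec Kmid KM.
pose S n := [set hnorm x ^+ 2 | x in K n].
have lbS n : lbound (S n) 0 by move=> _ [x _ <-]; exact: sqr_ge0.
have hS n : has_inf (S n).
  split; last by exists 0; exact: lbS.
  by have [x Kx _] := KM n; exists (hnorm x ^+ 2), x.
pose dd n := inf (S n).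
have ddle n x : K n x -> dd n <= hnorm x ^+ 2.
  by move=> Kx; apply: ge_inf; [exists 0; exact: lbS|exists x].
have /choice[z zP] n : exists x, K n x /\ hnorm x ^+ 2 < dd n + n.+1%:R^-1.
  have n0 : 0 < n.+1%:R^-1 :> R by rewrite invr_gt0.
  have [_ [x Kx <-] lt] := inf_adherent n0 (hS n).
  by exists x.
have ddnd n m : (n <= m)%N -> dd n <= dd m.
  move=> nm; apply: lb_le_inf; first by case: (hS m).
  by move=> _ [x Kx <-]; apply/ddle/(Kdec _ _ nm).
have ddM n : dd n <= M ^+ 2.
  have [x Kx xM] := KM n; apply: (le_trans (ddle _ _ Kx)).
  by rewrite ler_pXn2r ?nnegrE ?hnorm_ge0// (le_trans (hnorm_ge0 x)).
pose D := sup (range dd).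
have hD : has_sup (range dd).
  by split; [exists (dd 0%N), 0%N|exists (M ^+ 2) => _ [n _ <-]].
have ddD n : dd n <= D by apply: ub_le_sup; [case: hD|exists n].
suff cz : exists l, (fun n => hnorm (z n - l)) @ \oo --> 0.
  have [l zl] := cz; exists z, l; split=> // [n|n x Kx]; first by case: (zP n).
  by case: (zP n) => _ /ltW/le_trans; apply; rewrite lerD2r ddle.
apply: hmod_complete => eps eps0.
have e8 : 0 < eps ^+ 2 / 8 by rewrite divr_gt0// exprn_gt0.
have [_ [N1 _ <-] DN1] := sup_adherent e8 hD.
have [N2 le_inv] := invS_small e8.
exists (maxn N1 N2) => m n; rewrite geq_max => /andP[N1n N2n] nm.
rewrite -(@ler_pXn2r _ 2) ?nnegrE ?hnorm_ge0 ?(ltW eps0)//.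
rewrite (parallelogram hip).
have [Kzm zm] := zP m; have [Kzn zn] := zP n.
have mid := ddle _ _ (Kmid _ _ _ (Kdec _ _ nm _ Kzm) Kzn).
have im := le_inv _ (leq_trans N2n nm); have := le_inv _ N2n.
have := ddD m; have := ddnd _ _ N1n; have := ddnd _ _ nm.
move: DN1 mid zm zn im; rewrite -/D; set a : R := eps ^+ 2 / 8 in e8 *.
have -> : eps ^+ 2 = 8 * a by rewrite /a; field.
move: a e8 (m.+1%:R^-1) (n.+1%:R^-1) => a e8 x y; lra.
Qed.

Lemma cvg_hnorm (u : nat -> V) l :
  (fun n => hnorm (u n - l)) @ \oo --> 0 -> (fun n => hnorm (u n)) @ \oo --> hnorm l.
Proof.
move=> /(cvgn0P (fun n => hnorm_ge0 _)) ul.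
apply/cvgrPdist_le => eps /ul[N HN]; exists N => // n /= /HN; apply: le_trans.
rewrite ler_norml; apply/andP; split.
  by rewrite lerNl opprB lerBlDr -{1}(subrK l (u n)) (hnormD hip).
by rewrite lerBlDr -{1}(subrK (u n) l) (hnormBC hip (u n)) (hnormD hip).
Qed.

Definition rlinear (f : V -> V) : Prop :=
  (forall v w, f (v + w) = f v + f w) /\ (forall a v, f (a *: v) = a *: f v).

(** The representer is a multiple of the element of least norm in the affine
    hyperplane [phi = 1]. *)
Lemma riesz (phi : V -> R) (M : R) :
  (forall v w, phi (v + w) = phi v + phi w) ->
  (forall a v, phi (a *: v) = a * phi v) ->
  (forall v, `|phi v| <= M * hnorm v) ->
  exists y, forall v, phi v = <[y, v]>.
Proof.
move=> phiD phiZ phiM.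
have [phi0|/existsNP[v0 /eqP phiv0]] := pselect (forall v, phi v = 0).
  by exists 0 => v; rewrite hdot0l.
pose K (_ : nat) := [set x | phi x = 1].
have phiB v w : phi (v - w) = phi v - phi w.
  by rewrite phiD -scaleN1r phiZ mulN1r.
have Kv1 : phi ((phi v0)^-1 *: v0) = 1 by rewrite phiZ mulVf.
have [z [l [zK zmin zl]]] : exists (z : nat -> V) l,
    [/\ forall n, K n (z n),
        forall n x, K n x -> hnorm (z n) ^+ 2 <= hnorm x ^+ 2 + n.+1%:R^-1 &
        (fun n => hnorm (z n - l)) @ \oo --> 0].
  apply: (@minimizing_sequence K (hnorm ((phi v0)^-1 *: v0))) => //.
  - by move=> n m _ x.
  - by move=> n x y Kx Ky; rewrite /K/= phiZ phiD Kx Ky; field.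
  - by move=> n; exists ((phi v0)^-1 *: v0).
have phil : phi l = 1.
  apply/eqP; rewrite -subr_eq0 -normr_le0; apply/ler_addgt0Pl => eps eps0.
  have M1 : 0 < `|M| + 1 by rewrite ltr_wpDl.
  have /(cvgn0P (fun n => hnorm_ge0 _))/(_ _ (divr_gt0 eps0 M1))[N HN] := zl.
  have := HN _ (leqnn N); rewrite ler_pdivlMr// => zle.
  rewrite addr0 -(zK N) -phiB (le_trans (phiM _))// (hnormBC hip).
  apply: le_trans zle; rewrite mulrC ler_wpM2l ?hnorm_ge0//.
  by rewrite (le_trans (ler_norm M))// lerDl.
have lmin x : phi x = 1 -> hnorm l ^+ 2 <= hnorm x ^+ 2.
  move=> Kx; have zln := cvg_hnorm zl.
  have h1 : (fun n => hnorm (z n) ^+ 2) @ \oo --> hnorm l ^+ 2.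
    by rewrite expr2; under eq_fun => n do rewrite expr2; exact: cvgM.
  have h2 : (fun n : nat => hnorm x ^+ 2 + n.+1%:R^-1) @ \oo --> hnorm x ^+ 2 + 0.
    by apply: cvgD; [exact: cvg_cst|exact: cvg_harmonic].
  rewrite addr0 in h2; apply: ler_cvg_to h1 h2 _.
  by apply: nearW => n; exact: zmin.
have lorth h : phi h = 0 -> <[l, h]> = 0.
  move=> phih; pose c := <[l, h]>.
  have [/(hnorm_eq0 hip) ->|h0] := eqVneq (hnorm h) 0; first by rewrite hdot0r.
  have hh0 : 0 < hnorm h ^+ 2 by rewrite exprn_gt0// lt0r h0 hnorm_ge0.
  (* The projection of [l] along [h] is a competitor in the hyperplane. *)
  have := lmin (l - (c / hnorm h ^+ 2) *: h); rewrite phiB phiZ phih mulr0 subr0.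
  move=> /(_ phil); rewrite -!(hdotvv hip) hdotBl !hdotBr !hdotZl !hdotZr.
  rewrite (hdotC ip h l) (hdotvv hip h) -/c => le.
  have : c ^+ 2 / hnorm h ^+ 2 <= 0.
    rewrite (_ : _ / _ = c / hnorm h ^+ 2 * c); last by rewrite expr2; field.
    have e : c / hnorm h ^+ 2 * (c / hnorm h ^+ 2 * hnorm h ^+ 2)
        = c / hnorm h ^+ 2 * c by field.
    by move: le; rewrite e; lra.
  rewrite pmulr_lle0 ?invr_gt0// => c2.
  by apply/eqP; rewrite -sqrf_eq0 eq_le c2 sqr_ge0.
have l0 : hnorm l ^+ 2 != 0.
  rewrite sqrf_eq0; apply/eqP => /(hnorm_eq0 hip) l0.
  have := phiZ 0 l; rewrite scale0r mul0r -l0 phil => /eqP.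
  by rewrite oner_eq0.
exists ((hnorm l ^+ 2)^-1 *: l) => v.
have := lorth (v - phi v *: l); rewrite phiB phiZ phil mulr1 subrr => /(_ erefl).
rewrite hdotBr hdotZr (hdotvv hip) => /eqP; rewrite subr_eq0 => /eqP E.
by rewrite hdotZl E mulrCA mulVf// mulr1.
Qed.

Definition bounded_op (B : V -> V) : Prop :=
  rlinear B /\ exists2 c, 0 <= c & opnorm_le B c.

Lemma adjoint_exists (B : V -> V) : bounded_op B ->
  exists B' : V -> V, forall v w, <[B' w, v]> = <[w, B v]>.
Proof.
move=> [[BD BZ] [c c0 Bc]].
have /choice[B' B'P] w : exists y, forall v, <[w, B v]> = <[y, v]>.
  apply: (@riesz (fun v => <[w, B v]>) (hnorm w * c)).
  - by move=> v v'; rewrite BD hdotDr.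
  - by move=> a v; rewrite BZ hdotZr.
  - move=> v; rewrite (le_trans (normr_hdot hip _ _))// -mulrA.
    by rewrite ler_wpM2l ?hnorm_ge0.
by exists B'.
Qed.

(** Adjoints are taken for the real inner product; for right linear operators the
    result is again right linear ([right_linear_dual]). *)
Definition adj (B : V -> V) (w : V) : V :=
  xget 0 [set u | forall v, <[u, v]> = <[w, B v]>].

Lemma adjP (B : V -> V) v w : bounded_op B -> <[adj B w, v]> = <[w, B v]>.
Proof.
move=> /adjoint_exists[B' B'P]; rewrite /adj.
by case: xgetP => [_ _ ->//|/(_ (B' w))]; case.
Qed.

Lemma hnorm_le_dot v c : 0 <= c ->
  (forall w, <[w, v]> <= c * hnorm w) -> hnorm v <= c.
Proof.
move=> c0 /(_ v); rewrite (hdotvv hip) expr2.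
have [-> //|v0] := eqVneq (hnorm v) 0.
by rewrite ler_pM2r// lt0r v0 hnorm_ge0.
Qed.

Lemma rlinear_dual (B B' : V -> V) :
  (forall v w, <[B' w, v]> = <[w, B v]>) -> rlinear B'.
Proof.
move=> BB'; split=> [v w|a v]; apply: (hdot_inj hip) => u.
  by rewrite BB' !hdotDl !BB'.
by rewrite BB' !hdotZl BB'.
Qed.

Lemma opnorm_dual (B B' : V -> V) c : 0 <= c ->
  (forall v w, <[B' w, v]> = <[w, B v]>) -> opnorm_le B c -> opnorm_le B' c.
Proof.
move=> c0 BB' Bc w; apply: hnorm_le_dot => [|v].
  by rewrite mulr_ge0 ?hnorm_ge0.
rewrite hdotC BB' (le_trans (hdot_le hip _ _))// [c * _]mulrC -mulrA.
by rewrite ler_wpM2l ?hnorm_ge0.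
Qed.

Lemma bounded_adj (B : V -> V) : bounded_op B -> bounded_op (adj B).
Proof.
move=> bB; have [_ [c c0 Bc]] := bB; split.
  by apply: (@rlinear_dual B) => v w; exact: adjP.
by exists c => //; apply: (opnorm_dual c0 _ Bc) => v w; exact: adjP.
Qed.

End Hilbert.

(** * Riemann sums and the Lebesgue integral *)

Section ScalarRiemannSums.
Context {R : realType}.
Notation mu := (@lebesgue_measure R).
Implicit Types (h : R -> R) (a b c x y : R).

Lemma itv_oc_sub_half x y : 0 <= x -> (`]x, y] : set R) `<=` `]0, +oo[.
Proof. by move=> x0 t /=; rewrite !in_itv/= andbT => /andP[/(le_lt_trans x0)]. Qed.

Lemma mu_oc x y : x <= y -> fine (mu `]x, y]) = y - x.
Proof.
rewrite le_eqVlt lebesgue_measure_itv/= lte_fin => /predU1P[->|->//].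
by rewrite ltxx subrr.
Qed.

Lemma riemann_step h x y (z c : R) : x <= y ->
  mu.-integrable `]x, y] (EFin \o h) ->
  (forall t, x < t <= y -> `|z - h t| <= c) ->
  `|(y - x) * z - \int[mu]_(t in `]x, y]) h t| <= c * (y - x).
Proof.
move=> xy hi hc.
have cst (k : R) : mu.-integrable `]x, y] (EFin \o cst k).
  apply: measurable_bounded_integrable => //.
    rewrite /= lebesgue_measure_itv/= lte_fin.
    by case: ifP => _; rewrite // -EFinB ltry.
  by exists `|k|; split; [exact: num_real|move=> M kM t _; exact: ltW].
rewrite -(mu_oc xy) mulrC -Rintegral_cst// -RintegralB//; last exact: (cst z).
rewrite -Rintegral_cst//; apply: le_trans (le_normr_Rintegral _ _) _ => //.
  exact: integrableB (cst z) hi.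
apply: le_Rintegral => //.
- exact/integrable_norm/(integrableB _ (cst z) hi).
- exact: (cst c).
Qed.

(** The errors on the cells add up because the integral is additive. *)
Lemma riemann_sum_error h (n : nat) (p xi : nat -> R) (c : R) :
  0 <= p 0%N -> mu.-integrable `]0, +oo[ (EFin \o h) ->
  (forall i, (i < n)%N -> p i <= p i.+1) ->
  (forall i t, (i < n)%N -> p i < t <= p i.+1 -> `|h (xi i) - h t| <= c) ->
  p 0%N <= p n /\
  `|\sum_(i < n) (p i.+1 - p i) * h (xi i) - \int[mu]_(t in `]p 0%N, p n]) h t|
    <= c * (p n - p 0%N).
Proof.
move=> p0 hi; elim: n => [|n IH] pm hc.
  by rewrite big_ord0 set_itvoc0 Rintegral_set0 !subrr normr0 mulr0.
have [|i t ilt|p0n IHn] := IH.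
- by move=> i ilt; exact/pm/ltnW.
- exact/hc/ltnW.
have pn := pm n (ltnSn n).
have int x y : 0 <= x -> mu.-integrable `]x, y] (EFin \o h).
  by move=> x0; apply: integrableS hi => //; exact: itv_oc_sub_half.
split; first exact: le_trans pn.
rewrite big_ord_recr/= (@itv_bndbnd_setU _ _ _ (BRight (p n))) ?bnd_simp//.
rewrite Rintegral_setU//=; last 2 first.
- rewrite -itv_bndbnd_setU ?bnd_simp//; exact: int.
- apply/disj_setPRL => t /=; rewrite !in_itv/= => /andP[pt _]; apply/negP.
  by rewrite negb_and -ltNge pt orbT.
rewrite opprD addrACA (le_trans (ler_normD _ _))//.
rewrite (_ : c * _ = c * (p n - p 0%N) + c * (p n.+1 - p n)); last by ring.
rewrite lerD// riemann_step//; first by apply: int; exact: le_trans p0n.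
by move=> t; exact: hc.
Qed.

End ScalarRiemannSums.

(** * Integrals of operator valued functions *)

Section OperatorIntegrals.
Context {R : realType} {d : nat} {H : completeNormedModType R}.
Variable ip : {dot H for @idfun R}.
Hypothesis hip : norm_from_dot ip.
Local Notation V := (hmod d H).
Notation mu := (@lebesgue_measure R).
Implicit Types (u v w : V) (F : R -> V -> V).
Local Notation "<[ v , w ]>" := (hdot ip v w).

Definition op_cts F : Prop :=
  forall t : R, 0 < t -> forall eps : R, 0 < eps -> exists2 delta : R, 0 < delta &
    forall u : R, 0 < u -> `|u - t| < delta ->
      opnorm_le (fun v => F u v - F t v) eps.

(** The integrands of the functional calculus: continuous on the open half line
    and dominated in operator norm by an integrable function. *)
Definition tame F : Prop :=
  [/\ forall t, 0 < t -> rlinear (F t), op_cts F &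
      exists g : R -> R,
        [/\ measurable_fun (`]0, +oo[ : set R) g,
            (\int[mu]_(t in `]0%R, +oo[) (g t)%:E < +oo)%E &
            forall t, 0 < t -> 0 <= g t /\ opnorm_le (F t) (g t)]].

Lemma rlinearN (B : V -> V) v : rlinear B -> B (- v) = - B v.
Proof. by move=> [_ BZ]; rewrite -scaleN1r BZ scaleN1r. Qed.

Lemma rlinearB (B : V -> V) v w : rlinear B -> B (v - w) = B v - B w.
Proof. by move=> lB; rewrite (proj1 lB) rlinearN. Qed.

(** Taking adjoints preserves operator norms, hence both continuity and the
    majorant. *)
Lemma tame_dual F F' :
  (forall t, 0 < t -> forall v w, <[F' t w, v]> = <[w, F t v]>) ->
  tame F -> tame F'.
Proof.
move=> FF' [lF cF [g [mg ig gF]]]; split.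
- by move=> t t0; apply: (@rlinear_dual _ _ _ _ hip (F t)) => v w; exact: FF'.
- move=> t t0 eps eps0; have [delta delta0 dP] := cF t t0 eps eps0.
  exists delta => // u u0 ut.
  apply: (opnorm_dual hip (ltW eps0) _ (dP u u0 ut)) => v w.
  by rewrite hdotBl hdotBr !FF'.
- exists g; split=> // t t0; have [g0 Fg] := gF t t0; split=> //.
  by apply: (opnorm_dual hip g0 _ Fg) => v w; exact: FF'.
Qed.

Lemma tameN (F : R -> V -> V) : tame F -> tame (fun t v => - F t v).
Proof.
move=> [lF cF [g [mg ig gF]]]; split.
- move=> t /lF[FD FZ]; split=> [v w|a v]; first by rewrite FD opprD.
  by rewrite FZ scalerN.
- move=> t t0 eps eps0; have [delta delta0 dP] := cF t t0 eps eps0.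
  exists delta => // u u0 ut v; rewrite -(hnormN hip) opprD !opprK; exact: dP.
- exists g; split=> // t /gF[g0 Fg]; split=> // v.
  by rewrite (hnormN hip).
Qed.

Section Fixed.
Variable F : R -> V -> V.
Hypothesis tF : tame F.

Let lF t : 0 < t -> rlinear (F t). Proof. by case: tF => lF _ _; exact: lF. Qed.
Let cF : op_cts F. Proof. by case: tF. Qed.

Lemma tame_bound : exists g : R -> R,
  mu.-integrable `]0, +oo[ (EFin \o g) /\
  forall t, 0 < t -> 0 <= g t /\ opnorm_le (F t) (g t).
Proof.
case: tF => _ _ [g [mg ig gF]]; exists g; split=> //.
apply/integrableP; split; first exact/measurable_EFinP.
apply: le_lt_trans ig; apply: ge0_le_integral => //=.
- by apply: measurableT_comp => //; exact: measurableT_comp.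
- exact/measurable_EFinP.
- move=> t; rewrite in_itv/= andbT => /gF[g0 _].
  by rewrite lee_fin ger0_norm.
Qed.

Lemma pairing_continuous v w (t : R) : 0 < t ->
  {for t, continuous (fun t => <[w, F t v]>)}.
Proof.
move=> t0; apply/cvgrPdist_le => /= eps eps0.
have c0 : 0 < hnorm w * hnorm v + 1.
  by rewrite ltr_wpDl// mulr_ge0 ?hnorm_ge0.
have [delta delta0 dP] := cF t0 (divr_gt0 eps0 c0).
near=> u; rewrite -hdotBr (le_trans (normr_hdot hip _ _))//.
have u0 : 0 < u by near: u; exact: lt_nbhsr.
have ut : `|u - t| < delta.
  by rewrite distrC; near: u; exact: (nbhsx_ballx t delta delta0).
have := dP u u0 ut v; rewrite -(hnormN hip) opprB => le.
rewrite (le_trans (ler_wpM2l (hnorm_ge0 w) le))// mulrCA -mulrA.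
rewrite -[leRHS]mulr1 ler_wpM2l ?(ltW eps0)//.
by rewrite mulrC ler_pdivrMr// mul1r lerDl.
Unshelve. all: by end_near. Qed.

Lemma pairing_integrable v w :
  mu.-integrable `]0, +oo[ (EFin \o (fun t => <[w, F t v]>)).
Proof.
have [g [ig gF]] := tame_bound.
have igZ : mu.-integrable `]0, +oo[
    (fun t => (hnorm w * hnorm v)%:E * (EFin \o g) t)%E by exact: integrableZl.
apply: le_integrable igZ => //.
- apply/measurable_EFinP.
  have oD : open (`]0, +oo[%classic : set R) by exact: interval_open.
  apply: (open_continuous_measurable_fun oD).
  move=> t; rewrite inE/= in_itv/= andbT => t0.
  exact: pairing_continuous t0.
- move=> t; rewrite /= in_itv/= andbT => /gF[g0 Fg].
  rewrite lee_fin (le_trans (normr_hdot hip _ _))// ger0_norm; last first.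
    by rewrite !mulr_ge0 ?hnorm_ge0.
  by rewrite -mulrA ler_wpM2l ?hnorm_ge0// mulrC.
Qed.

Lemma weak_bound (g : R -> R) (D : set R) v w :
  mu.-integrable `]0, +oo[ (EFin \o g) ->
  (forall t, 0 < t -> 0 <= g t /\ opnorm_le (F t) (g t)) ->
  measurable D -> D `<=` (`]0, +oo[ : set R) ->
  `|\int[mu]_(t in D) <[w, F t v]>| <= (\int[mu]_(t in D) g t * hnorm v) * hnorm w.
Proof.
move=> ig gF mD D0.
have igD : mu.-integrable D (EFin \o g) by exact: integrableS ig.
have ihD : mu.-integrable D (EFin \o (fun t => <[w, F t v]>)).
  by apply: integrableS (pairing_integrable v w).
have t0 t : D t -> 0 < t by move=> /D0 /=; rewrite in_itv/= andbT.
rewrite (le_trans (le_normr_Rintegral _ _))// -mulrA -RintegralZr//.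
apply: le_Rintegral => //.
- exact/integrable_norm.
- apply: eq_integrable (integrableZr _ (hnorm v * hnorm w) igD) => //.
- move=> t /t0/gF[g0 Fg]; rewrite (le_trans (normr_hdot hip _ _))//.
  by rewrite mulrC mulrA ler_wpM2r ?hnorm_ge0.
Qed.

(** The pairing is a bilinear form bounded by the integral of the majorant, so the
    Riesz theorem represents it by an operator. *)
Lemma weak_integral (D : set R) : measurable D -> D `<=` (`]0, +oo[ : set R) ->
  exists B, bounded_op B /\
    forall v w, <[w, B v]> = \int[mu]_(t in D) <[w, F t v]>.
Proof.
move=> mD D0; have [g [ig gF]] := tame_bound.
have igD : mu.-integrable D (EFin \o g) by exact: integrableS ig.
have ihD v w : mu.-integrable D (EFin \o (fun t => <[w, F t v]>)).
  by apply: integrableS (pairing_integrable v w).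
have t0 t : D t -> 0 < t by move=> /D0 /=; rewrite in_itv/= andbT.
have gD0 : 0 <= \int[mu]_(t in D) g t.
  by apply: Rintegral_ge0 => t /t0/gF[].
have bnd v w := weak_bound v w ig gF mD D0.
have /choice[B BP] v : exists y, forall w,
    \int[mu]_(t in D) <[w, F t v]> = <[y, w]>.
  apply: (@riesz _ _ _ _ hip _ (\int[mu]_(t in D) g t * hnorm v)) => //.
  - move=> w w'; rewrite -RintegralD//; apply: eq_Rintegral => t _.
    by rewrite hdotDl.
  - by move=> a w; rewrite -RintegralZl//; apply: eq_Rintegral => t _; rewrite hdotZl.
exists B; split; last by move=> v w; rewrite BP hdotC.
split.
  split=> [v v'|a v]; apply: (hdot_inj hip) => w.
    rewrite hdotDl -!BP -RintegralD//; apply: eq_Rintegral => t.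
    by rewrite inE => /t0/lF[FD _]; rewrite FD hdotDr.
  rewrite hdotZl -!BP -RintegralZl//; apply: eq_Rintegral => t.
  by rewrite inE => /t0/lF[_ FZ]; rewrite FZ hdotZr.
exists (\int[mu]_(t in D) g t) => // v; apply: (hnorm_le_dot hip) => [|w].
  by rewrite mulr_ge0 ?hnorm_ge0.
by rewrite hdotC -BP (le_trans (ler_norm _))// bnd.
Qed.

(** Heine's theorem, from the compactness of the segment as a near covering
    property indexed by the radius [delta]. *)
Lemma op_unif_cts (a b : R) : 0 < a -> forall eps : R, 0 < eps ->
  exists2 delta : R, 0 < delta & forall t u : R, a <= t <= b -> 0 < u ->
    `|u - t| < delta -> opnorm_le (fun v => F u v - F t v) eps.
Proof.
move=> a0 eps eps0.
pose P (delta x : R) := forall u : R, 0 < u -> `|u - x| < delta ->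
  opnorm_le (fun v => F u v - F x v) eps.
have /compact_near_coveringP/(_ R (0 : R)^'+ P _) := @segment_compact R a b.
case=> [x|e e0 H'].
  rewrite /= in_itv/= => /andP[ax _].
  have x0 := lt_le_trans a0 ax.
  have [d0 d00 dP] := cF x0 (divr_gt0 eps0 (ltr0n R 2)).
  have d20 : 0 < d0 / 2 by rewrite divr_gt0.
  exists ([set y | 0 < y /\ `|y - x| < d0 / 2], [set e | e < d0 / 2]).
    split; last exact: nbhs_right_lt.
    near=> y; split; first by near: y; exact: lt_nbhsr.
    by rewrite distrC; near: y; exact: (nbhsx_ballx x _ d20).
  move=> [y e] /= [[y0 yx] ed] u u0 uy v.
  have ux : `|u - x| < d0.
    rewrite -(subrK y u) -addrA (le_lt_trans (ler_normD _ _))//.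
    by rewrite [ltRHS]splitr ltrD// (lt_trans uy).
  have yx' : `|y - x| < d0.
    by rewrite (lt_le_trans yx)// ler_pdivrMr// ler_peMr ?ler1n// ltW.
  have := dP u u0 ux v; have := dP y y0 yx' v.
  rewrite -(hnormN hip) opprB => h1 h2.
  rewrite (_ : F u v - F y v = (F u v - F x v) + (F x v - F y v)); last first.
    by rewrite addrA subrK.
  by rewrite (le_trans (hnormD hip _ _))// [eps]splitr mulrDl lerD.
exists (e / 2) => [|t u tab u0 ut]; first by rewrite divr_gt0.
apply: (H' (e / 2) _ _ t) => //.
  rewrite /= sub0r normrN ger0_norm ?ltr_pdivrMr ?ltr_pMr ?ltr1n ?(ltW e0)//.
  by rewrite divr_ge0// ltW.
by rewrite divr_gt0.
Unshelve. all: by end_near. Qed.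

Lemma tagged_partition_mono (a b delta : R) n (p xi : nat -> R) :
  tagged_partition a b delta n p xi ->
  forall i, (i <= n)%N -> a <= p i <= b.
Proof.
move=> [p0 pn pxi] i ilen.
have mono j k : (j <= k)%N -> (k <= n)%N -> p j <= p k.
  move=> jk; elim: k jk => [|k IH]; first by rewrite leqn0 => /eqP ->.
  rewrite leq_eqVlt => /predU1P[->//|jk kn].
  have [/andP[h1 h2] _] := pxi k kn.
  by rewrite (le_trans (IH _ (ltnW kn)))// (le_trans h1).
by rewrite -p0 -pn !mono.
Qed.

(** Uniform continuity bounds the pairings of the Riemann error by the product of
    the norms of the two vectors, which is a bound in operator norm. *)
Lemma weak_integral_RInt (a b : R) (B : V -> V) : 0 < a -> a <= b ->
  (forall v w, <[w, B v]> = \int[mu]_(t in `]a, b]) <[w, F t v]>) ->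
  is_op_RInt F a b B.
Proof.
move=> a0 ab BP eps eps0.
have ba1 : 0 < b - a + 1 by rewrite ltr_wpDl// subr_ge0.
set c := eps / (b - a + 1).
have c0 : 0 < c by rewrite divr_gt0.
have [delta delta0 dP] := op_unif_cts b a0 c0.
exists delta => // n p xi tp v.
have pab := tagged_partition_mono tp.
have [p0 pn pxi] := tp.
apply: (hnorm_le_dot hip) => [|w]; first by rewrite mulr_ge0 ?hnorm_ge0 ?ltW.
rewrite hdotBr BP -p0 -pn.
have -> : <[w, \sum_(i < n) (p i.+1 - p i) *: F (xi i) v]>
    = \sum_(i < n) (p i.+1 - p i) * <[w, F (xi i) v]>.
  elim/big_ind2 : _ => [|x x' y y' <- <-|i _]; first exact: hdot0r.
    exact: hdotDr.
  exact: hdotZr.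
have [|||i t ilt /andP[pit tpi]|_] := @riemann_sum_error R (fun t => <[w, F t v]>) n p xi
  (c * hnorm v * hnorm w).
- by rewrite p0 ltW.
- exact: pairing_integrable.
- by move=> i /pxi[/andP[h1 h2] _]; exact: le_trans h2.
- have [/andP[pixi xipi] dd] := pxi i ilt.
  have /andP[api _] := pab i (ltnW ilt); have /andP[_ pib] := pab i.+1 ilt.
  rewrite -hdotBr (le_trans (normr_hdot hip _ _))// mulrC ler_wpM2r ?hnorm_ge0//.
  apply: dP; first by rewrite (le_trans api (ltW pit)) (le_trans tpi).
    by rewrite (lt_le_trans a0)// (le_trans api).
  apply: le_lt_trans dd; rewrite ler_norml; apply/andP; split; lra.
move=> /(le_trans (ler_norm _))/le_trans; apply; rewrite p0 pn.
rewrite -[leRHS]mulrA [leLHS](_ : _ = c * (b - a) * (hnorm v * hnorm w)).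
  rewrite ler_wpM2r ?mulr_ge0 ?hnorm_ge0// /c mulrAC ler_pdivrMr//.
  by rewrite ler_wpM2l ?lerDl// ltW.
by ring.
Qed.


(** Monotone convergence along the intervals ]1 / (n + 1), n + 1], which exhaust
    the half line. *)
Lemma integrable_tail (g : R -> R) (eps : R) : 0 < eps ->
  mu.-integrable `]0, +oo[ (EFin \o g) -> (forall t, 0 < t -> 0 <= g t) ->
  exists a0 b0 : R, [/\ 0 < a0, a0 <= b0 & forall a b, 0 < a < a0 -> b0 < b ->
    \int[mu]_(t in (`]0, +oo[%classic `\` `]a, b]%classic)) g t <= eps].
Proof.
move=> eps0 ig g0.
pose I (n : nat) : set R := `]n.+1%:R^-1, n.+1%:R]%classic.
have I0 n : I n `<=` (`]0, +oo[ : set R) by apply: itv_oc_sub_half; rewrite invr_ge0.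
have mI n : measurable (I n) by exact: measurable_itv.
have mg : measurable_fun (`]0, +oo[ : set R) (EFin \o g) by exact: (measurable_int mu).
have Inb n m : (n <= m)%N -> I n `<=` I m.
  move=> nm t; rewrite /I/= !in_itv/= => /andP[h1 h2]; apply/andP; split.
    by apply: le_lt_trans h1; rewrite lef_pV2 ?posrE// ler_nat.
  by rewrite (le_trans h2)// ler_nat.
have UI : \bigcup_n I n = `]0%R, +oo[%classic.
  apply/seteqP; split=> [t [n _ /I0//]|t /=]; rewrite in_itv/= andbT => t0.
  have [N NP] := @invS_small R t t0.
  (* [N.+1] and not [N]: the interval is open on the left. *)
  exists (maxn N.+1 (Num.truncn t)); first by [].
  rewrite /I/= in_itv/=; apply/andP; split.
    apply: (@lt_le_trans _ _ (N.+1%:R^-1)); last exact: NP.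
    by rewrite ltf_pV2 ?posrE// ltr_nat ltnS leq_max ltnSn.
  rewrite ltW// (lt_le_trans (truncnS_gt _))// ler_nat ltnS leq_max leqnn orbT//.
have cI : (\int[mu]_(t in I n) (g t)%:E)%E @[n --> \oo] -->
    (\int[mu]_(t in `]0%R, +oo[) (g t)%:E)%E.
  rewrite -UI; apply: ge0_nondecreasing_set_cvg_integral => //.
  - by apply/nondecreasing_seqP => n; rewrite subsetEset; exact: Inb.
  - by move=> n; exact: measurable_funS mg.
  - by move=> n t /I0 /=; rewrite in_itv/= andbT lee_fin => /g0.
have fin : (\int[mu]_(t in `]0%R, +oo[) (g t)%:E)%E \is a fin_num.
  exact: integrable_fin_num.
have /fine_cvgP[_ /cvgrPdist_le/(_ _ eps0)[N _ /(_ N (leqnn N))]] :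
    (\int[mu]_(t in I n) (g t)%:E)%E @[n --> \oo] -->
      (fine (\int[mu]_(t in `]0%R, +oo[) (g t)%:E)%E)%:E by rewrite fineK.
rewrite /= -/(Rintegral mu (I N) g) -/(Rintegral mu _ g) => NP.
exists (N.+1%:R^-1), (N.+1%:R); split.
- by rewrite invr_gt0.
- by rewrite (@le_trans _ _ 1)// ?invf_le1// ?ler1n.
move=> a b /andP[a0 aN] Nb.
have sub : `]0, +oo[%classic `\` `]a, b]%classic `<=` `]0, +oo[%classic `\` I N.
  move=> t [t0 tab]; split=> // tI; apply: tab; move: tI.
  rewrite /I/= !in_itv/= => /andP[h1 h2].
  by rewrite (lt_trans aN h1) (le_trans h2)// ltW.
have split_int : \int[mu]_(t in `]0, +oo[) g t
    = \int[mu]_(t in I N) g t + \int[mu]_(t in (`]0, +oo[%classic `\` I N)) g t.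
  rewrite -{1}(setDUK (@I0 N)) Rintegral_setU ?setDUK//.
  - exact: mI.
  - by apply: measurableD => //; exact: mI.
  - by apply/disj_setPRL => t /= [].
have mono (A B : set R) : measurable A -> measurable B -> A `<=` B ->
    B `<=` `]0, +oo[%classic -> \int[mu]_(t in A) g t <= \int[mu]_(t in B) g t.
  move=> mA mB AB B0.
  have igB : mu.-integrable B (EFin \o g) by apply: integrableS ig.
  have igA : mu.-integrable A (EFin \o g) by apply: integrableS igB.
  rewrite /Rintegral fine_le ?integrable_fin_num//.
  apply: ge0_subset_integral => //; first exact: (measurable_int mu).
  by move=> t /B0 /=; rewrite in_itv/= andbT lee_fin => /g0.
apply: le_trans (mono _ _ _ _ sub _) _.
- by apply: measurableD => //; exact: measurable_itv.
- by apply: measurableD => //; exact: mI.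
- by move=> t [].
by move: NP; rewrite split_int addrAC subrr add0r => /(le_trans (ler_norm _)).
Qed.

(** The integral over a compact interval misses only the part carried by the
    complement, where the majorant has little mass. *)
Lemma tame_integral : exists A,
  [/\ bounded_op A, is_op_RInt_gen F A &
      forall v w, <[w, A v]> = \int[mu]_(t in `]0, +oo[) <[w, F t v]>].
Proof.
have [g [ig gF]] := tame_bound.
have [//|//|A [bA AP]] := @weak_integral `]0, +oo[%classic.
exists A; split=> // eps eps0.
have [|a0 [b0 [a00 ab0 tail]]] := integrable_tail eps0 ig.
  by move=> t /gF[].
exists a0, b0; split=> // a b /andP[apos alt] bgt.
have ab : a <= b by rewrite (le_trans (ltW alt))// (le_trans ab0)// ltW.
have sub0 : `]a, b]%classic `<=` (`]0, +oo[%classic : set R).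
  by apply: itv_oc_sub_half; exact: ltW.
have [//|//|B [bB BP]] := @weak_integral `]a, b]%classic.
exists B; first exact: weak_integral_RInt.
have mD : measurable (`]0, +oo[%classic `\` `]a, b]%classic : set R).
  exact: measurableD.
have D0 : `]0, +oo[%classic `\` `]a, b]%classic `<=` (`]0, +oo[%classic : set R).
  by move=> t [].
move=> v; rewrite (hnormBC hip); apply: (hnorm_le_dot hip) => [|w].
  by rewrite mulr_ge0 ?hnorm_ge0// ltW.
rewrite hdotBr AP BP -{1}(setDUK sub0) Rintegral_setU//; last 2 first.
- by rewrite setDUK//; exact: pairing_integrable.
- by apply/disj_setPRL => t /= [].
rewrite addrAC subrr add0r (le_trans (ler_norm _))//.
rewrite (le_trans (weak_bound v w ig gF mD D0))//.
by rewrite !ler_wpM2r ?hnorm_ge0// tail// apos.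
Qed.

End Fixed.
End OperatorIntegrals.

(** * Geometry of double sectors *)

Section SectorGeometry.
Context {R : realType} {d : nat}.
Local Notation Rd := (clifford R d).
Implicit Types (s t J : Rd) (x y theta omega phi : R).

Lemma cl_norm_eq0 s : cl_norm s = 0 -> s = 0.
Proof.
move=> s0; apply/ffunP => A; apply/eqP; rewrite ffunE -normr_le0 -s0.
exact: le_cl_norm.
Qed.

Lemma cl_norm0 : cl_norm (0 : Rd) = 0.
Proof.
rewrite /cl_norm big1 ?sqrtr0// => A _.
by rewrite ffunE expr0n.
Qed.

(** With the l1 norm on the right, bounds on coordinates suffice. *)
Lemma cl_norm_leD s t : cl_norm (s + t) <= cl_norm s + \sum_A `|t A|.
Proof.
have S0 : 0 <= \sum_A `|t A| by exact: sumr_ge0.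
rewrite -(@ler_pXn2r _ 2) ?nnegrE ?addr_ge0 ?cl_norm_ge0//.
rewrite cl_norm_sqr.
have le2 : cl_norm t ^+ 2 <= (\sum_A `|t A|) ^+ 2.
  by rewrite ler_pXn2r ?nnegrE ?cl_norm_ge0// cl_norm_le_sum.
have cross : \sum_A s A * t A <= cl_norm s * \sum_A `|t A|.
  rewrite mulr_sumr ler_sum// => A _.
  rewrite (le_trans (ler_norm _))// normrM ler_wpM2r//.
  exact: le_cl_norm.
have -> : \sum_A (s + t) A ^+ 2
    = cl_norm s ^+ 2 + 2 * (\sum_A s A * t A) + cl_norm t ^+ 2.
  rewrite !cl_norm_sqr mulr_sumr -!big_split/=; apply: eq_bigr => A _.
  by rewrite ffunE sqrrD mulr_natl.
by rewrite sqrrD; nra.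
Qed.

(** The cosine decreases on [0, pi]; the two angular ranges of the double sector
    merge into one inequality, from which openness and closures can be read off. *)
Lemma dsectorP theta s : 0 < theta < pi / 2 ->
  dsector theta s <-> paravector s /\ cos theta * cl_norm s < `|Re0 s|.
Proof.
move=> /andP[t0 t2].
have tpi : theta < pi by have := @pi_gt0 R; lra.
have Arg_spec : s <> 0 -> 0 <= Arg s <= pi /\ cos (Arg s) * cl_norm s = Re0 s.
  move=> s0; have n0 : 0 < cl_norm s.
    by rewrite lt_neqAle cl_norm_ge0 andbT eq_sym; apply/eqP => /cl_norm_eq0.
  have [|rng ->] := @acos_def R (Re0 s / cl_norm s); last by rewrite mulfVK ?gt_eqF.
  have := le_cl_norm s finset.set0; rewrite ler_norml => /andP[h1 h2].
  rewrite ler_pdivrMr// mul1r h2 andbT ler_pdivlMr// mulN1r//.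
have in0pi x : 0 <= x <= pi -> x \in `[0, pi] by rewrite in_itv.
have thI : theta \in `[0, pi] by rewrite in_itv/= !ltW.
have thI' : pi - theta \in `[0, pi].
  by rewrite in_itv/= subr_ge0 (ltW tpi) gerBl ltW.
have cpi : cos (pi - theta) = - cos theta.
  by rewrite addrC cosDpi cosN.
split=> [[ps s0 ang]|[ps lt]].
  have [rng RA] := Arg_spec s0; have /in0pi AI := rng.
  have n0 : 0 < cl_norm s.
    by rewrite lt_neqAle cl_norm_ge0 andbT eq_sym; apply/eqP => /cl_norm_eq0.
  split=> //; rewrite -RA.
  case: ang => /andP[lo hi].
    rewrite (lt_le_trans _ (ler_norm _))// ltr_pM2r//.
    by rewrite ltr_cos.
  rewrite -normrN (lt_le_trans _ (ler_norm _))// -mulNr ltr_pM2r//.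
  by rewrite ltrNr -cpi ltr_cos.
have s0 : s <> 0.
  by move=> s0; move: lt; rewrite s0 cl_norm0 mulr0 /Re0 ffunE normr0 ltxx.
have n0 : 0 < cl_norm s.
  by rewrite lt_neqAle cl_norm_ge0 andbT eq_sym; apply/eqP => /cl_norm_eq0.
have [rng RA] := Arg_spec s0; have /in0pi AI := rng.
have /andP[A0 Api] := rng.
split=> //; rewrite /sector_angles/=.
move: lt; rewrite -RA lter_normr => /orP[].
  rewrite ltr_pM2r// ltr_cos// => At; left; rewrite At andbT; lra.
rewrite -mulNr ltr_pM2r// ltrNr -cpi ltr_cos// => At; right; rewrite At /=; lra.
Qed.

Lemma ray_slice J phi (t : R) :
  t *: cl_exp J phi = slice_pt (t * cos phi) (t * sin phi) J.
Proof. exact: scale_slice. Qed.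

Lemma cl_norm_ray J phi (t : R) : imag_unit J -> 0 <= t ->
  cl_norm (t *: cl_exp J phi) = t.
Proof.
move=> hJ t0; rewrite ray_slice cl_norm_slice// !exprMn -mulrDr cos2Dsin2 mulr1.
by rewrite sqrtr_sqr ger0_norm.
Qed.

Lemma Re0_ray J phi (t : R) : imag_unit J -> Re0 (t *: cl_exp J phi) = t * cos phi.
Proof. by move=> hJ; rewrite ray_slice Re0_slice. Qed.

Lemma paravector_ray J phi (t : R) : imag_unit J -> paravector (t *: cl_exp J phi).
Proof. by move=> hJ; rewrite ray_slice; exact: paravector_slice. Qed.

Lemma ray_neq0 J phi (t : R) : imag_unit J -> 0 < t -> t *: cl_exp J phi <> 0.
Proof.
move=> hJ t0 E; have := cl_norm_ray phi hJ (ltW t0); rewrite E cl_norm0 => t00.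
by rewrite t00 ltxx in t0.
Qed.

Lemma dsector_ray J theta psi (t : R) : imag_unit J -> 0 < t ->
  0 < theta < pi / 2 ->
  dsector theta (t *: cl_exp J psi) <-> cos theta < `|cos psi|.
Proof.
move=> hJ t0 th; rewrite (dsectorP _ th) cl_norm_ray ?ltW// Re0_ray//.
rewrite normrM (gtr0_norm t0) mulrC ltr_pM2l//.
by split=> [[]//|lt]; split=> //; exact: paravector_ray.
Qed.

Lemma para_closure_dsector omega s : 0 < omega < pi / 2 ->
  para_closure (dsector omega) s -> cos omega * cl_norm s <= `|Re0 s|.
Proof.
move=> om [ps cl]; apply/ler_addgt0Pl => eps eps0.
pose N : R := 1 + #|{set 'I_d}|%:R.
have N0 : 0 < N by rewrite ltr_pwDl.
have [t /(dsectorP _ om)[_ lt] st] := cl _ (divr_gt0 eps0 N0).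
have c1 : cos omega <= 1 by exact: cos_le1.
have c0 : 0 < cos omega.
  apply: cos_gt0_pihalf; move: om => /andP[om1 om2].
  by rewrite om2 andbT (lt_trans _ om1)// oppr_lt0 divr_gt0 ?pi_gt0.
have le1 : \sum_A `|(s - t) A| <= #|{set 'I_d}|%:R * cl_norm (s - t).
  rewrite mulr_natl -sumr_const ler_sum// => A _; exact: le_cl_norm.
have := cl_norm_leD t (s - t); rewrite addrC subrK => le2.
have le3 : `|Re0 t| <= `|Re0 s| + cl_norm (s - t).
  have := le_cl_norm (s - t) finset.set0; rewrite !ffunE => le3.
  rewrite -(subrK (Re0 s) (Re0 t)) (le_trans (ler_normD _ _))// addrC lerD2l.
  by rewrite distrC.
have le4 : cl_norm (s - t) * N <= eps by rewrite -ler_pdivlMr// ltW.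
have S0 : 0 <= \sum_A `|(s - t) A| by exact: sumr_ge0.
have le5 : cos omega * cl_norm s <= cos omega * cl_norm t + \sum_A `|(s - t) A|.
  rewrite (le_trans (ler_wpM2l (ltW c0) le2))// mulrDr lerD2l.
  by rewrite ler_piMl.
apply: le_trans le5 _; move: le4 le1 le3 lt; rewrite /N.
move: (#|_|%:R : R) (cl_norm (s - t)) (\sum_A _) (`|Re0 t|) (`|Re0 s|).
move: (cos omega * cl_norm t); clear; move=> a n b c e f; lra.
Qed.

End SectorGeometry.

(** * Right linear operators *)

Section RightLinear.
Context {R : realType} {d : nat} {H : completeNormedModType R}.
Variable ip : {dot H for @idfun R}.
Hypothesis hip : norm_from_dot ip.
Local Notation Rd := (clifford R d).
Local Notation V := (hmod d H).
Local Notation "<[ v , w ]>" := (hdot ip v w).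
Implicit Types (s t J : Rd) (u v w : V) (A B : V -> V).

Lemma right_linear_scale (T : oper) (a : R) v : right_linear T -> dom T v ->
  dom T (a *: v) /\ T (a *: v) = a *: T v.
Proof. by move=> [_ _ Tr] /(Tr v (cl_real a)); rewrite !ract_real. Qed.

Lemma right_linear_sub (T : oper) v w : right_linear T -> dom T v -> dom T w ->
  dom T (v - w) /\ T (v - w) = T v - T w.
Proof.
move=> lT dv dw; have [_ TD _] := lT.
have [dN TN] := right_linear_scale (-1) lT dw.
by have := TD _ _ dv dN; rewrite TN !scaleN1r.
Qed.

Lemma right_linear0 (T : oper) : right_linear T -> T (0 : V) = 0.
Proof.
move=> lT; have [T0 _ _] := lT.
by have [_] := right_linear_scale 0 lT T0; rewrite !scale0r.
Qed.

Lemma full_right_linearP A : right_linear (full_oper A) <->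
  (forall v w, A (v + w) = A v + A w) /\ (forall v s, A (ract v s) = ract (A v) s).
Proof.
split=> [[_ AD Ar]|[AD Ar]].
  by split=> [v w|v s]; [have [] := AD v w I I|have [] := Ar v s I].
by split=> //= v w.
Qed.

Lemma right_linear_rlinear A : right_linear (full_oper A) -> rlinear A.
Proof.
move=> /full_right_linearP[AD Ar]; split=> // a v.
by rewrite -ract_real Ar ract_real.
Qed.

Lemma in_B_bounded A : in_B A -> bounded_op A.
Proof.
move=> [lA [c Ac]]; split; first exact: right_linear_rlinear.
exists `|c| => // v; rewrite (le_trans (Ac v))// ler_wpM2r ?hnorm_ge0//.
exact: ler_norm.
Qed.

Lemma right_linear_dual A A' :
  (forall v w, <[A' w, v]> = <[w, A v]>) -> right_linear (full_oper A) ->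
  right_linear (full_oper A').
Proof.
move=> AA' /full_right_linearP[AD Ar]; apply/full_right_linearP; split.
  by move=> v w; apply: (hdot_inj hip) => u; rewrite hdotDl !AA' hdotDl.
move=> w s; apply: (hdot_inj hip) => u.
by rewrite AA' !(hdot_ract ip) AA' Ar.
Qed.

Lemma bounded_in_B A : bounded_op A -> right_linear (full_oper A) -> in_B A.
Proof. by move=> [_ [c _ Ac]] lA; split=> //; exists c. Qed.

Lemma hnorm_lact_imag J v : imag_unit J -> hnorm (lact J v) = hnorm v.
Proof.
move=> hJ; apply/eqP; rewrite -(@eqrXn2 _ 2) ?hnorm_ge0//.
rewrite -!(hdotvv hip) (hdot_lact ip) cl_conj_imag// lactNl lact_mul imag_unit_sqr//.
by rewrite lactNl lact_real scale1r opprK.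
Qed.

Lemma lact_imag_sqr J v : imag_unit J -> lact J (lact J v) = - v.
Proof. by move=> hJ; rewrite lact_mul imag_unit_sqr// lactNl lact_real scale1r. Qed.

Lemma lact_slice J x y v : lact (slice_pt x y J) v = x *: v + y *: lact J v.
Proof. by rewrite lactDl lact_real lactZl. Qed.

Lemma lact_slice_mul J (x y p q : R) v : imag_unit J ->
 
  lact (slice_pt x y J) (lact (slice_pt p q J) v)
  = lact (slice_pt (x * p - y * q) (x * q + y * p) J) v.
Proof.
move=> hJ; rewrite !lact_slice !scalerDr lactDr !lactZr lact_imag_sqr//.
rewrite scalerDr !scalerN !scalerA.
by rewrite [X in _ + X]addrC addrACA scalerBl scalerDl.
Qed.

Lemma lact_slice_diff J (x y : R) v :
  lact (slice_pt (- x) y J) v - lact (slice_pt x y J) v = (- (2 * x)) *: v.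
Proof.
rewrite !lact_slice opprD addrACA subrr addr0 -scalerBl; congr (_ *: _); ring.
Qed.

Lemma hnorm_lact s v : hnorm (lact s v) <= (\sum_A `|s A|) * hnorm v.
Proof.
have -> : lact s v = \sum_A s A *: lact (cl_e A) v.
  apply/ffunP => C; rewrite lactE sum_ffunE; apply: eq_bigr => A _.
  rewrite ffunE lactE (bigD1 A)//= big1 ?addr0 => [|B /negbTE nB].
    by rewrite ffunE eqxx mulr1 scalerA mulrC.
  by rewrite ffunE nB mulr0 scale0r.
rewrite (le_trans (hnorm_sum hip _))// mulr_suml ler_sum// => A _.
rewrite (hnormZ hip) ler_wpM2l//.
rewrite -(@ler_pXn2r _ 2) ?nnegrE ?hnorm_ge0//.
rewrite -!(hdotvv hip) (hdot_lact ip) cl_conj_e lactZl lact_mul cl_mul_basis lactZl.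
by rewrite symdiffv scalerA basis_sign_sqr scale1r -{2}[v in leRHS]scale1r -lact_real
  /cl_real scale1r.
Qed.

Lemma hnorm_lact_le s v : hnorm (lact s v) <= #|{set 'I_d}|%:R * cl_norm s * hnorm v.
Proof.
rewrite (le_trans (hnorm_lact s v))// ler_wpM2r ?hnorm_ge0//.
by rewrite mulr_natl -sumr_const ler_sum// => A _; exact: le_cl_norm.
Qed.

End RightLinear.

(** * The inverse of Q_s *)

Section Resolvent.
Context {R : realType} {d : nat} {H : completeNormedModType R}.
Variable ip : {dot H for @idfun R}.
Hypothesis hip : norm_from_dot ip.
Local Notation Rd := (clifford R d).
Local Notation V := (hmod d H).
Local Notation "<[ v , w ]>" := (hdot ip v w).
Implicit Types (s t J : Rd) (u v w : V) (A B : V -> V).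
Variable T : @oper R d H.
Hypothesis lT : right_linear T.

Lemma Q_opE (S : oper) s v :
  Q_op s S v = S (S v) - (2 * Re0 s) *: S v + (cl_norm s ^+ 2) *: v.
Proof. by []. Qed.

Lemma Q_inv_unique s B : is_inverse (Q_op s T) B -> Q_inv s T = B.
Proof.
move=> [BQ QB]; apply/funext => v; rewrite /Q_inv.
have [dB QBv] := BQ v.
case: xgetP => [u _ [du Qu]|/(_ (B v))]; last by case.
by rewrite -Qu QB.
Qed.

Lemma Q_invP s : S_resolvent_set T s ->
  in_B (Q_inv s T) /\ is_inverse (Q_op s T) (Q_inv s T).
Proof. by move=> [_ [B [bB iB]]]; rewrite (Q_inv_unique iB). Qed.

Lemma Q_op_eq s s' : Re0 s = Re0 s' -> cl_norm s = cl_norm s' ->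
  Q_op s T = Q_op s' T.
Proof. by move=> e1 e2; rewrite /Q_op e1 e2. Qed.

Lemma Q_inv_eq s s' : Re0 s = Re0 s' -> cl_norm s = cl_norm s' ->
  Q_inv s T = Q_inv s' T.
Proof. by move=> e1 e2; rewrite /Q_inv (Q_op_eq e1 e2). Qed.

Section At.
Variable s : Rd.
Hypothesis sT : S_resolvent_set T s.
Let B := Q_inv s T.

Lemma dom_Q_inv v : dom T (B v) /\ dom T (T (B v)).
Proof. by have [_ [/(_ v)[]]] := Q_invP sT. Qed.

Lemma TT_Q_inv v :
  T (T (B v)) = v + (2 * Re0 s) *: T (B v) - (cl_norm s ^+ 2) *: B v.
Proof.
have [_ [/(_ v)[_ E] _]] := Q_invP sT.
transitivity (Q_op s T (B v) + (2 * Re0 s) *: T (B v) - (cl_norm s ^+ 2) *: B v).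
  by rewrite /= [X in X - _]addrAC addrNK addrK.
by rewrite E.
Qed.

(** [T Q_s^-1 v] belongs to the domain of [T ^ 2], because [T ^ 2 Q_s^-1 v] is a
    combination of vectors of the domain of [T] when [v] is one. *)
Lemma Q_inv_comm v : dom T v -> B (T v) = T (B v).
Proof.
move=> dv; have [d1 d2] := dom_Q_inv v; have [_ [_ /(_ (T (B v)))]] := Q_invP sT.
have [_ TD _] := lT.
have [da Ta] := right_linear_scale (2 * Re0 s) lT d2.
have [db Tb] := right_linear_scale (cl_norm s ^+ 2) lT d1.
have [dc Tc] := TD _ _ dv (TD _ _ dv da).1.
have d3 : dom T (T (T (B v))).
  by rewrite TT_Q_inv; apply: (right_linear_sub lT _ db).1; exact: (TD _ _ dv da).1.
move=> <-; last by split.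
congr (Q_inv s T _).
have E3 : T (T (T (B v)))
    = T v + (2 * Re0 s) *: T (T (B v)) - (cl_norm s ^+ 2) *: T (B v).
  rewrite {1}TT_Q_inv (right_linear_sub lT (TD _ _ dv da).1 db).2.
  by rewrite (TD _ _ dv da).2 Ta Tb.
by rewrite /= E3 [X in X + _]addrAC addrK addrNK.
Qed.

Lemma Q_inv_right_linear : right_linear (full_oper B).
Proof. by have [[]] := Q_invP sT. Qed.

Lemma TQ_inv_right_linear : right_linear (full_oper (fun v => T (B v))).
Proof.
have /full_right_linearP[BD Br] := Q_inv_right_linear.
have [_ TD Tr] := lT.
apply/full_right_linearP; split=> [v w|v a].
  by rewrite BD; apply: (TD _ _ _ _).2; exact: (dom_Q_inv _).1.
by rewrite Br; apply: (Tr _ _ _).2; exact: (dom_Q_inv _).1.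
Qed.

End At.

(** On the two conjugate points of one sphere [Q_s] is the same, so the
    difference of the two S-resolvents isolates [Q_s^-1]. *)
Lemma Q_inv_bound J x y (c : R) : imag_unit J -> y != 0 -> 0 <= c ->
  S_resolvent_set T (slice_pt x y J) ->
  opnorm_le (SL_resolvent (slice_pt x y J) T) c ->
  opnorm_le (SL_resolvent (slice_pt x (- y) J) T) c ->
  opnorm_le (Q_inv (slice_pt x y J) T) (c / `|y|) /\
  opnorm_le (fun v => T (Q_inv (slice_pt x y J) T v)) (c * (`|x| + 2 * `|y|) / `|y|).
Proof.
move=> hJ y0 c0 sT; rewrite /SL_resolvent !cl_conj_slice// opprK.
have -> : Q_inv (slice_pt x (- y) J) T = Q_inv (slice_pt x y J) T.
  by apply: Q_inv_eq; rewrite ?Re0_slice// !cl_norm_slice// sqrrN.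
set B := Q_inv _ T => S1 S2.
have /right_linear_rlinear lB := Q_inv_right_linear sT; have [BD BZ] := lB.
have ny : 0 < `|y| by rewrite normr_gt0.
have Bb : opnorm_le B (c / `|y|).
  move=> v; rewrite mulrAC ler_pdivlMr// mulrC.
  have := S1 (lact J v); have := S2 (lact J v).
  rewrite (hnorm_lact_imag hip v hJ) => h2 h1.
  have E : (2 * y) *: B v = B (lact (slice_pt x (- y) J) (lact J v)) - T (B (lact J v))
      - (B (lact (slice_pt x y J) (lact J v)) - T (B (lact J v))).
    rewrite opprB addrA addrNK -(rlinearB _ _ lB) !lact_slice lact_imag_sqr//.
    rewrite opprD addrACA subrr add0r -scaleNr -scalerDl -BZ; congr B.
    by rewrite scalerN -scaleNr; congr (_ *: _); ring.
  have : hnorm ((2 * y) *: B v) <= 2 * c * hnorm v.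
    rewrite E (le_trans (hnormB hip _ _))//.
    rewrite [leRHS](_ : _ = c * hnorm v + c * hnorm v); first exact: lerD h1 h2.
    by ring.
  by rewrite (hnormZ hip) normrM ger0_norm// -!mulrA ler_pM2l.
split=> // v.
have -> : T (B v) = B (lact (slice_pt x (- y) J) v)
    - (B (lact (slice_pt x (- y) J) v) - T (B v)) by rewrite opprB addrC addrNK.
rewrite (le_trans (hnormB hip _ _))//.
have h1 := S1 v; have h2 := Bb (lact (slice_pt x (- y) J) v).
have h3 : hnorm (lact (slice_pt x (- y) J) v) <= (`|x| + `|y|) * hnorm v.
  rewrite lact_slice (le_trans (hnormD hip _ _))// !(hnormZ hip) normrN.
  by rewrite (hnorm_lact_imag hip)// -mulrDl.
apply: (le_trans (lerD (le_trans h2 (ler_wpM2l _ h3)) h1)); first by rewrite divr_ge0.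
rewrite mulrA -mulrDl ler_wpM2r ?hnorm_ge0//.
rewrite [leRHS](_ : _ = c / `|y| * (`|x| + `|y|) + c)//.
by field; rewrite gt_eqF.
Qed.

End Resolvent.

(** * Resolvent bounds and density of the domain *)

Section Bisectorial.
Context {R : realType} {d : nat} {H : completeNormedModType R}.
Variable ip : {dot H for @idfun R}.
Hypothesis hip : norm_from_dot ip.
Local Notation Rd := (clifford R d).
Local Notation V := (hmod d H).
Local Notation "<[ v , w ]>" := (hdot ip v w).
Implicit Types (s J : Rd) (u v w : V) (A B : V -> V) (t psi : R).
Variables (T : @oper R d H) (omega phi : R) (J : Rd).
Hypothesis homega : 0 < omega < pi / 2.
Hypothesis hT : bisectorial omega T.
Hypothesis hphi : omega < phi < pi / 2.
Hypothesis hJ : imag_unit J.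

Let lT : right_linear T. Proof. by case: hT => -[]. Qed.
Let cT : closed_oper T. Proof. by case: hT => -[]. Qed.

Local Notation ray psi t := (t *: cl_exp J psi).

Lemma ray_resolvent psi t : `|cos psi| < cos omega -> 0 < t ->
  S_resolvent_set T (ray psi t).
Proof.
move=> cpsi t0; have pr := paravector_ray psi t hJ.
apply: contrapT => nres; case: hT => _ /(_ (ray psi t)) sub _.
have /(para_closure_dsector homega) : para_closure (dsector omega) (ray psi t).
  by apply: sub; split.
rewrite (cl_norm_ray psi hJ (ltW t0)) Re0_ray// normrM gtr0_norm// mulrC ler_pM2l//.
by rewrite leNgt cpsi.
Qed.

Lemma cos_phi_omega : cos phi < cos omega.
Proof. by rewrite ltr_cos ?in_itv/=; case/andP: hphi; case/andP: homega; lra. Qed.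

Lemma cos_phi_lt1 : cos phi < 1.
Proof. by rewrite (lt_le_trans cos_phi_omega)// cos_le1. Qed.

Section OnRay.
Variable psi : R.
Hypothesis hpsi : `|cos psi| <= cos phi.

Lemma ray_res t : 0 < t -> S_resolvent_set T (ray psi t).
Proof. by apply: ray_resolvent; exact: le_lt_trans cos_phi_omega. Qed.

Lemma sin_ray_neq0 : sin psi != 0.
Proof.
apply/eqP => s0; have := cos2Dsin2 psi; rewrite s0 expr0n/= addr0 => c1.
have := le_lt_trans hpsi cos_phi_lt1.
rewrite -(@ltr_pXn2r _ 2) ?nnegrE// real_normK ?num_real// c1 expr1n.
by rewrite ltxx.
Qed.

(** On a ray away from the sector the imaginary part of [s] is comparable to
    [|s|], so the bounds of [Q_inv_bound] become powers of [t]. *)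
Lemma ray_bounds : exists2 K, 0 <= K & forall t, 0 < t ->
  opnorm_le (Q_inv (ray psi t) T) (K / t ^+ 2) /\
  opnorm_le (fun v => T (Q_inv (ray psi t) T v)) (K / t).
Proof.
have [_ _ /(_ phi hphi)[C C0 HC]] := hT.
have s0 : 0 < `|sin psi| by rewrite normr_gt0 sin_ray_neq0.
have s1 : `|sin psi| <= 1 by rewrite ler_norml sin_geN1 sin_le1.
have c1 : `|cos psi| <= 1 by rewrite ler_norml cos_geN1 cos_le1.
(* [|cos| + 2 |sin| <= 3], and [1 <= 3] for the first bound. *)
exists (3 * C / `|sin psi|); first by rewrite !mulr_ge0 ?invr_ge0.
have phi02 : 0 < phi < pi / 2 by case/andP: hphi; case/andP: homega; lra.
have SLb chi t : 0 < t -> `|cos chi| <= cos phi ->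
    opnorm_le (SL_resolvent (ray chi t) T) (C / t).
  move=> t0 cchi; rewrite -[X in C / X](cl_norm_ray chi hJ (ltW t0)).
  apply: HC; [exact: paravector_ray| |exact: ray_neq0].
  by move=> /(dsector_ray chi hJ t0 phi02); rewrite ltNge cchi.
move=> t t0.
have [||||||B1 B2] := @Q_inv_bound _ _ _ _ hip T J (t * cos psi) (t * sin psi) (C / t).
- exact: hJ.
- by rewrite mulf_neq0 ?sin_ray_neq0 ?gt_eqF.
- by rewrite divr_ge0// ltW.
- by rewrite -ray_slice; exact: ray_res.
- by rewrite -ray_slice; exact: SLb.
- by rewrite -mulrN -sinN -(cosN psi) -ray_slice; apply: SLb; rewrite ?cosN.
have Kle (x y : R) : x <= y -> forall v, x * hnorm v <= y * hnorm v.
  by move=> xy v; rewrite ler_wpM2r ?hnorm_ge0.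
rewrite ray_slice; split=> v.
  apply: (le_trans (B1 v)); apply: Kle.
  rewrite normrM (gtr0_norm t0).
  rewrite [leLHS](_ : _ = C / `|sin psi| / t ^+ 2); last by field; rewrite !gt_eqF.
  rewrite ler_wpM2r ?invr_ge0 ?exprn_ge0 ?(ltW t0)// ler_wpM2r ?invr_ge0//.
  by rewrite ler_peMl// ler1n.
apply: (le_trans (B2 v)); apply: Kle.
rewrite !normrM (gtr0_norm t0).
rewrite [leLHS](_ : _ = C * (`|cos psi| + 2 * `|sin psi|) / `|sin psi| / t); last first.
  by field; rewrite !gt_eqF.
rewrite ler_wpM2r ?invr_ge0 ?(ltW t0)// ler_wpM2r ?invr_ge0//.
rewrite mulrC ler_wpM2r//; lra.
Qed.

End OnRay.

(** If [v] is orthogonal to the domain, the vectors [x_n = T Q_n^-1 v] tend to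
    zero, while [T x_n] stays bounded with the fixed component [|v|^2] on [v].
    Almost minimizing the norm of [T x_n] over convex sets of such [x_n] makes it
    converge, and closedness forces the limit to be [T 0 = 0]. *)
Lemma dom_dense v : (forall u, dom T u -> <[v, u]> = 0) -> v = 0.
Proof.
move=> vorth.
have h2 : `|cos (pi / 2 : R)| <= cos phi.
  rewrite cos_pihalf normr0 cos_ge0_pihalf//.
  by case/andP: hphi; case/andP: homega; lra.
have [K K0 HK] := ray_bounds h2.
have n0 n : 0 < n.+1%:R :> R by [].
(* At [psi = pi / 2] the linear term of [Q_s] vanishes: [Q_s = T ^ 2 + |s|^2]. *)
pose B n := Q_inv (ray (pi / 2) n.+1%:R) T.
pose Kn n := [set y | exists x, [/\ dom T x, T x = y,
  hnorm x <= K * hnorm v * n.+1%:R^-1 & <[v, y]> = hnorm v ^+ 2]].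
have [|||z [l [zK _ zl]]] := @minimizing_sequence _ _ _ _ hip Kn
    (hnorm v + K * hnorm v).
- move=> n m nm y [x [dx Tx xle vy]]; exists x; split=> //.
  apply: (le_trans xle); rewrite ler_wpM2l ?mulr_ge0 ?hnorm_ge0//.
  by rewrite lef_pV2 ?posrE// ler_nat.
- move=> n y1 y2 [x1 [d1 T1 l1 v1]] [x2 [d2 T2 l2 v2]].
  have [_ TD _] := lT; have [d12 T12] := TD _ _ d1 d2.
  have [d3 T3] := right_linear_scale 2^-1 lT d12.
  exists (2^-1 *: (x1 + x2)); split=> //.
  + by rewrite T3 T12 T1 T2.
  + rewrite (hnormZ hip) ger0_norm// ler_pdivrMl//.
    apply: (le_trans (hnormD hip _ _)); move: l1 l2.
    move: (K * hnorm v * _) (hnorm x1) (hnorm x2) => a b c; lra.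
  + by rewrite hdotZr hdotDr v1 v2; field.
- move=> n; have res := ray_res h2 (n0 n).
  have [dB dTB] := dom_Q_inv res v; have := TT_Q_inv res v.
  have [B1 B2] := HK _ (n0 n).
  rewrite Re0_ray// cos_pihalf mulr0 mulr0 scale0r addr0 cl_norm_ray// => TTB.
  exists (T (T (B n v))).
    exists (T (B n v)); split=> //.
      by rewrite mulrAC; exact: B2.
    by rewrite TTB hdotBr hdotZr (vorth _ dB) mulr0 subr0 (hdotvv hip).
  rewrite TTB (le_trans (hnormB hip _ _))// lerD2l (hnormZ hip).
  rewrite ger0_norm ?exprn_ge0//.
  have := B1 v; rewrite mulrAC ler_pdivlMr ?exprn_gt0//.
  by rewrite mulrC.
have /choice[x xP] n := zK n.
have xl0 : (fun n => hnorm (x n - 0)) @ \oo --> 0.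
  have K1 : (fun n : nat => K * hnorm v * n.+1%:R^-1) @ \oo --> 0.
    rewrite -(mulr0 (K * hnorm v)); apply: cvgM; first exact: cvg_cst.
    exact: cvg_harmonic.
  apply: (squeeze_cvgr _ (cvg_cst 0) K1); apply: nearW => n.
  by rewrite subr0 hnorm_ge0; have [_ _ ->] := xP n.
have zTx : (fun n => hnorm (T (x n) - l)) @ \oo --> 0.
  by under eq_fun => n do have [_ -> _ _] := xP n.
have [_ Tl] := cT (fun n => (let: And4 a _ _ _ := xP n in a)) xl0 zTx.
rewrite (right_linear0 lT) in Tl.
have := cvg_hnorm hip zl; rewrite -Tl (hnorm0 hip) => nz0.
have : hnorm v ^+ 2 <= 0.
  apply/ler_addgt0Pl => eps eps0; rewrite addr0.
  have v1 : 0 < hnorm v + 1 by rewrite ltr_wpDl ?hnorm_ge0.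
  have /(cvgn0P (fun n => hnorm_ge0 _))/(_ _ (divr_gt0 eps0 v1))[N HN] := nz0.
  have := HN N (leqnn N); rewrite ler_pdivlMr// => le.
  have [_ _ _ <-] := xP N; rewrite (le_trans (hdot_le hip _ _))//.
  by apply: le_trans le; rewrite mulrC ler_wpM2l ?hnorm_ge0// lerDl.
move=> v2; apply: (hnorm_eq0 hip); apply/eqP.
by rewrite -sqrf_eq0 eq_le v2 sqr_ge0.
Qed.

End Bisectorial.

(** * Resolvents of the adjoint *)

Section Adjoint.
Context {R : realType} {d : nat} {H : completeNormedModType R}.
Variable ip : {dot H for @idfun R}.
Hypothesis hip : norm_from_dot ip.
Local Notation Rd := (clifford R d).
Local Notation V := (hmod d H).
Local Notation "<[ v , w ]>" := (hdot ip v w).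
Implicit Types (s J : Rd) (u v w : V) (A B : V -> V).
Variable T : @oper R d H.
Hypothesis lT : right_linear T.
Hypothesis dense_T : forall v, (forall u, dom T u -> <[v, u]> = 0) -> v = 0.

Local Notation Ts := (adjoint ip T).

(** On a right submodule the Clifford valued pairing is determined by its scalar
    part, so adjoints can be computed with the real inner product. *)
Lemma hinner_adjP u w :
  (forall v, dom T v -> hinner ip u v = hinner ip w (T v)) <->
  (forall v, dom T v -> <[u, v]> = <[w, T v]>).
Proof.
have ract1 v : ract v (cl_e finset.set0) = v.
  by rewrite -[cl_e _]scale1r ract_real scale1r.
split=> E v dv.
  have := congr1 (fun s : Rd => s finset.set0) (E v dv).
  by rewrite !hinnerE basis_sign0l !mul1r !ract1.
apply/ffunP => C; rewrite !hinnerE; congr (_ * _).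
have [_ _ Tr] := lT; have [dC <-] := Tr v (cl_e C) dv.
exact: E.
Qed.

(** Density of the domain makes the adjoint single valued. *)
Lemma adjointP w u : (forall v, dom T v -> <[u, v]> = <[w, T v]>) ->
  dom Ts w /\ Ts w = u.
Proof.
move=> uw; have /hinner_adjP uw' := uw; split; first by exists u.
rewrite /=; case: xgetP => [u' _ /hinner_adjP u'w|/(_ u)]; last by case.
apply/eqP; rewrite -subr_eq0; apply/eqP/dense_T => v dv.
by rewrite hdotBl uw// u'w// subrr.
Qed.

Lemma adjoint_dot w v : dom Ts w -> dom T v -> <[Ts w, v]> = <[w, T v]>.
Proof.
move=> [u /hinner_adjP uw] dv.
by have [_ ->] := adjointP uw; exact: uw.
Qed.

Section At.
Variable s : Rd.
Hypothesis sT : S_resolvent_set T s.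
Let B := Q_inv s T.
Let TB v := T (B v).
Hypothesis bTB : exists2 c, 0 <= c & opnorm_le TB c.

Let bB : bounded_op B. Proof. exact/in_B_bounded/(Q_invP sT).1. Qed.
Let bC : bounded_op TB.
Proof. by split=> //; exact/right_linear_rlinear/TQ_inv_right_linear. Qed.

Let BC v : dom T v -> B (T v) = T (B v). Proof. exact: Q_inv_comm. Qed.
Let TTB v : T (T (B v)) = v + (2 * Re0 s) *: T (B v) - (cl_norm s ^+ 2) *: B v.
Proof. exact: TT_Q_inv. Qed.

(** [Q_s^-1] commutes with [T] on its domain, so that [T] can be moved across the
    pairing as the bounded operator [T Q_s^-1]. *)
Lemma adjoint_adj_Q_inv w : dom Ts (adj ip B w) /\ Ts (adj ip B w) = adj ip TB w.
Proof.
apply: adjointP => v dv; rewrite !(adjP hip)// /TB.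
by rewrite (BC dv).
Qed.

Lemma adjoint_adj_TQ_inv w : dom Ts (adj ip TB w) /\
  Ts (adj ip TB w)
    = w + (2 * Re0 s) *: adj ip TB w - (cl_norm s ^+ 2) *: adj ip B w.
Proof.
apply: adjointP => v dv.
rewrite hdotBl hdotDl !hdotZl !(adjP hip)// /TB (BC dv).
by rewrite TTB hdotBr hdotDr !hdotZr.
Qed.

(** The identity [T ^ 2 Q_s^-1 = 1 + 2 s_0 T Q_s^-1 - |s|^2 Q_s^-1] between bounded
    operators dualizes term by term. *)
Lemma Q_op_adjoint_inverse : is_inverse (Q_op s Ts) (adj ip B).
Proof.
split=> [w|w [dw dTw]].
  have [d1 E1] := adjoint_adj_Q_inv w; have [d2 E2] := adjoint_adj_TQ_inv w.
  have E3 : Ts (Ts (adj ip B w))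
      = w + (2 * Re0 s) *: adj ip TB w - (cl_norm s ^+ 2) *: adj ip B w.
    by rewrite E1.
  split; first by split=> //; rewrite E1.
  rewrite Q_opE E3 E1.
  by rewrite [X in X + _]addrAC addrK addrNK.
apply: (hdot_inj hip) => v; rewrite (adjP hip)//.
have [dB dTB] := dom_Q_inv sT v.
rewrite Q_opE.
rewrite hdotDl hdotBl !hdotZl !adjoint_dot// -/B.
rewrite TTB hdotBr hdotDr !hdotZr.
ring.
Qed.

Lemma Q_inv_adjoint : Q_inv s Ts = adj ip B.
Proof. exact/Q_inv_unique/Q_op_adjoint_inverse. Qed.

Lemma adjoint_resolvent : S_resolvent_set Ts s.
Proof.
have [ps _] := sT; split=> //; exists (adj ip B); split.
  apply: bounded_in_B; first exact: bounded_adj.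
  apply: (right_linear_dual hip (A := B)) => [v w|]; first exact: adjP.
  exact: Q_inv_right_linear.
exact: Q_op_adjoint_inverse.
Qed.

(** In the adjoint of [conj s Q_s^-1] the factor acts first: this exchanges the
    left and the right S-resolvent. *)
Lemma SL_adjoint_dual v w :
  <[SL_resolvent (cl_conj s) Ts w, v]> = <[w, SR_resolvent s T v]>.
Proof.
rewrite /SL_resolvent /SR_resolvent cl_conjK.
rewrite (@Q_inv_eq _ _ _ Ts _ s) ?cl_norm_conj//; last first.
  by rewrite /Re0 cl_conjE basis_sign0l mul1r.
rewrite Q_inv_adjoint (adjoint_adj_Q_inv _).2 hdotBl hdotBr !(adjP hip)//.
by rewrite (hdot_lact ip).
Qed.

Lemma SR_adjoint_dual v w :
  <[SR_resolvent (cl_conj s) Ts w, v]> = <[w, SL_resolvent s T v]>.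
Proof.
rewrite /SL_resolvent /SR_resolvent cl_conjK.
rewrite (@Q_inv_eq _ _ _ Ts _ s) ?cl_norm_conj//; last first.
  by rewrite /Re0 cl_conjE basis_sign0l mul1r.
rewrite Q_inv_adjoint (adjoint_adj_Q_inv _).2 hdotBl hdotBr !(adjP hip)//.
by rewrite (hdot_lact ip) (adjP hip).
Qed.

End At.

End Adjoint.

(** * Continuity in operator norm *)

Section OperatorContinuity.
Context {R : realType} {d : nat} {H : completeNormedModType R}.
Variable ip : {dot H for @idfun R}.
Hypothesis hip : norm_from_dot ip.
Local Notation Rd := (clifford R d).
Local Notation V := (hmod d H).
Implicit Types (u v w : V) (F G : R -> V -> V).

Lemma op_cts_lipschitz F :
  (forall t : R, 0 < t -> exists M r : R, [/\ 0 <= M, 0 < r &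
     forall u : R, 0 < u -> `|u - t| < r ->
       opnorm_le (fun v => F u v - F t v) (M * `|u - t|)]) ->
  op_cts F.
Proof.
move=> lip t t0 eps eps0; have [M [r [M0 r0 HM]]] := lip t t0.
have M1 : 0 < M + 1 by rewrite ltr_wpDl.
exists (Num.min r (eps / (M + 1))); first by rewrite lt_min r0 divr_gt0.
move=> u u0; rewrite lt_min => /andP[ur /ltW ueps] v.
apply: (le_trans (HM u u0 ur v)); rewrite ler_wpM2r ?hnorm_ge0//.
rewrite (le_trans (ler_wpM2l M0 ueps))// mulrCA ler_piMr ?(ltW eps0)//.
by rewrite ler_pdivrMr// mul1r lerDl.
Qed.

Lemma op_ctsD F G : op_cts F -> op_cts G -> op_cts (fun t v => F t v + G t v).
Proof.
move=> cF cG t t0 eps eps0; have e20 : 0 < eps / 2 by rewrite divr_gt0.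
have [d1 d10 H1] := cF t t0 _ e20; have [d2 d20 H2] := cG t t0 _ e20.
exists (Num.min d1 d2); first by rewrite lt_min d10.
move=> u u0; rewrite lt_min => /andP[ud1 ud2] v.
rewrite opprD addrACA (le_trans (hnormD hip _ _))// [eps]splitr mulrDl.
by rewrite lerD ?H1 ?H2.
Qed.

Lemma op_ctsN F : op_cts F -> op_cts (fun t v => - F t v).
Proof.
move=> cF t t0 eps eps0; have [d1 d10 H1] := cF t t0 eps eps0.
exists d1 => // u u0 ut v; rewrite -(hnormN hip) opprD !opprK.
exact: H1.
Qed.

Lemma op_cts_comp F G :
  (forall t, 0 < t -> bounded_op (F t)) -> (forall t, 0 < t -> bounded_op (G t)) ->
  op_cts F -> op_cts G -> op_cts (fun t v => F t (G t v)).
Proof.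
move=> bF bG cF cG t t0 eps eps0.
have [lFt [cf cf0 Hcf]] := bF t t0; have [_ [cg cg0 Hcg]] := bG t t0.
have e2 : 0 < eps / 2 by rewrite divr_gt0.
have f1 : 0 < cf + 1 by rewrite ltr_wpDl.
have g1 : 0 < cg + 1 by rewrite ltr_wpDl.
have [d1 d10 H1] := cF t t0 _ (divr_gt0 e2 g1).
have [d2 d20 H2] := cG t t0 _ (divr_gt0 e2 f1).
have [d3 d30 H3] := cG t t0 _ (ltr01 : 0 < 1 :> R).
exists (Num.min d1 (Num.min d2 d3)); first by rewrite !lt_min d10 d20.
move=> u u0; rewrite !lt_min => /and3P[ud1 ud2 ud3] v.
have -> : F u (G u v) - F t (G t v)
    = (F u (G u v) - F t (G u v)) + F t (G u v - G t v).
  by rewrite (rlinearB _ _ lFt) addrA addrNK.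
rewrite (le_trans (hnormD hip _ _))// [eps]splitr mulrDl lerD//.
  apply: (le_trans (H1 u u0 ud1 (G u v))).
  have gu : hnorm (G u v) <= (cg + 1) * hnorm v.
    rewrite -(subrK (G t v) (G u v)) (le_trans (hnormD hip _ _))//.
    by rewrite mulrDl addrC lerD// H3.
  have q0 : 0 <= eps / 2 / (cg + 1) by rewrite divr_ge0// ltW.
  apply: (le_trans (ler_wpM2l q0 gu)).
  by rewrite mulrA mulfVK ?gt_eqF.
apply: (le_trans (Hcf _)); apply: (le_trans (ler_wpM2l cf0 (H2 u u0 ud2 v))).
rewrite mulrA ler_wpM2r ?hnorm_ge0// mulrCA ler_piMr ?(ltW e2)//.
by rewrite ler_pdivrMr// mul1r lerDl.
Qed.

Lemma bounded_lact s : bounded_op (lact s : V -> V).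
Proof.
split; first by split=> *; rewrite ?lactDr ?lactZr.
by exists (\sum_A `|s A|); [exact: sumr_ge0|move=> v; exact: hnorm_lact].
Qed.

Lemma bounded_comp (A B : V -> V) : bounded_op A -> bounded_op B ->
  bounded_op (fun v => A (B v)).
Proof.
move=> [[AD AZ] [a a0 Ha]] [[BD BZ] [b b0 Hb]]; split.
  by split=> *; rewrite ?BD ?AD ?BZ ?AZ.
exists (a * b) => [|v]; first exact: mulr_ge0.
by rewrite -mulrA (le_trans (Ha _))// ler_wpM2l.
Qed.

Lemma bounded_add (A B : V -> V) : bounded_op A -> bounded_op B ->
  bounded_op (fun v => A v + B v).
Proof.
move=> [[AD AZ] [a a0 Ha]] [[BD BZ] [b b0 Hb]]; split.
  split=> [v w|c v]; first by rewrite AD BD addrACA.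
  by rewrite AZ BZ scalerDr.
exists (a + b) => [|v]; first exact: addr_ge0.
by rewrite mulrDl (le_trans (hnormD hip _ _))// lerD.
Qed.

Lemma bounded_opp (A : V -> V) : bounded_op A -> bounded_op (fun v => - A v).
Proof.
move=> [[AD AZ] [a a0 Ha]]; split.
  by split=> [v w|c v]; rewrite ?AD ?opprD// AZ scalerN.
by exists a => // v; rewrite (hnormN hip).
Qed.

Lemma op_cts_const (A : V -> V) : op_cts (fun=> A).
Proof.
move=> t t0 eps eps0; exists 1 => // u _ _ v.
by rewrite subrr (hnorm0 hip) mulr_ge0 ?hnorm_ge0 ?ltW.
Qed.

Lemma op_cts_lact (alpha : R -> Rd) :
  (forall A (t : R), 0 < t -> {for t, continuous (fun t : R => alpha t A : R)}) ->
  op_cts (fun t => lact (alpha t) : V -> V).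
Proof.
move=> ca t t0 eps eps0.
pose N : R := #|{set 'I_d}|%:R + 1.
have N0 : 0 < N by rewrite ltr_wpDl.
have near_all : \forall u \near t, forall A, `|alpha u A - alpha t A| <= eps / N.
  apply: (@filter_forall _ _
    (fun A (u : R) => `|alpha u A - alpha t A| <= eps / N) (nbhs t)) => A.
  have /cvgrPdist_le/(_ _ (divr_gt0 eps0 N0)) := ca A t t0.
  by apply: filterS => u; rewrite distrC.
have /nbhs_ballP[e /= e0 He] := near_all.
exists e => // u u0 ut v.
rewrite -lactBl (le_trans (hnorm_lact hip _ _))// ler_wpM2r ?hnorm_ge0//.
have le A : `|(alpha u - alpha t) A| <= eps / N.
  by rewrite !ffunE; apply: He; rewrite -ball_normE /= distrC.
apply: (le_trans (ler_sum _ (fun A _ => le A))).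
rewrite sumr_const -mulr_natl mulrCA ler_piMr ?(ltW eps0)//.
by rewrite ler_pdivrMr// mul1r lerDl.
Qed.

End OperatorContinuity.

(** * Integrands on a ray *)

Section Integrands.
Context {R : realType} {d : nat} {H : completeNormedModType R}.
Variable ip : {dot H for @idfun R}.
Hypothesis hip : norm_from_dot ip.
Local Notation Rd := (clifford R d).
Local Notation V := (hmod d H).
Local Notation mu := (@lebesgue_measure R).
Implicit Types (s J : Rd) (u v w : V) (t psi : R) (f : Rd -> Rd).

Local Notation ray J psi t := (t *: cl_exp J psi).

(** What the calculus uses of [f] on one ray. *)
Definition ray_ok J psi f : Prop :=
  (forall A t, 0 < t -> {for t, continuous (fun t => f (ray J psi t) A : R)}) /\
  (\int[mu]_(t in `]0%R, +oo[) (cl_norm (f (t *: cl_exp J psi)%R) / t)%:E < +oo)%E.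

Definition GL (T : @oper R d H) f s c v := SL_resolvent s T (lact c (lact (f s) v)).
Definition GR (T : @oper R d H) f s c v := lact (f s) (lact c (SR_resolvent s T v)).

Lemma ray_ok_continuous J psi f t : ray_ok J psi f -> 0 < t ->
  {for t, continuous (fun t => cl_norm (f (ray J psi t)) / t)}.
Proof.
move=> [fc _] t0; apply: cvgM; last by apply: cvgV; [rewrite gt_eqF|exact: cvg_id].
apply: continuous_cvg; first exact: sqrt_continuous.
apply: cvg_big => [|A _]; first exact: add_continuous.
rewrite expr2; under eq_fun => u do rewrite expr2.
by apply: cvgM; exact: fc.
Qed.

Lemma ray_ok_majorant J psi f (M : R) : 0 <= M -> ray_ok J psi f ->
  measurable_fun (`]0, +oo[ : set R) (fun t => M * (cl_norm (f (ray J psi t)) / t)) /\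
  (\int[mu]_(t in `]0%R, +oo[) (M * (cl_norm (f (t *: cl_exp J psi)%R) / t))%:E < +oo)%E.
Proof.
move=> M0 fok; have [_ fi] := fok.
have mf : measurable_fun (`]0, +oo[ : set R) (fun t => cl_norm (f (ray J psi t)) / t).
  have oD : open (`]0, +oo[%classic : set R) by exact: interval_open.
  apply: (open_continuous_measurable_fun oD).
  move=> t; rewrite inE/= in_itv/= andbT => t0.
  exact: ray_ok_continuous fok t0.
split; first exact: measurable_funM.
under eq_integral do rewrite EFinM.
rewrite ge0_integralZl//.
- by rewrite lte_mul_pinfty.
- exact/measurable_EFinP.
- move=> t; rewrite /= in_itv/= andbT => t0.
  by rewrite lee_fin divr_ge0 ?cl_norm_ge0// ltW.
Qed.

Section Bisectorial.
Variables (T : @oper R d H) (omega phi : R) (J : Rd).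
Hypothesis homega : 0 < omega < pi / 2.
Hypothesis hT : bisectorial omega T.
Hypothesis hphi : omega < phi < pi / 2.
Hypothesis hJ : imag_unit J.
Variable psi : R.
Hypothesis hpsi : `|cos psi| <= cos phi.

Let lT : right_linear T. Proof. by case: hT => -[]. Qed.
Let res t : 0 < t -> S_resolvent_set T (ray J psi t).
Proof. exact: (ray_res homega hT hphi hJ hpsi). Qed.

Let B t := Q_inv (ray J psi t) T.
Let C t v := T (B t v).

Let linB t : 0 < t -> rlinear (B t).
Proof. by move=> /res/Q_inv_right_linear/right_linear_rlinear. Qed.
Let linC t : 0 < t -> rlinear (C t).
Proof. by move=> /res/(TQ_inv_right_linear lT)/right_linear_rlinear. Qed.

Lemma ray_bounded t : 0 < t -> bounded_op (B t) /\ bounded_op (C t).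
Proof.
move=> t0; have [K K0 HK] := ray_bounds hip homega hT hphi hJ hpsi.
have [HB HC] := HK t t0; split; split; [exact: linB| |exact: linC|].
  by exists (K / t ^+ 2) => //; rewrite divr_ge0// exprn_ge0// ltW.
by exists (K / t) => //; rewrite divr_ge0// ltW.
Qed.

(** This is [B u - B t = B u (Q_t - Q_u) B t], where the terms in [T ^ 2] cancel. *)
Lemma ray_resolvent_identity t (u : R) v : 0 < t -> 0 < u ->
  B u v - B t v = B u ((2 * cos psi * (u - t)) *: C t v + (t ^+ 2 - u ^+ 2) *: B t v).
Proof.
move=> t0 u0; have [_ [QBt _]] := Q_invP (res t0).
have [_ [_ BQu]] := Q_invP (res u0).
have [dB dC] := dom_Q_inv (res t0) v.
have Qt : Q_op (ray J psi t) T (B t v) = v by exact: (QBt v).2.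
have Qu : B u (Q_op (ray J psi u) T (B t v)) = B t v by exact: BQu.
rewrite -{1}Qt -{2}Qu -(rlinearB _ _ (linB u0)); congr (B u _).
rewrite !Q_opE !Re0_ray// !cl_norm_ray ?ltW// -/(C t v).
rewrite opprD opprB addrACA [X in X + _]addrC [X in X + _]addrA subrK -!scalerBl.
by congr (_ *: _ + _); ring.
Qed.

(** Both functions are Lipschitz on [t / 2 < u < 3 t / 2], where the bounds at [u]
    are comparable to those at [t]. *)
Lemma op_cts_ray_resolvent : op_cts B /\ op_cts C.
Proof.
have [K K0 HK] := ray_bounds hip homega hT hphi hJ hpsi.
have c1 : `|cos psi| <= 1 by rewrite ler_norml cos_geN1 cos_le1.
have err t (u : R) v : 0 < t -> 0 < u -> `|u - t| < t / 2 ->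
    hnorm ((2 * cos psi * (u - t)) *: C t v + (t ^+ 2 - u ^+ 2) *: B t v)
    <= 5 * K / t * `|u - t| * hnorm v.
  move=> t0 u0 ut; have [HB HC] := HK t t0.
  have ut2 : t + u <= 3 * t by move: ut; rewrite ltr_norml => /andP[]; lra.
  rewrite (le_trans (hnormD hip _ _))// !(hnormZ hip).
  have le1 : `|2 * cos psi * (u - t)| * hnorm (C t v)
      <= 2 * `|u - t| * (K / t * hnorm v).
    rewrite !normrM ger0_norm// ler_pM ?mulr_ge0 ?hnorm_ge0//; last exact: HC.
    by rewrite ler_wpM2r// ler_piMr.
  have le2 : `|t ^+ 2 - u ^+ 2| * hnorm (B t v)
      <= 3 * t * `|u - t| * (K / t ^+ 2 * hnorm v).
    rewrite ler_pM ?hnorm_ge0//; last exact: HB.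
    rewrite subr_sqr normrM distrC mulrC ler_wpM2r//.
    by rewrite ger0_norm// addr_ge0// ltW.
  apply: (le_trans (lerD le1 le2)).
  by rewrite le_eqVlt; apply/orP; left; apply/eqP; field; rewrite gt_eqF.
have half t (u : R) : 0 < t -> 0 < u -> `|u - t| < t / 2 -> u^-1 <= 2 / t.
  move=> t0 u0; rewrite ltr_norml => /andP[lo _].
  by rewrite -[leRHS]invrK lef_pV2 ?posrE ?invr_gt0 ?divr_gt0// invf_div; lra.
have lin2 t (u : R) : 0 < t -> 0 < u -> `|u - t| < t / 2 ->
    forall v, hnorm (B u v - B t v) <= K * (2 / t) ^+ 2 * (5 * K / t * `|u - t| * hnorm v)
      /\ hnorm (C u v - C t v) <= K * (2 / t) * (5 * K / t * `|u - t| * hnorm v).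
  move=> t0 u0 ut v; have [HB HC] := HK u u0; have uhalf := half t u t0 u0 ut.
  have E := ray_resolvent_identity v t0 u0.
  have EC : C u v - C t v = C u ((2 * cos psi * (u - t)) *: C t v
      + (t ^+ 2 - u ^+ 2) *: B t v).
    rewrite {3}/C -E /C (right_linear_sub lT _ _).2//.
      by have [] := dom_Q_inv (res u0) v.
    by have [] := dom_Q_inv (res t0) v.
  have iu : 0 <= u^-1 by rewrite invr_ge0 ltW.
  split.
    rewrite E; apply: (le_trans (HB _)); rewrite ler_pM ?hnorm_ge0 ?err//.
      by rewrite mulr_ge0// invr_ge0 exprn_ge0// ltW.
    by rewrite ler_wpM2l// -exprVn ler_pXn2r ?nnegrE// (le_trans iu).
  rewrite EC; apply: (le_trans (HC _)); rewrite ler_pM ?hnorm_ge0 ?err//.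
    by rewrite mulr_ge0.
  by rewrite ler_wpM2l.
split; apply: op_cts_lipschitz => t t0.
  exists (K * (2 / t) ^+ 2 * (5 * K / t)), (t / 2); split.
  - by rewrite !mulr_ge0 ?exprn_ge0 ?divr_ge0 ?mulr_ge0 ?invr_ge0 ?(ltW t0).
  - by rewrite divr_gt0.
  - by move=> u u0 ut v; have [+ _] := lin2 t u t0 u0 ut v; rewrite !mulrA.
exists (K * (2 / t) * (5 * K / t)), (t / 2); split.
- by rewrite !mulr_ge0 ?divr_ge0 ?mulr_ge0 ?invr_ge0 ?(ltW t0).
- by rewrite divr_gt0.
- by move=> u u0 ut v; have [_] := lin2 t u t0 u0 ut v; rewrite !mulrA.
Qed.

Let sbar t : Rd := cl_conj (ray J psi t).

Lemma op_cts_sbar : op_cts (fun t => lact (sbar t) : V -> V).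
Proof.
apply: (op_cts_lact hip) => A t t0.
have -> : (fun t => sbar t A : R) = (fun t => t * cl_conj (cl_exp J psi) A).
  by apply/funext => u; rewrite /sbar cl_conjZ ffunE.
by apply: cvgM; [exact: cvg_id|exact: cvg_cst].
Qed.

Definition SLray t v := SL_resolvent (ray J psi t) T v.
Definition SRray t v := SR_resolvent (ray J psi t) T v.

Lemma bounded_SLray t : 0 < t -> bounded_op (SLray t).
Proof.
move=> t0; have [bB bC] := ray_bounded t0.
exact/(bounded_add hip (bounded_comp bB (bounded_lact hip _)))/(bounded_opp hip).
Qed.

Lemma bounded_SRray t : 0 < t -> bounded_op (SRray t).
Proof.
move=> t0; have [bB bC] := ray_bounded t0.
exact/(bounded_add hip (bounded_comp (bounded_lact hip _) bB))/(bounded_opp hip).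
Qed.

Lemma op_cts_SLray : op_cts SLray.
Proof.
have [cB cC] := op_cts_ray_resolvent.
have c1 : op_cts (fun t v => B t (lact (sbar t) v)).
  apply: (op_cts_comp hip (F := B) (G := fun t => lact (sbar t))) => [t t0|t _|//|].
  - by case: (ray_bounded t0).
  - exact: bounded_lact.
  - exact: op_cts_sbar.
exact: (op_ctsD hip c1 (op_ctsN hip cC)).
Qed.

Lemma op_cts_SRray : op_cts SRray.
Proof.
have [cB cC] := op_cts_ray_resolvent.
have c1 : op_cts (fun t v => lact (sbar t) (B t v)).
  apply: (op_cts_comp hip (F := fun t => lact (sbar t)) (G := B)) => [t _|t t0||//].
  - exact: bounded_lact.
  - by case: (ray_bounded t0).
  - exact: op_cts_sbar.
exact: (op_ctsD hip c1 (op_ctsN hip cC)).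
Qed.

Let N : R := #|{set 'I_d}|%:R.

(** The growth of the factor [conj s] is absorbed by the quadratic decay of
    [Q_s^-1]. *)
Lemma Sray_decay : exists2 M, 0 <= M & forall t, 0 < t ->
  opnorm_le (SLray t) (M / t) /\ opnorm_le (SRray t) (M / t).
Proof.
have [K K0 HK] := ray_bounds hip homega hT hphi hJ hpsi.
have N0 : 0 <= N by [].
exists (N * K + K) => [|t t0]; first by rewrite addr_ge0 ?mulr_ge0.
have [HB HC] := HK t t0.
have sb v : hnorm (lact (sbar t) v) <= N * t * hnorm v.
  have := hnorm_lact_le hip (sbar t) v.
  by rewrite cl_norm_conj cl_norm_ray// ltW.
have K2 : 0 <= K / t ^+ 2 by rewrite divr_ge0// exprn_ge0// ltW.
have E v : K / t ^+ 2 * (N * t * hnorm v) + K / t * hnorm v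
    = (N * K + K) / t * hnorm v by field; rewrite gt_eqF.
split=> v; rewrite -E (le_trans (hnormB hip _ _))// lerD//; try exact: HC.
  by rewrite (le_trans (HB _))// ler_wpM2l.
apply: (le_trans (sb _)).
have Nt : 0 <= N * t by rewrite mulr_ge0// ltW.
apply: (le_trans (ler_wpM2l Nt (HB v))).
by rewrite mulrCA.
Qed.

Variable f : Rd -> Rd.
Hypothesis fok : ray_ok J psi f.

Lemma tame_GL c : tame (fun t => GL T f (ray J psi t) c).
Proof.
have [M M0 HM] := Sray_decay; have [fc _] := fok.
have bl s : bounded_op (lact s : V -> V) by exact: bounded_lact.
split=> [t t0||].
- by have [] := bounded_comp (bounded_SLray t0) (bounded_comp (bl c) (bl (f (ray J psi t)))).
- apply: (op_cts_comp hip (F := SLray)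
    (G := fun t v => lact c (lact (f (ray J psi t)) v))).
  + by move=> t; exact: bounded_SLray.
  + by move=> t _; exact: bounded_comp.
  + exact: op_cts_SLray.
  + apply: (op_cts_comp hip (F := fun=> lact c) (G := fun t => lact (f (ray J psi t)))) => //.
      exact: op_cts_const.
    exact: op_cts_lact.
- have M'0 : 0 <= M * (N * cl_norm c) * N by rewrite !mulr_ge0 ?cl_norm_ge0.
  have [mg ig] := ray_ok_majorant M'0 fok.
  exists (fun t => M * (N * cl_norm c) * N * (cl_norm (f (ray J psi t)) / t)).
  split=> // t t0; split; first by rewrite mulr_ge0 ?divr_ge0 ?cl_norm_ge0// ltW.
  move=> v; have [HL _] := HM t t0.
  have Mt : 0 <= M / t by rewrite divr_ge0// ltW.
  apply: (le_trans (HL _)).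
  apply: (le_trans (ler_wpM2l Mt (hnorm_lact_le hip _ _))).
  have c0 : 0 <= N * cl_norm c by rewrite mulr_ge0 ?cl_norm_ge0.
  apply: (le_trans (ler_wpM2l Mt (ler_wpM2l c0 (hnorm_lact_le hip _ _)))).
  rewrite -/N le_eqVlt; apply/orP; left; apply/eqP; field; by rewrite gt_eqF.
Qed.

Lemma tame_GR c : tame (fun t => GR T f (ray J psi t) c).
Proof.
have [M M0 HM] := Sray_decay; have [fc _] := fok.
have bl s : bounded_op (lact s : V -> V) by exact: bounded_lact.
split=> [t t0||].
- by have [] := bounded_comp (bl (f (ray J psi t))) (bounded_comp (bl c) (bounded_SRray t0)).
- apply: (op_cts_comp hip (F := fun t => lact (f (ray J psi t)))
    (G := fun t v => lact c (SRray t v))) => //.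
  + by move=> t t0; exact/bounded_comp/bounded_SRray.
  + exact: op_cts_lact.
  + apply: (op_cts_comp hip (F := fun=> lact c) (G := SRray)) => //.
    * by move=> t; exact: bounded_SRray.
    * exact: op_cts_const.
    * exact: op_cts_SRray.
- have M'0 : 0 <= M * (N * cl_norm c) * N by rewrite !mulr_ge0 ?cl_norm_ge0.
  have [mg ig] := ray_ok_majorant M'0 fok.
  exists (fun t => M * (N * cl_norm c) * N * (cl_norm (f (ray J psi t)) / t)).
  split=> // t t0; split; first by rewrite mulr_ge0 ?divr_ge0 ?cl_norm_ge0// ltW.
  move=> v; have [_ HR] := HM t t0.
  have f0 : 0 <= N * cl_norm (f (ray J psi t)) by rewrite mulr_ge0 ?cl_norm_ge0.
  have c0 : 0 <= N * cl_norm c by rewrite mulr_ge0 ?cl_norm_ge0.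
  apply: (le_trans (hnorm_lact_le hip _ _)).
  apply: (le_trans (ler_wpM2l f0 (hnorm_lact_le hip _ _))).
  apply: (le_trans (ler_wpM2l f0 (ler_wpM2l c0 (HR _)))).
  rewrite -/N le_eqVlt; apply/orP; left; apply/eqP; field; by rewrite gt_eqF.
Qed.

End Bisectorial.
End Integrands.

(** * Slice hyperholomorphic functions on rays *)

Section SliceContinuity.
Context {R : realType} {d : nat}.
Local Notation Rd := (clifford R d).
Implicit Types (J : Rd) (f : Rd -> Rd) (x y t theta psi : R).

Lemma mean_value_bound (h : R -> R) (a b D : R) :
  (forall x, Num.min a b <= x <= Num.max a b -> derivable h x 1 /\ `|derive1 h x| <= D) ->
  `|h b - h a| <= D * `|b - a|.
Proof.
wlog ab : a b / a <= b => [W hD|].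
  have /orP[ab|ba] := le_total a b; first exact: W.
  by rewrite distrC [`|b - a|]distrC; apply: W => // x; rewrite minC maxC; exact: hD.
rewrite min_l// max_r// => hD.
have [| |c cab ->] := @MVT_segment R h (derive1 h) a b ab.
- move=> x xab; rewrite derive1E; apply/derivableP.
  by apply: (hD x _).1; move: xab; rewrite in_itv/= => /andP[/ltW -> /ltW ->].
- apply: derivable_within_continuous => x; rewrite in_itv/= => xab.
  exact: (hD x xab).1.
rewrite normrM ler_wpM2r//; apply: (hD c _).2.
by move: cab; rewrite in_itv.
Qed.

(** By the mean value theorem a step in the first variable costs at most the
    bound on that derivative times its length; a step in the second variable is
    taken on one fixed line, where derivability gives continuity. *)
Lemma partial_continuous (h : R -> R -> R) (W : set (R * R)) x y :
  (\forall z \near (x, y), W z) ->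
  (forall z, W z -> derivable (h^~ z.2) z.1 1 /\ derivable (h z.1) z.2 1) ->
  {for (x, y), continuous (fun z : R * R => derive1 (h^~ z.2) z.1)} ->
  {for (x, y), continuous (fun z : R * R => h z.1 z.2)}.
Proof.
move=> Wn hder hc.
pose D := `|derive1 (h^~ y) x| + 1.
have Dn : \forall z \near (x, y), `|derive1 (h^~ z.2) z.1| <= D.
  have /cvgrPdist_le/(_ 1 ltr01) := hc.
  apply: filterS => z /= le.
  rewrite -[X in `|X|](subrK (derive1 (h^~ y) x)) addrC (le_trans (ler_normD _ _))//.
  by rewrite lerD2l distrC.
have D0 : 0 < D by rewrite ltr_wpDl.
have /nbhs_ballP[r /= r0 Hr] : \forall z \near (x, y),
  W z /\ `|derive1 (h^~ z.2) z.1| <= D by apply: filterI.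
have box x' y' : `|x' - x| < r -> `|y' - y| < r ->
    W (x', y') /\ `|derive1 (h^~ y') x'| <= D.
  by move=> hx hy; apply: (Hr (x', y')); split; rewrite -ball_normE /ball_/= distrC.
have cy : {for y, continuous (h x)}.
  have [Wxy _] : W (x, y) /\ `|derive1 (h^~ y) x| <= D by apply: box; rewrite subrr normr0.
  by apply/differentiable_continuous/derivable1_diffP; exact: (hder _ Wxy).2.
apply/cvgrPdist_le => /= eps eps0.
have e2 : 0 < eps / 2 by rewrite divr_gt0.
have /cvgrPdist_le/(_ _ e2)/nbhs_ballP[r2 /= r20 Hr2] := cy.
pose r3 := Num.min r (Num.min r2 (eps / 2 / D)).
have r30 : 0 < r3 by rewrite !lt_min r0 r20 divr_gt0.
apply: filterS (nbhsx_ballx (x, y) r3 r30) => -[x' y'] [/=].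
rewrite -!ball_normE /ball_/= !lt_min => /and3P[xr _ xD] /and3P[yr yr2 _].
rewrite -(subrK (h x y') (h x y)) -addrA [eps]splitr (le_trans (ler_normD _ _))//.
rewrite lerD//; first by apply: Hr2; rewrite -ball_normE.
have le1 : `|h x' y' - h x y'| <= D * `|x' - x|.
  apply: (@mean_value_bound (h^~ y')) => c /andP[c1 c2].
  have cx : `|c - x| < r.
    apply: le_lt_trans xr; rewrite [leRHS]distrC; move: c1 c2.
    case: (lerP x x') => xx' c1 c2.
      rewrite !ger0_norm ?subr_ge0//; lra.
    rewrite !ler0_norm ?subr_le0 ?(ltW xx')//; lra.
  have [Wc Dc] : W (c, y') /\ `|derive1 (h^~ y') c| <= D.
    by apply: box => //; rewrite distrC.
  split; [exact: (hder _ Wc).1|exact: Dc].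
rewrite distrC (le_trans le1)// distrC.
apply: (le_trans (ler_wpM2l (ltW D0) (ltW xD))).
by rewrite mulrCA mulfV ?mulr1// gt_eqF.
Qed.

Lemma continuous_cl_mul (alpha beta : R -> Rd) t :
  (forall A, {for t, continuous (fun t => alpha t A : R)}) ->
  (forall A, {for t, continuous (fun t => beta t A : R)}) ->
  forall A, {for t, continuous (fun t => cl_mul (alpha t) (beta t) A : R)}.
Proof.
move=> ca cb A.
have -> : (fun t => cl_mul (alpha t) (beta t) A : R) = (fun t =>
    \sum_B basis_sign B (symdiff A B) * alpha t B * beta t (symdiff A B)).
  by apply/funext => u; rewrite cl_mulE.
apply: cvg_big => [|B _]; first exact: add_continuous.
by apply: cvgM; [apply: cvgM; [exact: cvg_cst|exact: ca]|exact: cb].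
Qed.

Section OnSector.
Variables (J : Rd) (theta : R).
Hypothesis hJ : imag_unit J.
Hypothesis htheta : 0 < theta < pi / 2.

(** The condition is the same for all imaginary units, so one of them tests it. *)
Lemma slice_domP x y : slice_dom (dsector theta : set Rd) (x, y) <->
  cos theta * Num.sqrt (x ^+ 2 + y ^+ 2) < `|x|.
Proof.
have E (J' : Rd) : imag_unit J' -> dsector theta (slice_pt x y J') <->
    cos theta * Num.sqrt (x ^+ 2 + y ^+ 2) < `|x|.
  move=> hJ'; rewrite (dsectorP _ htheta) cl_norm_slice// Re0_slice//.
  by split=> [[]//|lt]; split=> //; exact: paravector_slice.
by split=> [/(_ J hJ)/(E J hJ)//|lt J' hJ']; apply/(E J' hJ').
Qed.

Lemma slice_dom_open x y : slice_dom (dsector theta : set Rd) (x, y) ->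
  \forall z \near (x, y), slice_dom (dsector theta : set Rd) z.
Proof.
move=> /slice_domP; rewrite -subr_gt0 => xy.
pose F (z : R * R) := `|z.1| - cos theta * Num.sqrt (z.1 ^+ 2 + z.2 ^+ 2).
have cF : F @ (x, y) --> F (x, y).
  apply: cvgB; first by apply: cvg_norm; exact: cvg_fst.
  apply: cvgM; first exact: cvg_cst.
  apply: continuous_cvg; first exact: sqrt_continuous.
  apply: cvgD; rewrite !expr2; under eq_fun => z do rewrite expr2.
    by apply: cvgM; exact: cvg_fst.
  by apply: cvgM; exact: cvg_snd.
have Fpos : \forall z \near (x, y), 0 < F z by exact: (cvgr_gt _ cF).
apply: filterS Fpos => -[x' y'] /=.
by rewrite subr_gt0 => lt; apply/slice_domP.
Qed.

Lemma C1_on_continuous (g : R -> R -> Rd) x y (A : {set 'I_d}) :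
  C1_on (slice_dom (dsector theta : set Rd)) g ->
  slice_dom (dsector theta : set Rd) (x, y) ->
  {for (x, y), continuous (fun z : R * R => g z.1 z.2 A : R)}.
Proof.
move=> gC xyW.
apply: (@partial_continuous (fun x y => g x y A : R) _ x y (slice_dom_open xyW)).
  by move=> [x' y'] Wz; have [d1 d2 _ _] := gC A x' y' Wz; exact: conj d1 d2.
by have [_ _ cx _] := gC A x y xyW; exact: cx.
Qed.

Lemma slice_dom_ray psi t : 0 < t -> cos theta < `|cos psi| ->
  slice_dom (dsector theta : set Rd) (t * cos psi, t * sin psi).
Proof.
move=> t0 cpsi J' hJ'; rewrite /= -ray_slice.
exact/(dsector_ray psi hJ' t0 htheta).
Qed.

Lemma ray_continuous (g : R -> R -> Rd) psi t (A : {set 'I_d}) :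
  C1_on (slice_dom (dsector theta : set Rd)) g -> 0 < t -> cos theta < `|cos psi| ->
  {for t, continuous (fun t => g (t * cos psi) (t * sin psi) A : R)}.
Proof.
move=> gC t0 cpsi.
have cg := @C1_on_continuous g _ _ A gC (slice_dom_ray t0 cpsi).
have cp : (fun t : R => (t * cos psi, t * sin psi)) @ t --> (t * cos psi, t * sin psi).
  have cm (k : R) : (fun u : R => u * k) @ t --> t * k.
    by apply: cvgM; [exact: cvg_id|exact: cvg_cst].
  exact: (cvg_pair (cm _) (cm _)).
exact: (cvg_comp _ _ cp cg).
Qed.

Lemma slice_form_continuous f (F : R -> Rd) psi t A : 0 < t ->
  (forall u, 0 < u -> f (u *: cl_exp J psi) = F u) ->
  {for t, continuous (fun u : R => F u A : R)} ->
  {for t, continuous (fun u : R => f (u *: cl_exp J psi) A : R)}.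
Proof.
move=> t0 fF cF; rewrite /prop_for /continuous_at fF//.
apply: cvg_trans cF; apply: near_eq_cvg.
by near=> u; rewrite fF//; near: u; exact: lt_nbhsr.
Unshelve. all: by end_near. Qed.

Lemma SH0_ray_ok f psi : cos theta < `|cos psi| -> sector_angles theta psi ->
  SH0_L theta f \/ SH0_R theta f -> ray_ok J psi f.
Proof.
move=> cpsi apsi fSH; split; last first.
  by case: fSH => -[_ _ /(_ J psi hJ apsi)].
move=> A t t0.
have cJ B : {for t, continuous (fun=> J B : R)} by exact: cvg_cst.
have dom u (u0 : 0 < u) := slice_dom_ray u0 cpsi.
case: fSH => -[[f0 [f1 [[C0 C1 _] fE]]] _ _].
  apply: (@slice_form_continuous f (fun u => f0 (u * cos psi) (u * sin psi)
      + cl_mul J (f1 (u * cos psi) (u * sin psi)))) => //.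
    by move=> u u0; rewrite ray_slice; apply: fE => //; exact: dom.
  under [X in {for _, continuous X}]eq_fun => u do rewrite ffunE.
  apply: cvgD; first exact: ray_continuous.
  apply: (continuous_cl_mul (alpha := fun=> J)) => // B.
  exact: ray_continuous.
apply: (@slice_form_continuous f (fun u => f0 (u * cos psi) (u * sin psi)
    + cl_mul (f1 (u * cos psi) (u * sin psi)) J)) => //.
  by move=> u u0; rewrite ray_slice; apply: fE => //; exact: dom.
under [X in {for _, continuous X}]eq_fun => u do rewrite ffunE.
apply: cvgD; first exact: ray_continuous.
apply: (continuous_cl_mul (beta := fun=> J)) => // B.
exact: ray_continuous.
Qed.

Lemma ray_ok_sharp f psi psi' : cl_exp J psi' = cl_conj (cl_exp J psi) ->
  ray_ok J psi f -> ray_ok J psi' (sharp f).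
Proof.
move=> e' [fc fi].
have E t : sharp f (t *: cl_exp J psi') = cl_conj (f (t *: cl_exp J psi)).
  by rewrite /sharp e' cl_conjZ cl_conjK.
split=> [A t t0|].
  have -> : (fun t => sharp f (t *: cl_exp J psi') A : R)
      = (fun t => basis_sign A A * f (t *: cl_exp J psi) A).
    by apply/funext => u; rewrite E cl_conjE.
  by apply: cvgM; [exact: cvg_cst|exact: fc].
by under eq_integral => t _ do rewrite E cl_norm_conj.
Qed.

End OnSector.
End SliceContinuity.

(** * Contour integrals and duality *)

Section Contour.
Context {R : realType} {d : nat} {H : completeNormedModType R}.
Variable ip : {dot H for @idfun R}.
Hypothesis hip : norm_from_dot ip.
Local Notation Rd := (clifford R d).
Local Notation V := (hmod d H).
Local Notation mu := (@lebesgue_measure R).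
Local Notation "<[ v , w ]>" := (hdot ip v w).
Implicit Types (s c : Rd) (u v w : V) (t psi : R) (f : Rd -> Rd).
Implicit Types G : Rd -> Rd -> V -> V.
Variables (J : Rd) (phi : R).
Hypothesis hJ : imag_unit J.

Local Notation ray psi t := (t *: cl_exp J psi).

(** The derivative of [ds_J] along the ray of angle [psi]. *)
Definition dray psi : Rd := - cl_mul J (cl_exp J psi).

Definition contour_angles : seq R := [:: phi; - phi; pi - phi; pi + phi].

Definition ray_int G psi v w : R :=
  \int[mu]_(t in `]0, +oo[) <[w, G (ray psi t) (dray psi) v]>.

(** The signs are those of [is_contour_int]: this is the pairing of [w] with the
    contour integral applied to [v]. *)
Definition contour_form G v w : R :=
  - ray_int G phi v w + ray_int G (- phi) v w
  + ray_int G (pi - phi) v w - ray_int G (pi + phi) v w.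

Definition contour_tame G : Prop :=
  forall psi, psi \in contour_angles -> tame (fun t => G (ray psi t) (dray psi)).

Lemma contour_int_exists G : contour_tame G -> exists A,
  [/\ bounded_op A, is_contour_int J phi G A &
      forall v w, <[w, A v]> = contour_form G v w].
Proof.
move=> tG; have ri psi : psi \in contour_angles -> exists A,
    [/\ bounded_op A, is_op_RInt_gen (fun t => G (ray psi t) (dray psi)) A &
        forall v w, <[w, A v]> = ray_int G psi v w].
  by move=> /tG/(tame_integral hip).
have [|A1 [b1 i1 e1]] := ri phi; first by rewrite !inE eqxx.
have [|A2 [b2 i2 e2]] := ri (- phi); first by rewrite !inE eqxx orbT.
have [|A3 [b3 i3 e3]] := ri (pi - phi); first by rewrite !inE eqxx !orbT.
have [|A4 [b4 i4 e4]] := ri (pi + phi); first by rewrite !inE eqxx !orbT.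
exists (fun v => - A1 v + A2 v + A3 v - A4 v); split.
- exact: (bounded_add hip (bounded_add hip (bounded_add hip (bounded_opp hip b1) b2) b3)
    (bounded_opp hip b4)).
- by exists A1, A2, A3, A4.
- by move=> v w; rewrite hdotBr !hdotDr hdotNr e1 e2 e3 e4.
Qed.

Lemma eq_contour_form G G' v w v' w' :
  (forall psi, psi \in contour_angles -> ray_int G psi v w = ray_int G' psi v' w') ->
  contour_form G v w = contour_form G' v' w'.
Proof. by move=> E; rewrite /contour_form !E// !inE eqxx ?orbT. Qed.

Lemma eq_ray_int G G' psi v w v' w' :
  (forall t, 0 < t -> <[w, G (ray psi t) (dray psi) v]>
    = <[w', G' (ray psi t) (dray psi) v']>) ->
  ray_int G psi v w = ray_int G' psi v' w'.
Proof.
by move=> E; apply: eq_Rintegral => t; rewrite inE/= in_itv/= andbT => /E.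
Qed.

Lemma cl_exp_conj psi psi' : cos psi' = cos psi -> sin psi' = - sin psi ->
  cl_exp J psi' = cl_conj (cl_exp J psi).
Proof. by move=> c s; rewrite /cl_exp c s cl_conj_slice. Qed.

(** Expressed through cosine and sine because the conjugate of the angle
    [pi - phi] is [phi - pi], which is [pi + phi] only up to a full turn. *)
Definition conj_angles psi psi' : Prop := cos psi' = cos psi /\ sin psi' = - sin psi.

Lemma conj_phi : conj_angles phi (- phi).
Proof. by split; rewrite ?cosN ?sinN. Qed.

Lemma conj_piphi : conj_angles (pi - phi) (pi + phi).
Proof.
split.
  by rewrite addrC cosDpi [pi - _]addrC cosDpi cosN.
by rewrite addrC sinDpi [pi - _]addrC sinDpi sinN opprK.
Qed.

Lemma conj_anglesC psi psi' : conj_angles psi psi' -> conj_angles psi' psi.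
Proof. by case=> c s; rewrite /conj_angles c s opprK. Qed.


Lemma dray_slice psi : dray psi = slice_pt (sin psi) (- cos psi) J.
Proof.
rewrite /dray /cl_exp cl_mul_imag_slice// /slice_pt opprD scaleNr.
by rewrite /cl_real scaleNr opprK.
Qed.

(** Conjugation maps the contour to itself and reverses its orientation. *)
Lemma cl_conj_dray psi psi' : conj_angles psi psi' ->
  cl_conj (dray psi') = - dray psi.
Proof.
move=> [cE sE]; rewrite !dray_slice cE sE cl_conj_slice// opprK.
by rewrite /slice_pt opprD /cl_real !scaleNr opprK.
Qed.

Lemma ray_conj psi psi' t : conj_angles psi psi' ->
  ray psi' t = cl_conj (ray psi t).
Proof. by move=> [cE sE]; rewrite cl_conjZ (cl_exp_conj cE sE). Qed.

Section TwoOperators.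
Variables (T : @oper R d H) (omega theta : R).
Hypothesis homega : 0 < omega < pi / 2.
Hypothesis hT : bisectorial omega T.
Hypothesis htheta : omega < theta < pi / 2.
Hypothesis hphi : omega < phi < theta.
Local Notation Ts := (adjoint ip T).

Let lT : right_linear T. Proof. by case: hT => -[]. Qed.
Let hphi2 : omega < phi < pi / 2.
Proof. by case/andP: hphi => -> /lt_trans; apply; case/andP: htheta. Qed.
Let htheta2 : 0 < theta < pi / 2.
Proof.
by case/andP: htheta => h ->; rewrite andbT (lt_trans _ h)//; case/andP: homega.
Qed.
Let dense_T : forall v, (forall u, dom T u -> <[v, u]> = 0) -> v = 0.
Proof. exact: (dom_dense hip homega hT hphi2 hJ). Qed.

Lemma cos_contour psi : psi \in contour_angles -> `|cos psi| = cos phi.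
Proof.
have c0 : 0 <= cos phi.
  by rewrite cos_ge0_pihalf//; case/andP: hphi2; case/andP: homega; lra.
by rewrite !inE => /or4P[] /eqP ->; rewrite ?cosN ?[pi + _]addrC ?cosDpi ?cosN
  ?normrN ger0_norm.
Qed.

Lemma cos_theta_contour psi : psi \in contour_angles -> cos theta < `|cos psi|.
Proof.
move=> /cos_contour ->; have /andP[w0 _] := homega; have /andP[wp p2] := hphi2.
have /andP[th0 th2] := htheta2; have /andP[_ pt] := hphi.
by rewrite ltr_cos ?in_itv//=; lra.
Qed.

Lemma contour_sector psi : psi \in contour_angles -> sector_angles theta psi.
Proof.
have /andP[wp pt] := hphi; have /andP[w0 w2] := homega; have /andP[th0 th2] := htheta2.
have p0 := @pi_gt0 R.
by rewrite !inE => /or4P[] /eqP ->; rewrite /sector_angles/=;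
  [left|left|right|right]; apply/andP; split; lra.
Qed.

Section Resolvents.
Variable psi : R.
Hypothesis psiC : psi \in contour_angles.
Let hpsi : `|cos psi| <= cos phi. Proof. by rewrite cos_contour. Qed.

Lemma contour_res t : 0 < t -> S_resolvent_set T (ray psi t).
Proof. exact: (ray_res homega hT hphi2 hJ hpsi). Qed.

Lemma contour_bounded_TQ t : 0 < t ->
  exists2 c, 0 <= c & opnorm_le (fun v => T (Q_inv (ray psi t) T v)) c.
Proof.
move=> t0; have [K K0 HK] := ray_bounds hip homega hT hphi2 hJ hpsi.
by exists (K / t); [rewrite divr_ge0// ltW|have [] := HK t t0].
Qed.

Variable f : Rd -> Rd.

Lemma GL_ract t c v a : 0 < t ->
  GL T f (ray psi t) c (ract v a) = ract (GL T f (ray psi t) c v) a.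
Proof.
move=> /contour_res res.
have /full_right_linearP[_ Br] := Q_inv_right_linear res.
have /full_right_linearP[_ Cr] := TQ_inv_right_linear lT res.
by rewrite /GL /SL_resolvent !lact_ract Br Cr ractDl ractNl.
Qed.

Lemma GR_ract t c v a : 0 < t ->
  GR T f (ray psi t) c (ract v a) = ract (GR T f (ray psi t) c v) a.
Proof.
move=> /contour_res res.
have /full_right_linearP[_ Br] := Q_inv_right_linear res.
have /full_right_linearP[_ Cr] := TQ_inv_right_linear lT res.
by rewrite /GR /SR_resolvent Cr Br lact_ract -ractNl -ractDl !lact_ract.
Qed.

(** Taking adjoints reverses the order of the factors, which turns left
    integrands into right ones; the sign comes from [cl_conj_dray]. *)
Lemma GL_dual psi' t v w : conj_angles psi psi' -> 0 < t ->
  <[GL Ts f (ray psi' t) (dray psi') w, v]>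
  = - <[w, GR T (sharp f) (ray psi t) (dray psi) v]>.
Proof.
move=> cj t0; rewrite /GL /GR (ray_conj _ cj).
rewrite (SL_adjoint_dual hip lT dense_T (contour_res t0) (contour_bounded_TQ t0)).
rewrite !(hdot_lact ip) -/(sharp f _) /sharp -hdotNr -lactNr -lactNl.
by rewrite -(cl_conj_dray cj).
Qed.

Lemma GR_dual psi' t v w : conj_angles psi psi' -> 0 < t ->
  <[GR Ts f (ray psi' t) (dray psi') w, v]>
  = - <[w, GL T (sharp f) (ray psi t) (dray psi) v]>.
Proof.
move=> cj t0; rewrite /GL /GR (ray_conj _ cj).
rewrite !(hdot_lact ip).
rewrite (SR_adjoint_dual hip lT dense_T (contour_res t0) (contour_bounded_TQ t0)).
rewrite -hdotNr -(rlinearN _ (bounded_SLray hip homega hT hphi2 hJ hpsi t0).1).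
by rewrite /SLray -lactNl -(cl_conj_dray cj).
Qed.

End Resolvents.

Lemma contour_tame_GL f : (forall psi, psi \in contour_angles -> ray_ok J psi f) ->
  contour_tame (GL T f).
Proof.
move=> fok psi psiC; have hpsi : `|cos psi| <= cos phi by rewrite cos_contour.
exact: (tame_GL hip homega hT hphi2 hJ hpsi (fok psi psiC)).
Qed.

Lemma contour_tame_GR f : (forall psi, psi \in contour_angles -> ray_ok J psi f) ->
  contour_tame (GR T f).
Proof.
move=> fok psi psiC; have hpsi : `|cos psi| <= cos phi by rewrite cos_contour.
exact: (tame_GR hip homega hT hphi2 hJ hpsi (fok psi psiC)).
Qed.

(** The minus sign is that of [ds_J] under conjugation; the orientation of the
    contour compensates it. *)
Definition contour_dual (G' G : Rd -> Rd -> V -> V) : Prop :=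
  forall psi psi' t v w, psi \in contour_angles -> conj_angles psi psi' -> 0 < t ->
    <[G' (ray psi' t) (dray psi') w, v]> = - <[w, G (ray psi t) (dray psi) v]>.

Lemma contour_conj psi : psi \in contour_angles ->
  exists2 psi', psi' \in contour_angles & conj_angles psi' psi.
Proof.
rewrite !inE => /or4P[] /eqP ->.
- by exists (- phi); [rewrite !inE eqxx orbT|exact/conj_anglesC/conj_phi].
- by exists phi; [rewrite !inE eqxx|exact: conj_phi].
- by exists (pi + phi); [rewrite !inE eqxx !orbT|exact/conj_anglesC/conj_piphi].
- by exists (pi - phi); [rewrite !inE eqxx !orbT|exact: conj_piphi].
Qed.

Lemma contour_tame_dual G G' : contour_dual G' G -> contour_tame G -> contour_tame G'.
Proof.
move=> GG' tG psi psiC; have [psi' psi'C cj] := contour_conj psiC.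
apply: (tame_dual hip _ (tameN hip (tG psi' psi'C))) => t t0 v w.
by rewrite (GG' psi')// hdotNr.
Qed.

(** The sign in [contour_dual] cancels the reversal of the orientation when each
    ray is exchanged with its conjugate. *)
Lemma contour_form_dual G G' v w : contour_dual G' G -> contour_tame G ->
  contour_form G' v w = contour_form G w v.
Proof.
move=> GG' tG.
have E psi psi' : psi \in contour_angles -> conj_angles psi psi' ->
    ray_int G' psi' v w = - ray_int G psi w v.
  move=> psiC cj; rewrite -mulN1r -RintegralZl//; last first.
    exact: (pairing_integrable hip (tG psi psiC)).
  apply: eq_Rintegral => t; rewrite inE/= in_itv/= andbT => t0.
  by rewrite hdotC (GG' psi)// mulN1r hdotC.
rewrite /contour_form.
rewrite (E (- phi) phi) ?inE ?eqxx ?orbT//; last exact/conj_anglesC/conj_phi.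
rewrite (E phi (- phi)) ?inE ?eqxx ?orbT//; last exact/conj_phi.
rewrite (E (pi + phi) (pi - phi)) ?inE ?eqxx ?orbT//; last first.
  exact/conj_anglesC/conj_piphi.
rewrite (E (pi - phi) (pi + phi)) ?inE ?eqxx ?orbT//; last exact/conj_piphi.
move: (ray_int G phi w v) (ray_int G (- phi) w v) (ray_int G (pi - phi) w v).
by move: (ray_int G (pi + phi) w v) => a b c e; ring.
Qed.

Lemma contour_resolvent_T : contour_in_resolvent J phi T.
Proof. by move=> psi t psiC t0; exact: contour_res. Qed.

Lemma contour_resolvent_Ts : contour_in_resolvent J phi Ts.
Proof.
move=> psi t psiC t0.
exact: (adjoint_resolvent hip lT dense_T (contour_res psiC t0)
  (contour_bounded_TQ psiC t0)).
Qed.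

Definition calculus_op G (fT : V -> V) : Prop :=
  in_B fT /\ exists2 A, is_contour_int J phi G A &
    forall v, fT v = (2 * pi)^-1 *: A v.

Lemma calculus_exists G : contour_tame G ->
  (forall psi t v a, psi \in contour_angles -> 0 < t ->
     G (ray psi t) (dray psi) (ract v a) = ract (G (ray psi t) (dray psi) v) a) ->
  exists2 fT, calculus_op G fT &
    forall v w, <[w, fT v]> = (2 * pi)^-1 * contour_form G v w.
Proof.
move=> tG Gr; have [A [bA iA AE]] := contour_int_exists tG.
have [[AD AZ] [c c0 Ac]] := bA.
have lA : right_linear (full_oper A).
  apply/full_right_linearP; split=> // v a; apply: (hdot_inj hip) => w.
  rewrite (hdot_ract ip) [LHS]hdotC [RHS]hdotC !AE.
  apply: eq_contour_form => psi psiC; apply: eq_ray_int => t t0.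
  by rewrite Gr// hdotC (hdot_ract ip) hdotC.
exists (fun v => (2 * pi)^-1 *: A v); last by move=> v w; rewrite hdotZr AE.
split; last by exists A.
have /full_right_linearP[_ Ar] := lA.
split.
  apply/full_right_linearP; split=> [v w|v a]; first by rewrite AD scalerDr.
  by rewrite Ar ractZl.
exists (`|(2 * pi)^-1| * c) => v.
by rewrite (hnormZ hip) -mulrA ler_wpM2l.
Qed.

Lemma calculus_dual G G' fT : contour_dual G' G -> contour_tame G -> in_B fT ->
  (forall v w, <[w, fT v]> = (2 * pi)^-1 * contour_form G v w) ->
  exists2 fTs, calculus_op G' fTs & forall v w, <[fTs w, v]> = <[w, fT v]>.
Proof.
move=> GG' tG BfT fTE.
have [A [[[AD AZ] [c c0 Ac]] iA AE]] := contour_int_exists (contour_tame_dual GG' tG).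
have dual v w : <[(2 * pi)^-1 *: A w, v]> = <[w, fT v]>.
  by rewrite hdotZl hdotC AE fTE (contour_form_dual _ _ GG' tG).
exists (fun w => (2 * pi)^-1 *: A w); last exact: dual.
split; last by exists A.
split; first exact: (right_linear_dual hip dual BfT.1).
exists (`|(2 * pi)^-1| * c) => v.
by rewrite (hnormZ hip) -mulrA ler_wpM2l.
Qed.

Lemma full_oper_adjoint fT fTs : in_B fT ->
  (forall v w, <[fTs w, v]> = <[w, fT v]>) ->
  oper_eq (full_oper fTs) (adjoint ip (full_oper fT)).
Proof.
move=> [lfT _] dual.
have dense v : (forall u, dom (full_oper fT) u -> <[v, u]> = 0) -> v = 0.
  move=> /(_ v I); rewrite (hdotvv hip) => /eqP; rewrite sqrf_eq0 => /eqP.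
  exact: hnorm_eq0.
have adj w := @adjointP _ _ _ ip (full_oper fT) lfT dense w (fTs w)
  (fun v _ => dual v w).
split; last by move=> v _; rewrite (adj v).2.
by apply/seteqP; split=> // w _; exact: (adj w).1.
Qed.

(** * Intrinsic functions *)

Lemma intrinsic_ray f psi t : intrinsic (dsector theta) f ->
  psi \in contour_angles -> 0 < t ->
  exists p q, f (ray psi t) = slice_pt p q J /\
              f (cl_conj (ray psi t)) = slice_pt p (- q) J.
Proof.
move=> [g0 [g1 [[_ _ sym] fE]]] psiC t0.
have dom1 := @slice_dom_ray R d theta htheta2 psi t t0 (cos_theta_contour psiC).
have dom2 : slice_dom (dsector theta : set Rd) (t * cos psi, - (t * sin psi)).
  rewrite -mulrN -sinN -(cosN psi); apply: slice_dom_ray => //.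
  by rewrite cosN; exact: cos_theta_contour.
exists (g0 (t * cos psi) (t * sin psi)), (g1 (t * cos psi) (t * sin psi)).
have [s0 s1 _ _] := sym _ _ dom1.
rewrite ray_slice cl_conj_slice//; split.
  by rewrite (fE _ _ _ dom1 hJ) cl_mul_realr.
rewrite (fE _ _ _ dom2 hJ) s0 s1 /slice_pt; congr (_ + _).
by rewrite -cl_mul_realr /cl_real scaleNr.
Qed.

(** Two conjugate points together contribute a real combination of [Q_s^-1] and
    [T Q_s^-1], on which left and right multiplication agree. *)
Lemma intrinsic_pair f psi psi' t v : intrinsic (dsector theta) f ->
  psi \in contour_angles -> conj_angles psi psi' -> 0 < t ->
  GL T f (ray psi' t) (dray psi') v - GL T f (ray psi t) (dray psi) v
  = GR T f (ray psi' t) (dray psi') v - GR T f (ray psi t) (dray psi) v.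
Proof.
move=> fI psiC cj t0.
have [p [q [fs fs']]] := intrinsic_ray fI psiC t0.
have res := contour_res psiC t0.
have lB := right_linear_rlinear (Q_inv_right_linear res).
have lC := right_linear_rlinear (TQ_inv_right_linear lT res).
have EQ : Q_inv (ray psi' t) T = Q_inv (ray psi t) T.
  by rewrite (ray_conj _ cj); apply: Q_inv_eq;
    rewrite ?cl_norm_conj// /Re0 cl_conjE basis_sign0l mul1r.
rewrite /GL /GR /SL_resolvent /SR_resolvent EQ (ray_conj t cj) cl_conjK.
set B := Q_inv _ T in lB lC *.
set x := t * cos psi; set y := t * sin psi.
have sE : ray psi t = slice_pt x y J by exact: ray_slice.
have sbE : cl_conj (ray psi t) = slice_pt x (- y) J by rewrite sE cl_conj_slice.
set a := cos psi; set b := sin psi.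
have dE : dray psi = slice_pt b (- a) J by exact: dray_slice.
have dE' : dray psi' = slice_pt (- b) (- a) J by rewrite dray_slice cj.1 cj.2.
pose P := b * p + a * q; pose Q := b * q - a * p.
pose X := x * P + y * Q; pose Y := x * Q - y * P.
have eqs (k l k' l' : R) u : k = k' -> l = l' ->
  lact (slice_pt k l J) u = lact (slice_pt k' l' J) u by move=> -> ->.
have cf u : lact (dray psi) (lact (f (ray psi t)) u) = lact (slice_pt P Q J) u.
  by rewrite dE fs (lact_slice_mul _ _ _ _ _ hJ); apply: eqs; rewrite /P /Q; ring.
have cf' u : lact (dray psi') (lact (f (cl_conj (ray psi t))) u)
    = lact (slice_pt (- P) Q J) u.
  by rewrite dE' fs' (lact_slice_mul _ _ _ _ _ hJ); apply: eqs; rewrite /P /Q; ring.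
have fc u : lact (f (ray psi t)) (lact (dray psi) u) = lact (slice_pt P Q J) u.
  by rewrite dE fs (lact_slice_mul _ _ _ _ _ hJ); apply: eqs; rewrite /P /Q; ring.
have fc' u : lact (f (cl_conj (ray psi t))) (lact (dray psi') u)
    = lact (slice_pt (- P) Q J) u.
  by rewrite dE' fs' (lact_slice_mul _ _ _ _ _ hJ); apply: eqs; rewrite /P /Q; ring.
have scf u : lact (cl_conj (ray psi t)) (lact (slice_pt P Q J) u)
    = lact (slice_pt X Y J) u.
  by rewrite sbE (lact_slice_mul _ _ _ _ _ hJ); apply: eqs; rewrite /X /Y; ring.
have scf' u : lact (ray psi t) (lact (slice_pt (- P) Q J) u)
    = lact (slice_pt (- X) Y J) u.
  by rewrite sE (lact_slice_mul _ _ _ _ _ hJ); apply: eqs; rewrite /X /Y; ring.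
have cfs u : lact (slice_pt P Q J) (lact (cl_conj (ray psi t)) u)
    = lact (slice_pt X Y J) u.
  by rewrite sbE (lact_slice_mul _ _ _ _ _ hJ); apply: eqs; rewrite /X /Y; ring.
have cfs' u : lact (slice_pt (- P) Q J) (lact (ray psi t) u)
    = lact (slice_pt (- X) Y J) u.
  by rewrite sE (lact_slice_mul _ _ _ _ _ hJ); apply: eqs; rewrite /X /Y; ring.
have swap (k l m n : V) : k - l - (m - n) = (k - m) - (l - n).
  by rewrite !opprB addrACA [RHS]addrACA [- l - m]addrC.
rewrite cf cf' fc fc' scf scf' !lactDr !lactNr cfs cfs'.
rewrite [LHS]swap [RHS]swap !lact_slice_diff.
rewrite -(rlinearB _ _ lB) -(rlinearB _ _ lC) !lact_slice_diff.
by rewrite (lB.2) (lC.2).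
Qed.

Lemma ray_int_sub G psi psi' v w : contour_tame G ->
  psi \in contour_angles -> psi' \in contour_angles ->
  ray_int G psi' v w - ray_int G psi v w
  = \int[mu]_(t in `]0, +oo[)
      <[w, G (ray psi' t) (dray psi') v - G (ray psi t) (dray psi) v]>.
Proof.
move=> tG psiC psiC'; rewrite /ray_int -RintegralB//.
- by apply: eq_Rintegral => t _; rewrite hdotBr.
- exact: (pairing_integrable hip (tG _ psiC')).
- exact: (pairing_integrable hip (tG _ psiC)).
Qed.

Lemma intrinsic_contour_form f v w : intrinsic (dsector theta) f ->
  (forall psi, psi \in contour_angles -> ray_ok J psi f) ->
  contour_form (GL T f) v w = contour_form (GR T f) v w.
Proof.
move=> fI fok.
have regroup G : contour_form G v w =
    (ray_int G (- phi) v w - ray_int G phi v w)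
    + (ray_int G (pi - phi) v w - ray_int G (pi + phi) v w).
  rewrite /contour_form.
  move: (ray_int G phi v w) (ray_int G (- phi) v w) (ray_int G (pi - phi) v w).
  by move: (ray_int G (pi + phi) v w) => a b c e; ring.
have tL := contour_tame_GL fok; have tR := contour_tame_GR fok.
have C1 : phi \in contour_angles by rewrite !inE eqxx.
have C2 : - phi \in contour_angles by rewrite !inE eqxx orbT.
have C3 : pi - phi \in contour_angles by rewrite !inE eqxx !orbT.
have C4 : pi + phi \in contour_angles by rewrite !inE eqxx !orbT.
rewrite (regroup (GL T f)) (regroup (GR T f)).
have pair psi psi' : psi \in contour_angles -> psi' \in contour_angles ->
    conj_angles psi psi' ->
    ray_int (GL T f) psi' v w - ray_int (GL T f) psi v w
    = ray_int (GR T f) psi' v w - ray_int (GR T f) psi v w.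
  move=> D D' cj; apply: (etrans (ray_int_sub v w tL D D')).
  apply: (etrans _ (esym (ray_int_sub v w tR D D'))).
  apply: eq_Rintegral => t; rewrite inE/= in_itv/= andbT => t0.
  by rewrite (intrinsic_pair v fI D cj t0).
exact: (congr2 +%R (pair _ _ C1 C2 conj_phi)
  (pair _ _ C4 C3 (conj_anglesC conj_piphi))).
Qed.

Lemma intrinsic_sharp f psi t : intrinsic (dsector theta) f ->
  psi \in contour_angles -> 0 < t -> sharp f (ray psi t) = f (ray psi t).
Proof.
move=> fI psiC t0; have [p [q [fs fs']]] := intrinsic_ray fI psiC t0.
by rewrite /sharp fs' fs cl_conj_slice// opprK.
Qed.

Lemma SH0_contour_ok f : SH0_L theta f \/ SH0_R theta f ->
  forall psi, psi \in contour_angles -> ray_ok J psi f.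
Proof.
move=> fSH psi psiC; apply: (SH0_ray_ok hJ htheta2 _ _ fSH).
  exact: cos_theta_contour.
exact: contour_sector.
Qed.

Lemma sharp_contour_ok f :
  (forall psi, psi \in contour_angles -> ray_ok J psi f) ->
  forall psi, psi \in contour_angles -> ray_ok J psi (sharp f).
Proof.
move=> fok psi psiC; have [psi' psi'C [cE sE]] := contour_conj psiC.
exact: (ray_ok_sharp (cl_exp_conj cE sE) (fok psi' psi'C)).
Qed.

Lemma omega_calc_L_T f fT :
  calculus_op (GL T f) fT -> omega_calc_L J phi T f fT.
Proof. by move=> [BfT cA]; split=> //; exact: contour_resolvent_T. Qed.

Lemma omega_calc_R_T f fT :
  calculus_op (GR T f) fT -> omega_calc_R J phi T f fT.
Proof. by move=> [BfT cA]; split=> //; exact: contour_resolvent_T. Qed.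

Lemma omega_calc_L_Ts f fT :
  calculus_op (GL Ts f) fT -> omega_calc_L J phi Ts f fT.
Proof. by move=> [BfT cA]; split=> //; exact: contour_resolvent_Ts. Qed.

Lemma omega_calc_R_Ts f fT :
  calculus_op (GR Ts f) fT -> omega_calc_R J phi Ts f fT.
Proof. by move=> [BfT cA]; split=> //; exact: contour_resolvent_Ts. Qed.

Section Admissible.
Variable f : Rd -> Rd.
Hypothesis fok : forall psi, psi \in contour_angles -> ray_ok J psi f.

Lemma calculus_GL : exists2 fT, calculus_op (GL T f) fT &
  forall v w, <[w, fT v]> = (2 * pi)^-1 * contour_form (GL T f) v w.
Proof.
apply: calculus_exists; first exact: contour_tame_GL.
by move=> psi t v a psiC t0; exact: GL_ract.
Qed.

Lemma calculus_GR : exists2 fT, calculus_op (GR T f) fT &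
  forall v w, <[w, fT v]> = (2 * pi)^-1 * contour_form (GR T f) v w.
Proof.
apply: calculus_exists; first exact: contour_tame_GR.
by move=> psi t v a psiC t0; exact: GR_ract.
Qed.

Lemma calculus_GL_adjoint fT : in_B fT ->
  (forall v w, <[w, fT v]> = (2 * pi)^-1 * contour_form (GR T (sharp f)) v w) ->
  exists2 fTs, calculus_op (GL Ts f) fTs & forall v w, <[fTs w, v]> = <[w, fT v]>.
Proof.
apply: calculus_dual; last exact/contour_tame_GR/sharp_contour_ok.
by move=> psi psi' t v w psiC cj t0; exact: GL_dual.
Qed.

Lemma calculus_GR_adjoint fT : in_B fT ->
  (forall v w, <[w, fT v]> = (2 * pi)^-1 * contour_form (GL T (sharp f)) v w) ->
  exists2 fTs, calculus_op (GR Ts f) fTs & forall v w, <[fTs w, v]> = <[w, fT v]>.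
Proof.
apply: calculus_dual; last exact/contour_tame_GL/sharp_contour_ok.
by move=> psi psi' t v w psiC cj t0; exact: GR_dual.
Qed.

End Admissible.

Lemma intrinsic_sharp_form f v w : intrinsic (dsector theta) f ->
  contour_form (GL T (sharp f)) v w = contour_form (GL T f) v w /\
  contour_form (GR T (sharp f)) v w = contour_form (GR T f) v w.
Proof.
move=> fI; split; apply: eq_contour_form => psi psiC; apply: eq_ray_int => t t0.
  by rewrite /GL intrinsic_sharp.
by rewrite /GR intrinsic_sharp.
Qed.

End TwoOperators.
End Contour.

(** * Adjoints in the functional calculus *)

Theorem theorem4p12 (R : realType) (d : nat) (hd : (1 <= d)%N)
    (H : completeNormedModType R) (ip : {dot H for @idfun R})
    (hip : norm_from_dot ip)
    (omega : R) (homega : 0 < omega < pi / 2)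
    (T : @oper R d H) (hT : bisectorial omega T)
    (theta : R) (htheta : omega < theta < pi / 2)
    (f : clifford R d -> clifford R d)
    (J : clifford R d) (hJ : imag_unit J)
    (phi : R) (hphi : omega < phi < theta) :
  [/\ SH0_L theta f ->
        exists fTstar fsharpT : hmod d H -> hmod d H,
          [/\ omega_calc_L J phi (adjoint ip T) f fTstar,
              omega_calc_R J phi T (sharp f) fsharpT &
              oper_eq (full_oper fTstar) (adjoint ip (full_oper fsharpT))],
      SH0_R theta f ->
        exists fTstar fsharpT : hmod d H -> hmod d H,
          [/\ omega_calc_R J phi (adjoint ip T) f fTstar,
              omega_calc_L J phi T (sharp f) fsharpT &
              oper_eq (full_oper fTstar) (adjoint ip (full_oper fsharpT))] &
      SH0_L theta f \/ SH0_R theta f -> intrinsic (dsector theta) f ->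
        exists fTstar fT : hmod d H -> hmod d H,
          [/\ omega_calc_L J phi (adjoint ip T) f fTstar /\
              omega_calc_R J phi (adjoint ip T) f fTstar,
              omega_calc_L J phi T f fT /\ omega_calc_R J phi T f fT &
              oper_eq (full_oper fTstar) (adjoint ip (full_oper fT))]].
Proof.
split=> [fL|fR|fLR fI].
- have fok := SH0_contour_ok hJ homega htheta hphi (or_introl fL).
  have [fT cT fTE] := calculus_GR hip hJ homega hT htheta hphi (sharp_contour_ok hJ fok).
  have [fTs cTs dual] := calculus_GL_adjoint hip hJ homega hT htheta hphi fok cT.1 fTE.
  exists fTs, fT; split.
  + exact: (omega_calc_L_Ts hip hJ homega hT htheta hphi cTs).
  + exact: (omega_calc_R_T hJ homega hT htheta hphi cT).
  + exact: (full_oper_adjoint hip cT.1 dual).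
- have fok := SH0_contour_ok hJ homega htheta hphi (or_intror fR).
  have [fT cT fTE] := calculus_GL hip hJ homega hT htheta hphi (sharp_contour_ok hJ fok).
  have [fTs cTs dual] := calculus_GR_adjoint hip hJ homega hT htheta hphi fok cT.1 fTE.
  exists fTs, fT; split.
  + exact: (omega_calc_R_Ts hip hJ homega hT htheta hphi cTs).
  + exact: (omega_calc_L_T hJ homega hT htheta hphi cT).
  + exact: (full_oper_adjoint hip cT.1 dual).
have fok := SH0_contour_ok hJ homega htheta hphi fLR.
have [fT cL fTL] := calculus_GL hip hJ homega hT htheta hphi fok.
have [fT' cR fTR] := calculus_GR hip hJ homega hT htheta hphi fok.
have LR v w := intrinsic_contour_form hip hJ homega hT htheta hphi v w fI fok.
have shE v w := intrinsic_sharp_form ip hJ T homega htheta hphi v w fI.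
have fTT' : fT' = fT.
  apply/funext => v; apply: (hdot_inj hip) => w.
  by rewrite [LHS]hdotC [RHS]hdotC fTL fTR LR.
rewrite {}fTT' in cR fTR.
have fTR' v w : hdot ip w (fT v)
    = (2 * pi)^-1 * contour_form ip J phi (GR T (sharp f)) v w.
  by rewrite fTR (shE v w).2.
have fTL' v w : hdot ip w (fT v)
    = (2 * pi)^-1 * contour_form ip J phi (GL T (sharp f)) v w.
  by rewrite fTL (shE v w).1.
have [fTs cTsL dual] := calculus_GL_adjoint hip hJ homega hT htheta hphi fok cL.1 fTR'.
have [fTs' cTsR dual'] := calculus_GR_adjoint hip hJ homega hT htheta hphi fok cL.1 fTL'.
have fTsE : fTs' = fTs.
  by apply/funext => w; apply: (hdot_inj hip) => v; rewrite dual dual'.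
rewrite {}fTsE in cTsR.
exists fTs, fT; split; last exact: (full_oper_adjoint hip cL.1 dual).
  split; first exact: (omega_calc_L_Ts hip hJ homega hT htheta hphi cTsL).
  exact: (omega_calc_R_Ts hip hJ homega hT htheta hphi cTsR).
split; first exact: (omega_calc_L_T hJ homega hT htheta hphi cL).
exact: (omega_calc_R_T hJ homega hT htheta hphi cR).
Qed.
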